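(* Let $\mathcal U_{\rm uc}$ be an upper cluster algebra with universal coefficient semifield and let $t, t_0$ be two seeds of $\mathcal U_{\rm uc}$. Let $k,j\in\{1,\ldots,n\}$, let $\frac{X_{k;t}}{1+X_{k;t}}M_1+\frac{1}{1+X_{k;t}}M_2$ be the $k$-th exchange binomial of $t$ and $\frac{X_{j;t_0}}{1+X_{j;t_0}}N_1+\frac{1}{1+X_{j;t_0}}N_2$ the $j$-th exchange binomial of $t_0$. (So $M_1=\prod_{b_{ik}^t>0}A_{i;t}^{b_{ik}^t}$, $M_2=\prod_{b_{ik}^t<0}A_{i;t}^{-b_{ik}^t}$, $N_1=\prod_{b_{ij}^{t_0}>0}A_{i;t_0}^{b_{ij}^{t_0}}$, $N_2=\prod_{b_{ij}^{t_0}<0}A_{i;t_0}^{-b_{ij}^{t_0}}$.) Then the following conditions are equivalent. (i) $X_{k;t}=X_{j;t_0}$; (ii) $(A_{k;t}, M_1, M_2)=(A_{j;t_0}, N_1, N_2)$; (iii) $(A_{k;t},\{A_{i;t}\mid b_{ik}^t\neq 0\})=(A_{j;t_0},\{A_{i;t_0}\mid b_{ij}^{t_0}\neq 0\})$; (iv) $A_{k;t}=A_{j;t_0}$ and $\{A_{i;t}\mid b_{ik}^t\neq 0\}\subseteq A_{t_0}$; (v) $(A_{k;t},A_{k;t^\prime})=(A_{j;t_0},A_{j;t_1})$, where $t^\prime=\mu_k(t)$ and $t_1=\mu_j(t_0)$; (vi) $A_{k;t}=A_{j;t_0}$ and $\frac{X_{k;t}}{1+X_{k;t}}M_1+\fr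ac{1}{1+X_{k;t}}M_2=\frac{X_{j;t_0}}{1+X_{j;t_0}}N_1+\frac{1}{1+X_{j;t_0}}N_2$.
   Context: Throughout, $\mathbb K$ is a factorial domain (UFD) of characteristic $0$. A semifield $(\mathbb P,\oplus,\cdot)$ is an abelian multiplicative group with a commutative, associative operation $\oplus$ over which multiplication distributes; $\mathbb{KP}$ is its group ring over $\mathbb K$, and $\mathcal F$ is the field of rational functions in $n$ independent variables with coefficients in $\mathbb{KP}$. An integer $n\times n$ matrix $B$ is skew-symmetrizable if $SB$ is skew-symmetric for some integer diagonal matrix $S$ with positive diagonal entries. A (labeled) $\mathscr A$-seed over $\mathbb P$ is a triple $(B,X,A)$ with $B=(b_{ij})$ an $n\times n$ skew-symmetrizable integer matrix, $X=(X_1,\ldots,X_n)\in\mathbb P^n$, and $A=(A_1,\ldots,A_n)$ a free generating set of $\mathcal F$ over $\mathbb{KP}$. Its $k$-th exchange binomial is $P_k=\frac{X_k}{1\oplus X_k}\prod_{b_{jk}>0}A_j^{b_{jk}}+\frac{1}{1\oplus X_k}\prod_{b_{jk}<0}A_j^{-b_{jk}}$. The mutation $\mu_k(B,X,A)=(B',X',A')$ is: $b'_{ij}=-b_{ij}$ if $i=k$ or $j=k$, else $b'_{ij}=b_{ij}+\mathrm{sgn}(b_{ik})\max(b_{ik}b_{kj},0)$; $X'_k=X_k^{-1}$ and $X'_i=X_iX_k^{\max(b_{ki},0)}(1\oplus X_k)^{-b_{ki}}$ for $i\ne k$; $A'_i=A_i$ for $i\neq k$ and $A'_k=A_k^{-1}P_k$.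 Let $\mathbb T_n$ be the $n$-regular tree with edges labeled $1,\ldots,n$ so that edges at each vertex have distinct labels. An $\mathscr A$-seed pattern assigns to each vertex $t$ a seed $(B_t,X_t,A_t)$, $B_t=(b^t_{ij})$, $X_t=(X_{1;t},\ldots,X_{n;t})$, $A_t=(A_{1;t},\ldots,A_{n;t})$, such that seeds at vertices joined by an edge labeled $k$ are related by $\mu_k$. A vertex and its seed are denoted by the same letter. The upper cluster algebra is $\mathcal U=\bigcap_{t}\mathbb{KP}[A_{1;t}^{\pm1},\ldots,A_{n;t}^{\pm1}]$. The $A_{k;t}$ are the cluster variables, $A_t$ is the cluster at $t$ (also viewed as a set). Standing assumption: no exchange binomial is invertible in $\mathbb{KP}$. Universal coefficient semifield: $\mathbb P=\mathbb Q_{\rm sf}(X_{1;t_*},\ldots,X_{n;t_*})$ for some seed $t_*$, i.e. $\mathbb P$ is the semifield (usual multiplication and addition) of all non-zero rational functions in independent variables $X_{1;t_*},\ldots,X_{n;t_*}$ that can be written as subtraction-free rational expressions. Here $\oplus$ is the usual addition of $\mathbb Q_{\rm sf}$; in the exchange binomials the coefficients $\frac{X_{k;t}}{1+X_{k;t}},\frac1{1+X_{k;t}}$ are elements of $\mathbb P$, viewed as elements of the group ring $\mathbb{KP}$, while the outer addition is that of $\mathcal F$. *)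

(* Defs.v *)
From HB Require Import structures.
From mathcomp Require Import all_boot all_order all_algebra.
From mathcomp Require Import finmap mpoly.
From mathcomp Require monalg.
From mathcomp Require Import boolp.

Set Implicit Arguments.
Unset Strict Implicit.
Unset Printing Implicit Defensive.

Import Order.TTheory GRing.Theory Num.Theory.
Local Open Scope ring_scope.

Definition irreducible_elt (K : idomainType) (a : K) : Prop :=
  [/\ a != 0, a \isn't a GRing.unit
    & forall b c, a = b * c -> b \is a GRing.unit \/ c \is a GRing.unit].

Definition associates (K : idomainType) (a b : K) : Prop :=
  exists2 u : K, u \is a GRing.unit & b = u * a.

Definition factorial_domain (K : idomainType) : Prop :=
  (forall a : K, a != 0 -> exists (u : K) (s : seq K),
     [/\ u \is a GRing.unit, {in s, forall p, irreducible_elt p}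
       & a = u * \prod_(p <- s) p]) /\
  (forall s1 s2 : seq K,
     {in s1, forall p, irreducible_elt p} ->
     {in s2, forall p, irreducible_elt p} ->
     associates (\prod_(p <- s1) p) (\prod_(p <- s2) p) ->
     exists s : seq K, [/\ perm_eq s2 s, size s = size s1
       & forall i, (i < size s1)%N -> associates s1`_i s`_i]).

HB.mixin Record isSemifield P of monoid.Group P := {
  oplus : P -> P -> P;
  mulgC_subproof : commutative (@monoid.mul P);
  oplusA : associative oplus;
  oplusC : commutative oplus;
  mulg_oplusr : right_distributive (@monoid.mul P) oplus
}.

#[short(type="semifieldType")]
HB.structure Definition Semifield := {P of isSemifield P & monoid.Group P}.

Definition expgz (G : groupType) (x : G) (m : int) : G :=
  match m with Posz d => (x ^+ d)%g | Negz d => (x ^- d.+1)%g end.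

Section Universal.
Variable n : nat.

Definition ratfun := {fraction {mpoly rat[n]}}.

(* The values of subtraction-free rational expressions; every value is a
   nonzero rational function, see [subtraction_free_neq0].  The constructor
   [sf_one] matters for n = 0 only, since 1 = X_i / X_i. *)
Inductive subtraction_free : ratfun -> Prop :=
| sf_var (i : 'I_n) : subtraction_free (tofrac 'X_i)
| sf_one : subtraction_free 1
| sf_add x y : subtraction_free x -> subtraction_free y ->
    subtraction_free (x + y)
| sf_mul x y : subtraction_free x -> subtraction_free y ->
    subtraction_free (x * y)
| sf_div x y : subtraction_free x -> subtraction_free y ->
    subtraction_free (x / y).

Definition sfpred : pred ratfun := fun x => `[< subtraction_free x >].

(* Evaluation at (1, ..., 1) is positive on numerators and denominators. *)
Lemma subtraction_free_frac x : subtraction_free x ->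
  exists p q : {mpoly rat[n]},
    [/\ 0 < p.@[fun=> 1], 0 < q.@[fun=> 1] & x = tofrac p / tofrac q].
Proof.
have nz (p : {mpoly rat[n]}) : 0 < p.@[fun=> 1] -> tofrac p != 0.
  by move=> p0; rewrite tofrac_eq0; apply: contraTneq p0 => ->; rewrite meval0.
elim=> {x} [i||x y _ [p [q [p0 q0 ->]]] _ [r [s [r0 s0 ->]]]
  |x y _ [p [q [p0 q0 ->]]] _ [r [s [r0 s0 ->]]]
  |x y _ [p [q [p0 q0 ->]]] _ [r [s [r0 s0 ->]]]].
- by exists 'X_i, 1; rewrite mevalXU meval1 tofrac1 divr1.
- by exists 1, 1; rewrite meval1 tofrac1 divr1.
- exists (p * s + r * q), (q * s); split.
  + by rewrite mevalD !mevalM addr_gt0 ?mulr_gt0.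
  + by rewrite mevalM mulr_gt0.
  + by rewrite tofracD !tofracM addf_div ?nz.
- exists (p * r), (q * s); split; rewrite ?mevalM ?mulr_gt0 //.
  by rewrite !tofracM mulf_div.
- exists (p * s), (q * r); split; rewrite ?mevalM ?mulr_gt0 //.
  by rewrite !tofracM invf_div mulf_div.
Qed.

Lemma subtraction_free_neq0 x : subtraction_free x -> x != 0.
Proof.
case/subtraction_free_frac => p [q [p0 q0 ->]].
rewrite mulf_neq0 ?invr_eq0 // tofrac_eq0.
- by apply: contraTneq p0 => ->; rewrite meval0.
- by apply: contraTneq q0 => ->; rewrite meval0.
Qed.

Record Qsf := MkQsf { Qsf_val :> ratfun; _ : sfpred Qsf_val }.
HB.instance Definition _ := [isSub for Qsf_val].
HB.instance Definition _ := [Choice of Qsf by <:].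

Lemma Qsf_sf (x : Qsf) : subtraction_free (Qsf_val x).
Proof. exact/asboolP/(valP x). Qed.

Definition mkQsf x (hx : subtraction_free x) : Qsf := MkQsf (asboolT hx).

Definition Qsf_one := mkQsf sf_one.
Definition Qsf_add (x y : Qsf) := mkQsf (sf_add (Qsf_sf x) (Qsf_sf y)).
Definition Qsf_mul (x y : Qsf) := mkQsf (sf_mul (Qsf_sf x) (Qsf_sf y)).
Definition Qsf_inv (x : Qsf) : Qsf := mkQsf (sf_div sf_one (Qsf_sf x)).
Definition Qsf_var (i : 'I_n) : Qsf := mkQsf (sf_var i).

Fact Qsf_mulA : associative Qsf_mul.
Proof. by move=> x y z; apply: val_inj; rewrite /= mulrA. Qed.
Fact Qsf_mulC : commutative Qsf_mul.
Proof. by move=> x y; apply: val_inj; rewrite /= mulrC. Qed.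
Fact Qsf_mul1 : left_id Qsf_one Qsf_mul.
Proof. by move=> x; apply: val_inj; rewrite /= mul1r. Qed.
Fact Qsf_mulr1 : right_id Qsf_one Qsf_mul.
Proof. by move=> x; rewrite Qsf_mulC Qsf_mul1. Qed.
Fact Qsf_mulV : left_inverse Qsf_one Qsf_inv Qsf_mul.
Proof.
move=> x; apply: val_inj => /=.
by rewrite mul1r mulVf // subtraction_free_neq0 //; apply: Qsf_sf.
Qed.
Fact Qsf_mulrV : right_inverse Qsf_one Qsf_inv Qsf_mul.
Proof. by move=> x; rewrite Qsf_mulC Qsf_mulV. Qed.

HB.instance Definition _ := isGroup.Build Qsf
  Qsf_mulA Qsf_mul1 Qsf_mulr1 Qsf_mulV Qsf_mulrV.

Fact Qsf_addA : associative Qsf_add.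
Proof. by move=> x y z; apply: val_inj; rewrite /= addrA. Qed.
Fact Qsf_addC : commutative Qsf_add.
Proof. by move=> x y; apply: val_inj; rewrite /= addrC. Qed.
Fact Qsf_mulD : right_distributive Qsf_mul Qsf_add.
Proof. by move=> x y z; apply: val_inj; rewrite /= mulrDr. Qed.

HB.instance Definition _ := isSemifield.Build Qsf
  Qsf_mulC Qsf_addA Qsf_addC Qsf_mulD.

End Universal.

(* The additive group is [malg]; the ring structure that the library puts on
   [malg] requires a monoid without nontrivial units, hence does not apply. *)
Section GroupRing.
Import monalg.
Local Open Scope fset_scope.
Local Open Scope ring_scope.
Variables (K : comNzRingType) (P : semifieldType).

Definition grpring : Type := monalg.malg P K.
HB.instance Definition _ := GRing.Zmodule.on grpring.

Implicit Types g : grpring.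

Definition gr_mono (c : K) (x : P) : grpring := monalg.mkmalgU x c.
Definition gr_elt (x : P) : grpring := gr_mono 1 x.

Definition gr_mul g1 g2 : grpring :=
  \sum_(x <- monalg.msupp g1) \sum_(y <- monalg.msupp g2)
    gr_mono (monalg.mcoeff x g1 * monalg.mcoeff y g2) (x * y)%g.

Lemma gr_monoD x c d : gr_mono (c + d) x = gr_mono c x + gr_mono d x.
Proof. exact: monalg.monalgUD. Qed.
Lemma gr_mono0 x : gr_mono 0 x = 0.
Proof. exact: monalg.monalgU0. Qed.
Lemma gr_monoE g :
  g = \sum_(x <- monalg.msupp g) gr_mono (monalg.mcoeff x g) x.
Proof. exact: monalg.monalgE. Qed.

Lemma gr_mulw (d1 d2 : {fset P}) g1 g2 :
  monalg.msupp g1 `<=` d1 -> monalg.msupp g2 `<=` d2 ->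
  gr_mul g1 g2 = \sum_(x <- d1) \sum_(y <- d2)
    gr_mono (monalg.mcoeff x g1 * monalg.mcoeff y g2) (x * y)%g.
Proof.
move=> le1 le2; rewrite /gr_mul (big_fset_incl _ le1) /=; last first.
  move=> x _ /monalg.mcoeff_outdom ->.
  by rewrite big1 // => y _; rewrite mul0r gr_mono0.
apply/eq_bigr => x _; rewrite (big_fset_incl _ le2) //= => y _.
by move=> /monalg.mcoeff_outdom ->; rewrite mulr0 gr_mono0.
Qed.

Fact gr_mulC : commutative gr_mul.
Proof.
move=> g1 g2; rewrite /gr_mul exchange_big /=.
by apply/eq_bigr=> x _; apply/eq_bigr=> y _; rewrite mulrC mulgC_subproof.
Qed.

Fact gr_mulDl : left_distributive gr_mul +%R.
Proof.
move=> g1 g2 g.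
pose d := monalg.msupp g1 `|` monalg.msupp g2.
rewrite (@gr_mulw d (monalg.msupp g) (g1 + g2)) ?monalg.msuppD_le //.
rewrite (@gr_mulw d (monalg.msupp g) g1) ?fsubsetUl //.
rewrite (@gr_mulw d (monalg.msupp g) g2) ?fsubsetUr //.
rewrite -big_split /=; apply/eq_bigr=> x _.
rewrite -big_split /=; apply/eq_bigr=> y _.
by rewrite monalg.mcoeffD mulrDl gr_monoD.
Qed.

Fact gr_mulDr : right_distributive gr_mul +%R.
Proof. by move=> g g1 g2; rewrite gr_mulC gr_mulDl !(gr_mulC g). Qed.

Fact gr_mul0 : left_zero 0 gr_mul.
Proof. by move=> g; apply: (addrI (gr_mul 0 g)); rewrite -gr_mulDl !addr0. Qed.

Fact gr_mulr0 : right_zero 0 gr_mul.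
Proof. by move=> g; rewrite gr_mulC gr_mul0. Qed.

Lemma gr_mul_mono c d x y :
  gr_mul (gr_mono c x) (gr_mono d y) = gr_mono (c * d) (x * y)%g.
Proof.
rewrite (@gr_mulw [fset x] [fset y]) ?monalg.msuppU_le //.
by rewrite !big_seq_fset1 !monalg.mcoeffUU.
Qed.

Lemma gr_mul_suml g (I : Type) (r : seq I) (F : I -> grpring) :
  gr_mul (\sum_(i <- r) F i) g = \sum_(i <- r) gr_mul (F i) g.
Proof. exact: (big_morph (gr_mul^~ g) (fun _ _ => gr_mulDl _ _ _) (gr_mul0 g)).
Qed.

Lemma gr_mul_sumr g (I : Type) (r : seq I) (F : I -> grpring) :
  gr_mul g (\sum_(i <- r) F i) = \sum_(i <- r) gr_mul g (F i).
Proof. exact: (big_morph (gr_mul g) (fun _ _ => gr_mulDr _ _ _) (gr_mulr0 g)).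
Qed.

Fact gr_mulA : associative gr_mul.
Proof.
move=> g1 g2 g3; rewrite (gr_monoE g1) !gr_mul_suml; apply/eq_bigr=> x _.
rewrite (gr_monoE g2) gr_mul_suml !gr_mul_sumr gr_mul_suml.
apply/eq_bigr=> y _; rewrite (gr_monoE g3) !gr_mul_sumr.
by apply/eq_bigr=> z _; rewrite !gr_mul_mono mulrA mulgA.
Qed.

Fact gr_mul1 : left_id (gr_elt 1%g) gr_mul.
Proof.
move=> g; rewrite [in LHS](gr_monoE g) gr_mul_sumr [RHS]gr_monoE.
by apply/eq_bigr=> x _; rewrite gr_mul_mono mul1r mul1g.
Qed.

Fact gr_oner_neq0 : gr_elt 1%g != 0.
Proof.
apply/eqP => /(congr1 (@monalg.mcoeff P K 1%g)) /eqP.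
by rewrite monalg.mcoeffUU monalg.mcoeff0 oner_eq0.
Qed.

HB.instance Definition _ := GRing.Zmodule_isComNzRing.Build grpring
  gr_mulA gr_mulC gr_mul1 gr_mulDl gr_oner_neq0.

End GroupRing.

Section Ambient.
Variables (R : comNzRingType) (F : fieldType) (iota : {rmorphism R -> F}).

(* Evaluation at [z] of polynomials with coefficients in [R] is injective (in
   particular so is [iota]), and F is the field of fractions of its image. *)
Definition free_generating (n : nat) (z : 'I_n -> F) : Prop :=
  injective (mmap iota z) /\
  (forall x : F, exists p q : {mpoly R[n]},
     q != 0 /\ x = mmap iota z p / mmap iota z q).

Definition is_ratfun_field (n : nat) : Prop :=
  exists z : 'I_n -> F, free_generating z.

Definition invertible_in (x : F) : Prop :=
  exists u v : R, u * v = 1 /\ x = iota u.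

End Ambient.

Definition skew_symmetrizable (n : nat) (B : 'M[int]_n) : Prop :=
  exists2 s : 'rV[int]_n, (forall i, 0 < s 0 i)
    & (diag_mx s *m B)^T = - (diag_mx s *m B).

Record seed (n : nat) (P F : Type) := Seed {
  seedB : 'M[int]_n;
  seedX : {ffun 'I_n -> P};
  seedA : {ffun 'I_n -> F} }.

Section Seeds.
Variables (K : comNzRingType) (P : semifieldType) (F : fieldType).
Variables (iota : {rmorphism grpring K P -> F}) (n : nat).
Implicit Types (s : seed n P F) (k : 'I_n).

Definition is_seed s : Prop :=
  skew_symmetrizable (seedB s) /\ free_generating iota (seedA s).

Definition exch_pos s k : F :=
  \prod_(i | 0 < seedB s i k) seedA s i ^ seedB s i k.
Definition exch_neg s k : F :=
  \prod_(i | seedB s i k < 0) seedA s i ^ (- seedB s i k).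

Definition exch_binomial s k : F :=
  let Xk := seedX s k in
  iota (gr_elt K (Xk / oplus 1 Xk)%g) * exch_pos s k
  + iota (gr_elt K (oplus 1 Xk)^-1%g) * exch_neg s k.

Definition mutB (B : 'M[int]_n) k : 'M[int]_n :=
  \matrix_(i, j) if (i == k) || (j == k) then - B i j
    else B i j + Num.sg (B i k) * Num.max (B i k * B k j) 0.

Definition mutX s k : {ffun 'I_n -> P} :=
  [ffun i => let B := seedB s in let X := seedX s in
    if i == k then (X k)^-1%g
    else (X i * expgz (X k) (Num.max (B k i) 0)
              * expgz (oplus 1 (X k)) (- B k i))%g].

Definition mutA s k : {ffun 'I_n -> F} :=
  [ffun i => if i == k then (seedA s k)^-1 * exch_binomial s k
             else seedA s i].

Definition mutation k s : seed n P F :=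
  Seed (mutB (seedB s) k) (mutX s k) (mutA s k).

Local Open Scope fset_scope.

Definition cluster s : {fset F} := [fset seedA s i | i : 'I_n].

Definition exch_support s k : {fset F} :=
  [fset seedA s i | i : 'I_n & seedB s i k != 0].

End Seeds.

(* A vertex is the word of edge labels, read backwards, of the reduced path to
   it from a base point. *)
Definition tree (n : nat) : Type :=
  {w : seq 'I_n | sorted (fun i j => i != j) w}.

Definition tree_step (n : nat) (k : 'I_n) (w : seq 'I_n) : seq 'I_n :=
  if w is i :: w' then if i == k then w' else k :: w else [:: k].

Fact tree_step_sorted n (k : 'I_n) (w : seq 'I_n) :
  sorted (fun i j => i != j) w -> sorted (fun i j => i != j) (tree_step k w).
Proof.
case: w => //= i w hw; case: eqP => [_|/eqP ik]; first exact: path_sorted hw.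
by rewrite /= eq_sym ik.
Qed.

(* The vertex joined to [t] by the edge labeled [k]. *)
Definition nbr n (k : 'I_n) (t : tree n) : tree n :=
  exist _ (tree_step k (val t)) (tree_step_sorted k (valP t)).

Lemma nbrK n (k : 'I_n) : involutive (nbr k).
Proof.
case=> w hw; apply: val_inj => /=; case: w hw => [|i w] /= hw.
  by rewrite eqxx.
case: eqP => [ik|] /=; last by rewrite eqxx.
subst i; case: w hw => [|j w] //= /andP[kj _].
by rewrite eq_sym (negbTE kj).
Qed.

Definition seed_pattern (K : comNzRingType) (P : semifieldType)
    (F : fieldType) (iota : {rmorphism grpring K P -> F}) (n : nat)
    (S : tree n -> seed n P F) : Prop :=
  (forall t, is_seed iota (S t)) /\
  (forall t k, S (nbr k t) = mutation iota k (S t)).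

(* Main.v *)
(** Write [y_{k;t} = X_{k;t} * prod_i A_{i;t}^{b_{ik}}].  Freeness of the
    semifield gives a homomorphism [psi : P -> F] with [psi X_{k;t} = y_{k;t}]
    at every seed, and mutating from [t0] shows that each cluster variable is
    separated: a Laurent monomial in [A_{t0}] times [psi h / h], [h] in [P].

    Since [P] contains the [X_{k;t}], the exchange binomials of [t] become units
    times the distinct primes [1 + y_{k;t}].  Evaluation at these primes shows
    that lying in the Laurent rings of [t] and of all its neighbours is invariant
    under mutation, hence suffices for lying in every Laurent ring; in particular
    cluster variables do.

    The derivations with [{X_{i;t}, A_{l;t}} = delta_{il} s_i A_{l;t}], suitably
    normalized, are the same for all seeds [t], where [s] symmetrizes all [B_t].
    If [X_{k;t} = X_{j;t0}], then [A_{k;t}] is an eigenvector of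
    [{X_{j;t0}, -}], so it is homogeneous in [A_{j;t0}], of degree 1, and
    [A_{k;t} / A_{j;t0}] satisfies the criterion above at [t0].  So does its
    inverse; being separated, this unit is a monomial, and one with nonnegative
    exponents in both directions, hence it is 1.  Applied to the mutated seeds,
    whose variables are [X^-1], this gives (ii), (iii) and (v).

    Conversely, under (iv) [y_{k;t} = X_{k;t}] times a monomial in [A_{t0}], which
    forces [X_{k;t}] to be a Laurent monomial in [X_{t0}]; evaluating at
    [1 + y_{j;t0}] leaves only powers of [X_{j;t0}], symmetry leaves
    [X_{j;t0}^(+-1)], and the bracket with [A_{k;t} = A_{j;t0}] fixes the sign.
    Under (vi), setting [A_{t0} = 1] turns the two binomials into
    [a + b = Y^m (1 + Y_j)] with [a / b = X_{k;t}], and the bracket gives an Euler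
    identity [s_k a b = s_j Y_j (a_{Y_j} b - a b_{Y_j})], which only
    [a = Y^m Y_j], [b = Y^m] solve. *)
From HB Require Import structures.
Require Import Defs.
From mathcomp Require Import all_boot all_order all_algebra.
From mathcomp Require Import finmap mpoly.
From mathcomp Require Import ring zify.
From mathcomp Require boolp.

Set Implicit Arguments.
Unset Strict Implicit.
Unset Printing Implicit Defensive.

Import Order.TTheory GRing.Theory Num.Theory.
Local Open Scope ring_scope.

(** * Subtraction-free expressions *)

(** Elements of [P] enter [F] in two unrelated ways. Through [coef] distinct elements are linearly
    independent over [K] and [oplus] is invisible; through [psi] they become functions of the [y],
    and [oplus] becomes addition. The specialization [phi] tells the two apart: it sends [psi x] to
    [x] written as a rational function of the coefficients of [t0], but [coef x] only to the
    monomial of its degree. An equation between the two kinds therefore forces monomials. The primes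
    [1 + y_i] are handled without factorization theory in Laurent rings. A homomorphism from [P] to
    the integers that is 1 on [X_i] and 0 on the other [X_l] lets [y_i] be sent to -1 while the
    cluster stays fixed; a Laurent polynomial is congruent to its value modulo [1 + y_i], so this
    element generates the kernel. Values form a relation and not a function, because not every
    element of [F] specializes. *)

Inductive sfx (n : nat) :=
| SfOne
| SfVar of 'I_n
| SfAdd of sfx n & sfx n
| SfMul of sfx n & sfx n
| SfDiv of sfx n & sfx n.
Arguments SfOne {n}.

(** [subtraction_free] is a proposition and cannot be recursed on to build maps; expressions make
    its derivations computable. *)
Fixpoint sfx_semifield n (T : semifieldType) (z : 'I_n -> T) (e : sfx n) : T :=
  match e with
  | SfOne => 1%g
  | SfVar i => z i
  | SfAdd a b => oplus (sfx_semifield z a) (sfx_semifield z b)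
  | SfMul a b => (sfx_semifield z a * sfx_semifield z b)%g
  | SfDiv a b => (sfx_semifield z a / sfx_semifield z b)%g
  end.

Fixpoint sfx_field n (E : fieldType) (z : 'I_n -> E) (e : sfx n) : E :=
  match e with
  | SfOne => 1
  | SfVar i => z i
  | SfAdd a b => sfx_field z a + sfx_field z b
  | SfMul a b => sfx_field z a * sfx_field z b
  | SfDiv a b => sfx_field z a / sfx_field z b
  end.

(** The fraction stays unreduced and depends on the expression, not only on its value. Integer
    coefficients let it be mapped both to [F] and to polynomials over [K]. *)
Fixpoint sfx_frac n (e : sfx n) : {mpoly int[n]} * {mpoly int[n]} :=
  match e with
  | SfOne => (1, 1)
  | SfVar i => ('X_i, 1)
  | SfAdd a b => let (p, q) := sfx_frac a in let (p', q') := sfx_frac b in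
      (p * q' + p' * q, q * q')
  | SfMul a b => let (p, q) := sfx_frac a in let (p', q') := sfx_frac b in
      (p * p', q * q')
  | SfDiv a b => let (p, q) := sfx_frac a in let (p', q') := sfx_frac b in
      (p * q', q * p')
  end.

Notation sfx_num e := (sfx_frac e).1.
Notation sfx_den e := (sfx_frac e).2.

Definition int_eval n (E : comNzRingType) (z : 'I_n -> E) : {mpoly int[n]} -> E :=
  mmap (intmul 1) z.
HB.instance Definition _ n (E : comNzRingType) (z : 'I_n -> E) :=
  GRing.RMorphism.on (int_eval z).

(** A substitute for positivity in fields without an order: subtraction-free expressions evaluated
    inside such a set never meet a zero denominator. *)
Record positive_cone (E : fieldType) (C : E -> Prop) : Prop := PositiveCone {
  cone1 : C 1;
  coneD : forall x y, C x -> C y -> C (x + y);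
  coneM : forall x y, C x -> C y -> C (x * y);
  coneV : forall x, C x -> C x^-1;
  cone_neq0 : forall x, C x -> x != 0 }.

Lemma int_evalX n (E : comNzRingType) (z : 'I_n -> E) i : int_eval z 'X_i = z i.
Proof. by rewrite /int_eval mmapX mmap1U. Qed.

Section Cone.
Variables (n : nat) (E : fieldType) (C : E -> Prop).
Hypothesis coneC : positive_cone C.

Lemma cone_prod (I : Type) (r : seq I) (P : pred I) (f : I -> E) :
  (forall i, C (f i)) -> C (\prod_(i <- r | P i) f i).
Proof.
by move=> Cf; elim/big_ind: _ => //; [exact: cone1 | exact: coneM].
Qed.

Lemma cone_exp x (m : nat) : C x -> C (x ^+ m).
Proof.
move=> Cx; elim: m => [|m IH]; first by rewrite expr0; apply: cone1.
by rewrite exprS; apply: coneM.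
Qed.

Lemma cone_expz x (m : int) : C x -> C (x ^ m).
Proof.
move=> Cx; case: m => m; first exact: cone_exp.
by rewrite NegzE -exprnN; apply: (coneV coneC); apply: cone_exp.
Qed.

Variable z : 'I_n -> E.
Hypothesis Cz : forall i, C (z i).

Lemma sfx_cone e :
  [/\ C (int_eval z (sfx_num e)), C (int_eval z (sfx_den e)) &
      sfx_field z e = int_eval z (sfx_num e) / int_eval z (sfx_den e)].
Proof.
have nz := cone_neq0 coneC.
elim: e => [|i|a [Ca Cb ea] b [Cc Cd eb]|a [Ca Cb ea] b [Cc Cd eb]
  |a [Ca Cb ea] b [Cc Cd eb]] /=.
- by rewrite rmorph1 divr1; split=> //; apply: cone1.
- by rewrite int_evalX rmorph1 divr1; split=> //; apply: cone1.
- rewrite ea eb; move: Ca Cb Cc Cd {ea eb}.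
  case: (sfx_frac a) => p q; case: (sfx_frac b) => p' q' /= Ca Cb Cc Cd.
  rewrite rmorphD !rmorphM; split.
  + by apply: coneD => //; apply: coneM.
  + exact: coneM.
  + by rewrite addf_div ?nz.
- rewrite ea eb; move: Ca Cb Cc Cd {ea eb}.
  case: (sfx_frac a) => p q; case: (sfx_frac b) => p' q' /= Ca Cb Cc Cd.
  by rewrite !rmorphM; split; rewrite ?mulf_div //; apply: coneM.
- rewrite ea eb; move: Ca Cb Cc Cd {ea eb}.
  case: (sfx_frac a) => p q; case: (sfx_frac b) => p' q' /= Ca Cb Cc Cd.
  by rewrite !rmorphM; split; rewrite ?invf_div ?mulf_div //; apply: coneM.
Qed.

Lemma sfx_field_cone e : C (sfx_field z e).
Proof. by case: (sfx_cone e) => a b ->; apply: coneM => //; apply: coneV. Qed.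

End Cone.

Lemma mpoly_rmorph_eq n (R S : nzRingType) (f g : {rmorphism {mpoly R[n]} -> S}) :
  (forall c, f c%:MP = g c%:MP) -> (forall i, f 'X_i = g 'X_i) -> f =1 g.
Proof.
move=> fgC fgX p; rewrite (mpolyE p) !rmorph_sum; apply: eq_bigr => m _ /=.
rewrite -mul_mpolyC !rmorphM fgC mpolyXE_id; congr (_ * _).
by rewrite !rmorph_prod; apply: eq_bigr => i _; rewrite !rmorphXn fgX.
Qed.

Lemma int_eval_tofrac n (R : idomainType) (p : {mpoly int[n]}) :
  int_eval (fun i => tofrac ('X_i : {mpoly R[n]})) p
  = tofrac (map_mpoly (intmul 1) p).
Proof.
rewrite -[RHS]/((@tofrac {mpoly R[n]} \o map_mpoly (intmul 1)) p).
apply: mpoly_rmorph_eq => [c|i] /=.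
  rewrite /int_eval mmapC map_mpolyC ?rmorph0 //=.
  by rewrite !rmorph_int.
by rewrite int_evalX map_mpolyX.
Qed.

Lemma map_mpoly_int_inj n (R : nzRingType) : (forall m : int, (m%:~R == 0 :> R) = (m == 0)) ->
  injective (map_mpoly (intmul 1 : int -> R) : {mpoly int[n]} -> {mpoly R[n]}).
Proof.
move=> R0; apply: raddf_inj => p /mpolyP p0; apply/mpolyP => m.
have := p0 m; rewrite mcoeff_map_mpoly !mcoeff0 => /eqP.
by rewrite R0 => /eqP.
Qed.

Section Qsf.
Variable n : nat.
Implicit Types (e : sfx n) (x y : Qsf n).

Definition sfx_val e : Qsf n := sfx_semifield (@Qsf_var n) e.

Lemma cone_subtraction_free : positive_cone (@subtraction_free n).
Proof.
split.
- exact: sf_one.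
- exact: sf_add.
- exact: sf_mul.
- by move=> x sx; rewrite -div1r; apply: sf_div => //; apply: sf_one.
- exact: subtraction_free_neq0.
Qed.

Lemma sfx_semifield_val (X : 'I_n -> Qsf n) e :
  Qsf_val (sfx_semifield X e) = sfx_field (fun i => Qsf_val (X i)) e.
Proof.
elim: e => //= a IHa b IHb; rewrite -?IHa -?IHb //.
by rewrite div1r.
Qed.

Lemma sfx_val_surj x : exists e, sfx_val e = x.
Proof.
suff [e he] : exists e, Qsf_val (sfx_val e) = Qsf_val x.
  by exists e; apply: val_inj.
elim: (Qsf_sf x) => [i||u v _ [a <-] _ [b <-]|u v _ [a <-] _ [b <-]
  |u v _ [a <-] _ [b <-]].
- by exists (SfVar i).
- by exists SfOne.
- by exists (SfAdd a b).
- by exists (SfMul a b).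
- by exists (SfDiv a b); rewrite -[RHS]/(_ * _) -div1r.
Qed.

Lemma int_eval_inj :
  injective (int_eval (fun i : 'I_n => Qsf_val (Qsf_var i))).
Proof.
move=> p q; rewrite !int_eval_tofrac => /eqP; rewrite tofrac_eq => /eqP.
by apply: map_mpoly_int_inj => m; rewrite intr_eq0.
Qed.

(** The variables are algebraically independent, so equal values give equal cross products. Hence
    evaluation at points of a positive cone depends only on the value of the expression: this is the
    freeness of [Qsf], which makes [sf_hom] a homomorphism. *)
Lemma sfx_val_frac e e' : sfx_val e = sfx_val e' ->
  sfx_num e * sfx_den e' = sfx_num e' * sfx_den e.
Proof.
move=> /(congr1 (@Qsf_val n)); rewrite !sfx_semifield_val.
set z := fun i => _.
have Cz i : subtraction_free (z i) by apply: Qsf_sf.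
case: (sfx_cone cone_subtraction_free Cz e) => Ca Cb ->.
case: (sfx_cone cone_subtraction_free Cz e') => Cc Cd -> /eqP.
rewrite eqr_div ?subtraction_free_neq0 // -!rmorphM => /eqP.
exact: int_eval_inj.
Qed.

Lemma sfx_frac_neq0 e : (sfx_num e != 0) /\ (sfx_den e != 0).
Proof.
have Cz i : subtraction_free (Qsf_val (Qsf_var i : Qsf n)) by apply: Qsf_sf.
case: (sfx_cone cone_subtraction_free Cz e) => /subtraction_free_neq0 h1.
move=> /subtraction_free_neq0 h2 _; split.
  by apply: contraNneq h1 => ->; rewrite rmorph0.
by apply: contraNneq h2 => ->; rewrite rmorph0.
Qed.

Definition sfx_rep x : sfx n := sval (boolp.cid (sfx_val_surj x)).
Lemma sfx_repK x : sfx_val (sfx_rep x) = x.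
Proof. by rewrite /sfx_rep; case: boolp.cid. Qed.

Section Hom.
Variables (E : fieldType) (C : E -> Prop) (z : 'I_n -> E).
Hypotheses (coneC : positive_cone C) (Cz : forall i, C (z i)).

Definition sf_hom x : E := sfx_field z (sfx_rep x).

Lemma sf_homE e : sf_hom (sfx_val e) = sfx_field z e.
Proof.
rewrite /sf_hom; set e' := sfx_rep _.
case: (sfx_cone coneC Cz e) => Ca Cb ->.
case: (sfx_cone coneC Cz e') => Cc Cd ->.
have nz := cone_neq0 coneC.
apply/eqP; rewrite eqr_div ?nz // -!rmorphM (@sfx_val_frac e' e) //.
exact: sfx_repK.
Qed.

Lemma sf_hom_cone x : C (sf_hom x).
Proof. exact: sfx_field_cone. Qed.
Lemma sf_homM x y : sf_hom (x * y)%g = sf_hom x * sf_hom y.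
Proof.
rewrite -[in LHS](sfx_repK x) -[in LHS](sfx_repK y).
exact: (sf_homE (SfMul _ _)).
Qed.
Lemma sf_homD x y : sf_hom (oplus x y) = sf_hom x + sf_hom y.
Proof.
rewrite -[in LHS](sfx_repK x) -[in LHS](sfx_repK y).
exact: (sf_homE (SfAdd _ _)).
Qed.
Lemma sf_hom1 : sf_hom 1%g = 1.
Proof. exact: (sf_homE SfOne). Qed.
Lemma sf_homV x : sf_hom x^-1%g = (sf_hom x)^-1.
Proof.
have nz := cone_neq0 coneC (sf_hom_cone x).
apply: (mulIf nz); rewrite -sf_homM mulVf // -sf_hom1.
by congr sf_hom; rewrite mulVg.
Qed.
Lemma sf_hom_var i : sf_hom (Qsf_var i) = z i.
Proof. exact: (sf_homE (SfVar i)). Qed.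

(** Logarithmic derivative in direction [l], evaluated at [z]. Additivity on products lets it
    descend to fractions and to [Qsf]. *)
Definition dlog l (p : {mpoly int[n]}) : E :=
  z l * int_eval z (mderiv l p) / int_eval z p.

Lemma dlogM l p q : int_eval z p != 0 -> int_eval z q != 0 ->
  dlog l (p * q) = dlog l p + dlog l q.
Proof.
move=> p0 q0; rewrite /dlog mderivM rmorphD !rmorphM.
by field; rewrite p0 q0.
Qed.

Definition sfx_dlog l e : E := dlog l (sfx_num e) - dlog l (sfx_den e).
Definition sf_dlog l x : E := sfx_dlog l (sfx_rep x).

Lemma sf_dlogE l e : sf_dlog l (sfx_val e) = sfx_dlog l e.
Proof.
rewrite /sf_dlog /sfx_dlog; set e' := sfx_rep _.
case: (sfx_cone coneC Cz e) => Ca Cb _.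
case: (sfx_cone coneC Cz e') => Cc Cd _.
have nz := cone_neq0 coneC.
have := @sfx_val_frac e' e (sfx_repK _) => /(congr1 (dlog l)).
rewrite !dlogM ?nz // => h.
by apply/eqP; rewrite subr_eq addrAC eq_sym subr_eq h.
Qed.

Lemma sf_dlogM l x y : sf_dlog l (x * y)%g = sf_dlog l x + sf_dlog l y.
Proof.
rewrite -[in LHS](sfx_repK x) -[in LHS](sfx_repK y).
rewrite (sf_dlogE l (SfMul _ _)) /sf_dlog /sfx_dlog /=.
have nz := cone_neq0 coneC.
case: (sfx_cone coneC Cz (sfx_rep x)) (sfx_cone coneC Cz (sfx_rep y)).
case: (sfx_frac _) => p q /= Ca Cb _; case: (sfx_frac _) => p' q' /= [Cc Cd _].
by rewrite !dlogM ?nz //; ring.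
Qed.

Lemma sf_dlogD l x y : sf_hom (oplus x y) * sf_dlog l (oplus x y)
  = sf_hom x * sf_dlog l x + sf_hom y * sf_dlog l y.
Proof.
rewrite sf_homD -[X in sf_dlog l (oplus X _)](sfx_repK x).
rewrite -[X in sf_dlog l (oplus _ X)](sfx_repK y).
rewrite (sf_dlogE l (SfAdd _ _)) /sf_hom /sf_dlog /sfx_dlog /=.
have nz := cone_neq0 coneC.
case: (sfx_cone coneC Cz (sfx_rep x)) (sfx_cone coneC Cz (sfx_rep y)).
case: (sfx_frac _) => p q /= Ca Cb ->; case: (sfx_frac _) => p' q' /= [Cc Cd ->].
have hd : int_eval z (p * q' + p' * q) != 0.
  by rewrite rmorphD !rmorphM nz //; apply: coneD => //; apply: coneM.
rewrite dlogM ?nz // /dlog mderivD !mderivM.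
move: hd; rewrite !rmorphD !rmorphM => hd.
by field; rewrite hd !nz.
Qed.

Lemma sf_dlog1 l : sf_dlog l 1%g = 0.
Proof. by apply: (addrI (sf_dlog l 1%g)); rewrite -sf_dlogM mul1g addr0. Qed.
Lemma sf_dlogV l x : sf_dlog l x^-1%g = - sf_dlog l x.
Proof. by apply: (addrI (sf_dlog l x)); rewrite -sf_dlogM mulgV subrr sf_dlog1. Qed.
Lemma sf_dlog_var l i : sf_dlog l (Qsf_var i) = (l == i)%:R.
Proof.
rewrite (sf_dlogE l (SfVar i)) /sfx_dlog /dlog /=.
have nz := cone_neq0 coneC (Cz i).
rewrite -mpolyC1 mderivC mderivX rmorph0 mulr0 mul0r subr0 mnm1E eq_sym.
case: (l =P i) nz => [<- nz|_ _]; last by rewrite scale0r rmorph0 mulr0 mul0r.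
have -> : (U_(l) - U_(l))%MM = 0%MM by apply/mnmP => j; rewrite !mnmE subnn.
by rewrite scale1r mpolyX0 rmorph1 mulr1 int_evalX divff.
Qed.

End Hom.

Definition lexp x (l : 'I_n) : int :=
  (mlead (sfx_num (sfx_rep x)) l)%:Z - (mlead (sfx_den (sfx_rep x)) l)%:Z.
Definition lcoef x : rat :=
  (mleadc (sfx_num (sfx_rep x)))%:~R / (mleadc (sfx_den (sfx_rep x)))%:~R.

Lemma lexpE e l : lexp (sfx_val e) l
  = (mlead (sfx_num e) l)%:Z - (mlead (sfx_den e) l)%:Z.
Proof.
rewrite /lexp; set e' := sfx_rep _.
have [a b] := sfx_frac_neq0 e; have [c d] := sfx_frac_neq0 e'.
have := @sfx_val_frac e' e (sfx_repK _) => /(congr1 (fun p => mlead p)).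
rewrite !mleadM // => /mnmP /(_ l); rewrite !mnmDE => h.
by apply/eqP; rewrite subr_eq addrAC eq_sym subr_eq -!PoszD h.
Qed.

Lemma mleadc_mul (p q : {mpoly int[n]}) : p != 0 -> q != 0 ->
  mleadc (p * q) = mleadc p * mleadc q.
Proof. by move=> p0 q0; rewrite mleadM // mleadcM. Qed.

Lemma mleadc_rat_neq0 (p : {mpoly int[n]}) : p != 0 ->
  (mleadc p)%:~R != 0 :> rat.
Proof. by rewrite intr_eq0 mleadc_eq0. Qed.

Lemma lcoefE e : lcoef (sfx_val e)
  = (mleadc (sfx_num e))%:~R / (mleadc (sfx_den e))%:~R.
Proof.
rewrite /lcoef; set e' := sfx_rep _.
have [a b] := sfx_frac_neq0 e; have [c d] := sfx_frac_neq0 e'.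
have := @sfx_val_frac e' e (sfx_repK _).
move=> /(congr1 (fun p => mleadc p)); rewrite !mleadc_mul // => h.
by apply/eqP; rewrite eqr_div ?mleadc_rat_neq0 // -!intrM h.
Qed.

Lemma lexpM x y l : lexp (x * y)%g l = lexp x l + lexp y l.
Proof.
rewrite -[in LHS](sfx_repK x) -[in LHS](sfx_repK y).
rewrite (lexpE (SfMul _ _)) /lexp /=.
have := sfx_frac_neq0 (sfx_rep x); have := sfx_frac_neq0 (sfx_rep y).
case: (sfx_frac (sfx_rep x)) => p q; case: (sfx_frac _) => p' q' /= [? ?] [? ?].
by rewrite !mleadM // !mnmDE !PoszD opprD addrACA.
Qed.

Lemma lcoefM x y : lcoef (x * y)%g = lcoef x * lcoef y.
Proof.
rewrite -[in LHS](sfx_repK x) -[in LHS](sfx_repK y).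
rewrite (lcoefE (SfMul _ _)) /lcoef /=.
have := sfx_frac_neq0 (sfx_rep x); have := sfx_frac_neq0 (sfx_rep y).
case: (sfx_frac (sfx_rep x)) => p q; case: (sfx_frac _) => p' q' /= [? ?] [? ?].
by rewrite !mleadc_mul // !intrM mulf_div.
Qed.

(** A nonzero exponent excludes a tie between the leading monomials of numerator and denominator, so
    one summand dominates. At a tie the leading coefficients would add, as in [1 + 1]. *)
Lemma lexp_add1 x : (exists l, lexp x l != 0) ->
  (lexp (oplus 1%g x) =1 lexp x /\ lcoef (oplus 1%g x) = lcoef x)
  \/ ((forall l, lexp (oplus 1%g x) l = 0) /\ lcoef (oplus 1%g x) = 1).
Proof.
case=> l hl.
pose e := SfAdd SfOne (sfx_rep x).
have ev : sfx_val e = oplus 1%g x.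
  by rewrite -[in RHS](sfx_repK x).
have hE k := lexpE e k; have hC := lcoefE e; rewrite {}ev in hE hC.
have := sfx_frac_neq0 (sfx_rep x).
move: hl hE hC; rewrite /lexp /lcoef /=.
case: (sfx_frac (sfx_rep x)) => p q /= hl hE hC [p0 q0].
move: hE hC; rewrite !mul1r mulr1 => hE hC.
have ne : mlead p != mlead q.
  by apply: contraNneq hl => ->; rewrite subrr.
case: (ltgtP (mlead p) (mlead q)) (ne) => // hlt _.
  right; rewrite hC.
  have e1 : mlead (q + p) = mlead q by rewrite mleadDl.
  split=> [k|]; first by rewrite hE e1 subrr.
  rewrite e1 mcoeffD (mcoeff_gt_mlead hlt) addr0 divff //.
  exact: mleadc_rat_neq0.
left; rewrite hC.
have e1 : mlead (q + p) = mlead p by rewrite addrC mleadDl.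
split=> [k|]; first by rewrite hE e1.
by rewrite e1 mcoeffD (mcoeff_gt_mlead hlt) add0r.
Qed.

Lemma lexp_var i l : lexp (Qsf_var i) l = (l == i)%:R.
Proof.
rewrite (lexpE (SfVar i)) /= mlead1 mleadXm mnm0E subr0 mnm1E eq_sym.
by case: eqP.
Qed.

Lemma lcoef_var i : lcoef (Qsf_var i) = 1.
Proof. by rewrite (lcoefE (SfVar i)) /= mleadc1 mleadXm mcoeffX eqxx divr1. Qed.

End Qsf.

(** * Polynomials dividing monomials; the Euler identity *)

Section PolyMonomial.
Variable D : idomainType.
Implicit Types p q : {poly D}.

Lemma poly_low p : p != 0 -> exists u p0, p0`_0 != 0 /\ p = p0 * 'X^u.
Proof.
move=> p0; have [m [q]] := multiplicity_XsubC p 0.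
rewrite p0 /= subr0 => hq ->; exists m, q; split=> //.
by move: hq; rewrite /root horner_coef0.
Qed.

(** Removing the powers of ['X] leaves factors with nonzero constant coefficients. Their product is
    then a constant, and so are they, by degree. *)
Lemma poly_mul_monomial p q c k : c != 0 -> p * q = c *: 'X^k ->
  exists d, p = p`_d *: 'X^d.
Proof.
move=> c0 h.
have pq0 : p * q != 0.
  by rewrite h -mul_polyC mulf_neq0 ?polyC_eq0 // -size_poly_eq0 size_polyXn.
move: (pq0); rewrite mulf_eq0 negb_or => /andP[p_0 q_0].
have [u [p' [p'0 pE]]] := poly_low p_0; have [v [q' [q'0 qE]]] := poly_low q_0.
have h' : (p' * q') * 'X^(u + v) = c *: 'X^k.
  by rewrite -h pE qE exprD; ring.
have kuv : (u + v)%N = k.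
  apply/eqP; have := congr1 (fun r : {poly D} => r`_(u + v)) h'.
  rewrite coefMXn ltnn subnn coefM big_ord1 /= coefZ coefXn.
  by case: eqP => // _ /eqP; rewrite mulr0 mulf_eq0 (negbTE p'0) (negbTE q'0).
have {h'} h' : p' * q' = c%:P.
  apply: (@mulIf _ ('X^k)); first by rewrite -size_poly_eq0 size_polyXn.
  by rewrite mul_polyC -h' kuv.
have : size (p' * q') = 1%N by rewrite h' size_polyC c0.
have p'n : p' != 0 by apply: contraNneq p'0 => ->; rewrite coef0.
have q'n : q' != 0 by apply: contraNneq q'0 => ->; rewrite coef0.
rewrite size_mul //; have sp : (0 < size p')%N by rewrite size_poly_gt0.
have sq : (0 < size q')%N by rewrite size_poly_gt0.
move=> s1; have : (size p' <= 1)%N by lia.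
move=> /size1_polyC p'E; exists u.
by rewrite pE coefMXn ltnn subnn -mul_polyC -p'E.
Qed.

End PolyMonomial.

Lemma mcoeff_euler n (R : comNzRingType) (j : 'I_n) (p : {mpoly R[n]}) m :
  ('X_j * mderiv j p)@_m = p@_m *+ m j.
Proof.
elim/mpolyind: p => [|c m' p _ _ IH].
  by rewrite mderiv0 mulr0 mcoeff0 mul0rn.
rewrite mderivD mulrDr !mcoeffD IH mulrnDl; congr (_ + _).
rewrite mderivZ mderivX -!scalerAr !mcoeffZ mulrCA -mpolyXD !mcoeffX.
case: (posnP (m' j)) => [z|pos].
  rewrite z mul0r; case: (m' =P m) => [<-|_]; first by rewrite z mulr0n.
  by rewrite mulr0 mul0rn.
have -> : (U_(j) + (m' - U_(j)))%MM = m'.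
  apply/mnmP => l; rewrite !mnmE; case: eqP => [<-|_] /=; lia.
by case: (m' =P m) => [<-|_]; rewrite ?mulr1 ?mulr0 ?mul0rn // mulr_natl.
Qed.

(* Replaces ['X_j] by ['X_j * tau], [tau] being a new variable. *)
Section Twist.
Variables (n : nat) (R : idomainType) (j : 'I_n).
Implicit Types p q : {mpoly R[n]}.

Definition twist : {rmorphism {mpoly R[n]} -> {poly {mpoly R[n]}}} :=
  locked (mmap (polyC \o @mpolyC n R : {rmorphism R -> {poly {mpoly R[n]}}})
    (fun l => if l == j then ('X_l)%:P * 'X else ('X_l)%:P)
    : {rmorphism {mpoly R[n]} -> {poly {mpoly R[n]}}}).

Lemma twistC c : twist c%:MP = c%:MP%:P.
Proof. by rewrite /twist -lock [LHS]mmapC. Qed.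

Lemma twistX m : twist 'X_[m] = 'X_[m] *: 'X^(m j).
Proof.
rewrite /twist -lock [LHS]mmapX /mmap1 [in RHS]mpolyXE_id -mul_polyC rmorph_prod /=.
rewrite (bigD1 j) //= [X in _ = X * _](bigD1 j) //= eqxx exprMn -mulrA mulrCA -mulrA.
rewrite mulrC -mulrA rmorphXn; congr (_ * (_ * _)).
by apply: eq_bigr => l /negbTE ->; rewrite rmorphXn.
Qed.

Lemma coef_twist p d m : ((twist p)`_d)@_m = p@_m *+ (m j == d).
Proof.
elim/mpolyind: p => [|c m' p _ _ IH].
  by rewrite rmorph0 coef0 !mcoeff0 mul0rn.
rewrite rmorphD coefD !mcoeffD IH mulrnDl; congr (_ + _).
rewrite -mul_mpolyC rmorphM twistC twistX /= coefCM coefZ coefXn.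
rewrite mcoeffCM mcoeffCM.
case: (m' j =P d) => [<-|ne]; rewrite ?eqxx ?(introF eqP (not_eq_sym ne)).
  rewrite mulr1 mcoeffX; case: eqP => [->|_]; first by rewrite eqxx.
  by rewrite mulr0 mul0rn.
rewrite mulr0 mcoeff0 mulr0 mcoeffX; case: eqP => [<-|_]; last by rewrite mulr0 mul0rn.
by case: eqP.
Qed.

Lemma twist_inj : injective twist.
Proof.
apply: raddf_inj => p h; apply/mpolyP => m; rewrite mcoeff0.
by have := coef_twist p (m j) m; rewrite h coef0 mcoeff0 eqxx.
Qed.

(** The Euler operator in one of several variables becomes that of univariate polynomials over a
    domain, where lowest coefficients and degrees can be compared. *)
Lemma twist_deriv p : twist ('X_j * mderiv j p) = 'X * (twist p)^`().
Proof.
apply/polyP => d; apply/mpolyP => m.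
rewrite coef_twist coefXM.
rewrite mcoeff_euler; case: d => [|d] /=.
  by rewrite mcoeff0; case: eqP => [->|_]; rewrite ?mulr0n.
rewrite coef_deriv mcoeffMn coef_twist.
by case: eqP => [->|_]; rewrite ?mulr1n // mulr0n mul0rn.
Qed.

End Twist.
Arguments twist {n R} j.

Lemma mpoly_mul_monomial n (R : idomainType) (p q : {mpoly R[n]}) a :
  p * q = 'X_[a] -> exists c b, p = c *: 'X_[b].
Proof.
move=> pq.
have [->|p0] := eqVneq p 0; first by exists 0, 0%MM; rewrite scale0r.
(* Twisting by each variable in turn shows that all monomials of [p] have the same exponent at
   [j]. *)
have key j : exists d, forall m, m \in msupp p -> m j = d.
  have h : twist j p * twist j q = 'X_[a] *: 'X^(a j) by rewrite -rmorphM pq twistX.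
  have a0 : 'X_[a] != 0 :> {mpoly R[n]}.
    apply/eqP => /mpolyP /(_ a); rewrite mcoeffX eqxx mcoeff0 => /eqP.
    by rewrite oner_eq0.
  have [d e] := poly_mul_monomial a0 h; exists d => m.
  rewrite mcoeff_msupp => pm.
  have := coef_twist j p (m j) m; rewrite eqxx mulr1n e coefZ coefXn.
  case: eqP => // _; rewrite mulr0 mcoeff0 => /esym/eqP.
  by rewrite (negbTE pm).
have lp : mlead p \in msupp p by apply: mlead_supp.
exists (mleadc p), (mlead p); apply/mpolyP => m; rewrite mcoeffZ mcoeffX.
case: (mlead p =P m) => [<-|ne]; first by rewrite mulr1.
rewrite mulr0; apply/eqP; rewrite mcoeff_eq0; apply/negP => mp; apply: ne.
by apply/mnmP => j; have [d hd] := key j; rewrite (hd _ lp) (hd _ mp).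
Qed.

Section Euler.
Variable D : idomainType.
Hypothesis D_char0 : [pchar D] =i pred0.
Implicit Types p q : {poly D}.

Lemma poly_low_unique p q u v : p`_0 != 0 -> q`_0 != 0 ->
  p * 'X^u = q * 'X^v -> u = v.
Proof.
wlog uv : p q u v / (u <= v)%N.
  move=> h p0 q0 e; case: (leqP u v) => uv; first exact: (h p q).
  by apply/esym/(h q p) => //; apply: ltnW.
move=> p0 q0 /(congr1 (fun r : {poly D} => r`_u)).
rewrite !coefMXn ltnn subnn => e; apply/eqP; rewrite eqn_leq uv leqNgt.
by apply/negP => lt; move/eqP: e; rewrite lt (negbTE p0).
Qed.

Lemma nat_mulI (x : D) a b : x != 0 -> a%:R * x = b%:R * x -> a = b.
Proof.
move=> x0 /(mulIf x0) e; apply/eqP.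
have h i j : (i <= j)%N -> i%:R = j%:R :> D -> i = j.
  move=> ij e'; have : (j - i)%:R == 0 :> D by rewrite natrB // e' subrr.
  by rewrite (proj1 (pcharf0P D) D_char0) subn_eq0 => ji; apply/eqP; rewrite eqn_leq ij.
by case: (leqP a b) => ab; [rewrite (h a b) | rewrite (h b a) // ltnW].
Qed.

Variables (s1 s0 : nat).
Hypotheses (s1_gt0 : (0 < s1)%N) (s0_gt0 : (0 < s0)%N).

(** With E = X d/dX this reads E(p / q) = (s1 / s0) (p / q), cleared of denominators. *)
Definition euler p q : Prop :=
  s1%:R * (p * q) = s0%:R * ('X * (p^`() * q - p * q^`())).

Lemma euler_low p q u v : p`_0 != 0 -> q`_0 != 0 ->
  euler (p * 'X^u) (q * 'X^v) -> (s1 + s0 * v = s0 * u)%N.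
Proof.
move=> p0 q0; have xd (r : {poly D}) w :
    'X * (r * 'X^w)^`() = 'X^w * (w%:R * r + 'X * r^`()).
  rewrite derivM derivXn; case: w => [|w]; first by rewrite mulr0n expr0; ring.
  by rewrite -mulr_natl exprS; ring.
rewrite /euler => h.
have {}h : 'X^(u + v) * (s1%:R * (p * q))
  = 'X^(u + v) * (s0%:R * ((u%:R * p + 'X * p^`()) * q - p * (v%:R * q + 'X * q^`()))).
  transitivity (s1%:R * (p * 'X^u * (q * 'X^v))); first by rewrite exprD; ring.
  rewrite h; transitivity (s0%:R * (('X * (p * 'X^u)^`()) * (q * 'X^v)
     - (p * 'X^u) * ('X * (q * 'X^v)^`()))); first by ring.
  by rewrite !xd exprD; ring.
have x0 : 'X^(u + v) != 0 :> {poly D} by rewrite -size_poly_eq0 size_polyXn.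
have := congr1 (fun r => r.[0]) (mulfI x0 h).
rewrite !hornerE /= !hornerMn !hornerE !horner_coef0 => e.
apply: (@nat_mulI (p`_0 * q`_0)); first exact: mulf_neq0.
rewrite natrD !natrM; move: e.
set a := p`_0; set b := q`_0 => e.
transitivity (s1%:R * a * b + s0%:R * (a * v%:R * b)); first by ring.
by rewrite e; ring.
Qed.

(** The Euler equation makes p / q a constant times X^r with r = s1 / s0, so p + q is q times a
    binomial of degree r. It is also a monomial times a binomial of degree 1; comparing lowest terms
    and degrees leaves r = 1 and q a monomial. *)
Lemma euler_binomial p q c d k : p != 0 -> q != 0 -> c != 0 -> d != 0 ->
  euler p q -> p + q = c *: 'X^k * (1 + d *: 'X) ->
  q = c *: 'X^k /\ p = (c * d) *: 'X^(k.+1).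
Proof.
move=> p_0 q_0 c0 d0 eu pq.
have [u [p' [p'0 pE]]] := poly_low p_0; have [v [q' [q'0 qE]]] := poly_low q_0.
have uv : (s1 + s0 * v = s0 * u)%N by apply: (euler_low p'0 q'0); rewrite -pE -qE.
have ltvu : (v < u)%N by rewrite -(ltn_pmul2l s0_gt0) -uv -[X in (X < _)%N]add0n ltn_add2r.
set r := (u - v)%N.
have r_gt0 : (0 < r)%N by rewrite subn_gt0.
have s1E : s1 = (s0 * r)%N by rewrite /r mulnBr; lia.
have ur : u = (r + v)%N by rewrite subnK // ltnW.
(* [g] still solves the equation with [q], and its coefficient in degree [u] is cancelled. By
   [euler_low] every nonzero solution starts exactly in degree [u], so [g] is 0. *)
pose g := q'`_0 *: p - p'`_0 *: ('X^r * q).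
have xr : ('X^r : {poly D})^`() * 'X = r%:R * 'X^r.
  by rewrite derivXn -(prednK r_gt0) /= -mulr_natl exprSr mulrA.
have eg : euler g q.
  have er : euler ('X^r * q) q.
    rewrite /euler derivM s1E natrM.
    transitivity (s0%:R * ((r%:R * 'X^r) * q * q)); first by ring.
    by rewrite -xr; ring.
  rewrite /euler /g derivB !derivZ -!mul_polyC.
  transitivity ((q'`_0)%:P * (s1%:R * (p * q)) - (p'`_0)%:P * (s1%:R * ('X^r * q * q))).
    by ring.
  by rewrite eu er; ring.
have g0 : g = 0.
  apply/eqP; apply: contraT => g_0.
  have [w [g' [g'0 gE]]] := poly_low g_0.
  have wv : (s1 + s0 * v = s0 * w)%N by apply: (euler_low g'0 q'0); rewrite -gE -qE.
  have wu : w = u by apply/eqP; rewrite -(eqn_pmul2l s0_gt0) -wv -uv.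
  have : g`_u = 0.
    rewrite /g coefB !coefZ pE coefMXn ltnn subnn ur coefXnM ltnNge leq_addr /=.
    by rewrite addnC addnK qE coefMXn ltnn subnn mulrC subrr.
  by rewrite gE wu coefMXn ltnn subnn => /eqP; rewrite (negbTE g'0).
have kv : k = v.
  have h : (c%:P * (1 + d *: 'X)) * 'X^k = (p' * 'X^r + q') * 'X^v.
    by rewrite [RHS]mulrDl -[p' * _ * _]mulrA -exprD -ur -pE -qE pq -!mul_polyC; ring.
  apply: (poly_low_unique _ _ h).
    by rewrite mul_polyC coefZ coefD coef1 coefZ coefX /= mulr0 addr0 mulr1.
  by rewrite coefD coefMXn r_gt0 add0r.
have qpE : (p'`_0 *: 'X^r + (q'`_0)%:P) * q = (q'`_0 * c) *: 'X^v * (1 + d *: 'X).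
  move/eqP: g0; rewrite subr_eq0 => /eqP g0.
  transitivity (q'`_0 *: (p + q)); last by rewrite pq kv -!mul_polyC polyCM; ring.
  by rewrite scalerDr g0 -!mul_polyC; ring.
have sz1 : size (1 + d *: 'X : {poly D}) = 2.
  by rewrite addrC size_addl size_scale ?size_polyX // size_poly1.
have sL : size (p'`_0 *: 'X^r + (q'`_0)%:P) = r.+1.
  rewrite size_addl size_scale // ?size_polyXn // size_polyC.
  by case: (_ == _); rewrite /= ltnS.
have := congr1 (fun f : {poly D} => size f) qpE.
have qc0 : q'`_0 * c != 0 by rewrite mulf_neq0.
have nL : p'`_0 *: 'X^r + (q'`_0)%:P != 0 by rewrite -size_poly_eq0 sL.
have n1 : 1 + d *: 'X != 0 :> {poly D} by rewrite -size_poly_eq0 sz1.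
have nX : (q'`_0 * c) *: 'X^v != 0 :> {poly D}.
  by rewrite -size_poly_eq0 size_scale // size_polyXn.
rewrite (size_mul nL q_0) (size_mul nX n1) sL sz1 size_scale // size_polyXn.
have q'n : q' != 0 by apply: contraNneq q'0 => ->; rewrite coef0.
have sq : size q = (size q' + v)%N by rewrite qE size_mulXn // addnC.
have sq' : (0 < size q')%N by rewrite size_poly_gt0.
rewrite sq => es.
have r1 : r = 1%N by lia.
have : (size q' <= 1)%N by lia.
move=> /size1_polyC q'E.
have qE' : q = q'`_0 *: 'X^v by rewrite qE {1}q'E mul_polyC.
have cE : c = q'`_0.
  have := congr1 (fun f : {poly D} => f`_v) pq.
  rewrite coefD pE coefMXn ltvu add0r qE' kv !coefZ coefXn eqxx mulr1 => ->.
  by rewrite mulrC -scalerAr coefZ coefMXn ltnn subnn coefD coef1 coefZ coefX /= mulr0 addr0 mulr1.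
split; first by rewrite qE' cE kv.
apply: (addIr q); rewrite pq qE' -cE kv exprS -!mul_polyC polyCM; ring.
Qed.

End Euler.

Lemma mpoly_char0 n (R : idomainType) : [pchar R] =i pred0 ->
  [pchar {mpoly R[n]}] =i pred0.
Proof.
move=> /pcharf0P h; apply/pcharf0P => m.
by rewrite -mpolyC_nat mpolyC_eq0 h.
Qed.

Lemma euler_mpoly n (R : idomainType) (j : 'I_n) (a b : {mpoly R[n]}) m s1 s0 :
  [pchar R] =i pred0 -> (0 < s1)%N -> (0 < s0)%N -> a != 0 -> b != 0 ->
  a + b = 'X_[m] * (1 + 'X_j) ->
  s1%:R * (a * b) = s0%:R * (('X_j * mderiv j a) * b - a * ('X_j * mderiv j b)) ->
  a = 'X_[m] * 'X_j /\ b = 'X_[m].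
Proof.
move=> R0 s1p s0p a0 b0 ab eu.
have X0 m' : 'X_[m'] != 0 :> {mpoly R[n]}.
  apply/eqP => /mpolyP /(_ m'); rewrite mcoeffX eqxx mcoeff0 => /eqP.
  by rewrite oner_eq0.
have t0 (p : {mpoly R[n]}) : p != 0 -> twist j p != 0.
  by apply: contraNneq => h; apply/eqP/(@twist_inj _ _ j); rewrite h rmorph0.
have tXj : twist j ('X_j : {mpoly R[n]}) = 'X_j *: 'X by rewrite (twistX _ j U_(j)) mnm1E eqxx expr1.
have e1 : euler s1 s0 (twist j a) (twist j b).
  have := congr1 (twist j) eu; rewrite /euler.
  rewrite rmorphM rmorph_nat rmorphM => ->.
  by rewrite rmorphM rmorph_nat rmorphB !rmorphM -!(rmorphM (twist j) 'X_j) !twist_deriv; ring.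
have e2 : twist j a + twist j b = 'X_[m] *: 'X^(m j) * (1 + 'X_j *: 'X).
  by rewrite -rmorphD ab rmorphM rmorphD rmorph1 tXj twistX.
have [hb ha] := euler_binomial (mpoly_char0 n R0) s1p s0p (t0 _ a0) (t0 _ b0) (X0 m) (X0 _) e1 e2.
split; apply: (@twist_inj _ _ j).
  by rewrite ha rmorphM twistX tXj exprS -!mul_polyC polyCM; ring.
by rewrite hb twistX.
Qed.

(** * Group rings and places *)

Record character (P : semifieldType) (E : comNzRingType) := Character {
  char_fun :> P -> E;
  char1 : char_fun 1%g = 1;
  charM : forall x y, char_fun (x * y)%g = char_fun x * char_fun y }.

Section GroupRingEval.
Local Open Scope fset_scope.
Local Open Scope ring_scope.
Variables (K : comNzRingType) (P : semifieldType) (E : comNzRingType).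
Variables (j : {rmorphism K -> E}) (chi : character P E).

Definition gr_eval (g : grpring K P) : E :=
  \sum_(x <- monalg.msupp g) j (monalg.mcoeff x g) * chi x.

Lemma gr_eval_wide (d : {fset P}) g : monalg.msupp g `<=` d ->
  gr_eval g = \sum_(x <- d) j (monalg.mcoeff x g) * chi x.
Proof.
move=> led; rewrite /gr_eval (big_fset_incl _ led) //= => x _.
by move=> /monalg.mcoeff_outdom ->; rewrite rmorph0 mul0r.
Qed.

Lemma gr_eval_mono c x : gr_eval (gr_mono c x) = j c * chi x.
Proof.
by rewrite (@gr_eval_wide [fset x]) ?monalg.msuppU_le // big_seq_fset1
  monalg.mcoeffUU.
Qed.

Fact gr_eval_is_additive : zmod_morphism gr_eval.
Proof.
move=> g1 g2.
pose d := monalg.msupp g1 `|` monalg.msupp g2.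
rewrite (@gr_eval_wide d (g1 - g2)) ?monalg.msuppB_le //.
rewrite (@gr_eval_wide d g1) ?fsubsetUl // (@gr_eval_wide d g2) ?fsubsetUr //.
rewrite -sumrB; apply/eq_bigr => x _.
by rewrite monalg.mcoeffB rmorphB mulrBl.
Qed.
HB.instance Definition _ :=
  GRing.isZmodMorphism.Build (grpring K P) E gr_eval gr_eval_is_additive.

Fact gr_eval_is_multiplicative : monoid_morphism gr_eval.
Proof.
split; first by rewrite -[1]/(gr_mono 1 1%g) gr_eval_mono char1 rmorph1 mulr1.
move=> g1 g2; rewrite -[g1 * g2]/(gr_mul g1 g2) /gr_mul raddf_sum /=.
rewrite [gr_eval g1]/gr_eval mulr_suml; apply/eq_bigr => x _.
rewrite raddf_sum /= [gr_eval g2]/gr_eval mulr_sumr; apply/eq_bigr => y _.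
by rewrite gr_eval_mono charM rmorphM mulrACA.
Qed.
HB.instance Definition _ :=
  GRing.isMonoidMorphism.Build (grpring K P) E gr_eval gr_eval_is_multiplicative.

End GroupRingEval.

Section GroupRing.
Variables (K : comNzRingType) (P : semifieldType).

Definition gr_const (c : K) : grpring K P := gr_mono c 1%g.
Fact gr_const_is_additive : zmod_morphism gr_const.
Proof. by move=> c d; apply: monalg.monalgUB. Qed.
Fact gr_const_is_multiplicative : monoid_morphism gr_const.
Proof.
split=> // c d.
by rewrite -[RHS]/(gr_mul _ _) gr_mul_mono mulg1.
Qed.
HB.instance Definition _ :=
  GRing.isZmodMorphism.Build K (grpring K P) gr_const gr_const_is_additive.
HB.instance Definition _ :=
  GRing.isMonoidMorphism.Build K (grpring K P) gr_const gr_const_is_multiplicative.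

Lemma gr_eltM (x y : P) : gr_elt K (x * y)%g = gr_elt K x * gr_elt K y.
Proof. by rewrite -[RHS]/(gr_mul _ _) gr_mul_mono mulr1. Qed.
Lemma gr_elt1 : gr_elt K (1%g : P) = 1.
Proof. by []. Qed.
Lemma gr_mono_factor c (x : P) : gr_mono c x = gr_const c * gr_elt K x.
Proof. by rewrite -[RHS]/(gr_mul _ _) gr_mul_mono mulr1 mul1g. Qed.

Lemma gr_ind (Q : grpring K P -> Prop) :
  Q 0 -> (forall c x g, Q g -> Q (gr_const c * gr_elt K x + g)) -> forall g, Q g.
Proof.
move=> Q0 Qadd g; rewrite (gr_monoE g).
elim: (monalg.msupp g : seq P) => [|x r IH]; first by rewrite big_nil.
by rewrite big_cons gr_mono_factor; apply: Qadd.
Qed.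

Lemma gr_eval_const (E : comNzRingType) (j : {rmorphism K -> E})
  (chi : character P E) c : gr_eval j chi (gr_const c) = j c.
Proof. by rewrite gr_eval_mono char1 mulr1. Qed.
Lemma gr_eval_elt (E : comNzRingType) (j : {rmorphism K -> E})
  (chi : character P E) x : gr_eval j chi (gr_elt K x) = chi x.
Proof. by rewrite gr_eval_mono rmorph1 mul1r. Qed.

End GroupRing.

(* [place f y]: the element [f] of the fraction field [F] of [R] lies in the
   localization of [R] at the kernel of [e2], and specializes to [y] there. *)
Section Place.
Variables (R : comNzRingType) (F E : fieldType).
Variables (e1 : {rmorphism R -> F}) (e2 : {rmorphism R -> E}).
Hypothesis e1_inj : injective e1.

Definition place (f : F) (y : E) : Prop :=
  exists p q, [/\ e2 q != 0, f * e1 q = e1 p & y * e2 q = e2 p].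

Lemma place_neq0 q : e2 q != 0 -> e1 q != 0.
Proof.
apply: contraNneq => h; have -> : q = 0 by apply: e1_inj; rewrite rmorph0.
by rewrite rmorph0.
Qed.

Lemma place_fun f y y' : place f y -> place f y' -> y = y'.
Proof.
case=> p [q [q0 fq yq]] [p' [q' [q0' fq' yq']]].
have h : p * q' = p' * q.
  by apply: e1_inj; rewrite !rmorphM -fq -fq' mulrAC.
apply: (mulIf q0); apply: (mulIf q0').
by rewrite yq -rmorphM h rmorphM -yq' mulrAC.
Qed.

Lemma place_e p : place (e1 p) (e2 p).
Proof. by exists p, 1; rewrite !rmorph1 !mulr1 oner_eq0. Qed.

Lemma place0 : place 0 0.
Proof. by have := place_e 0; rewrite !rmorph0. Qed.
Lemma place1 : place 1 1.
Proof. by have := place_e 1; rewrite !rmorph1. Qed.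

Lemma placeD f g y z : place f y -> place g z -> place (f + g) (y + z).
Proof.
case=> p [q [q0 fq yq]] [p' [q' [q0' fq' yq']]].
exists (p * q' + p' * q), (q * q'); split.
- by rewrite rmorphM mulf_neq0.
- by rewrite rmorphD !rmorphM -fq -fq'; ring.
- by rewrite rmorphD !rmorphM -yq -yq'; ring.
Qed.

Lemma placeM f g y z : place f y -> place g z -> place (f * g) (y * z).
Proof.
case=> p [q [q0 fq yq]] [p' [q' [q0' fq' yq']]].
exists (p * p'), (q * q'); split.
- by rewrite rmorphM mulf_neq0.
- by rewrite !rmorphM -fq -fq' mulrACA.
- by rewrite !rmorphM -yq -yq' mulrACA.
Qed.

Lemma placeN f y : place f y -> place (- f) (- y).
Proof.
move=> h; rewrite -mulN1r -[- y]mulN1r; apply: placeM => //.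
by have := place_e (-1); rewrite !rmorphN1.
Qed.

Lemma placeV f y : y != 0 -> place f y -> place f^-1 y^-1.
Proof.
move=> y0 [p [q [q0 fq yq]]].
have p0 : e2 p != 0 by rewrite -yq mulf_neq0.
have f0 : f != 0.
  by apply: contraNneq (place_neq0 p0) => f0; rewrite -fq f0 mul0r.
by exists q, p; split; rewrite // -?fq -?yq mulKf.
Qed.

Lemma place_nat m : place m%:R m%:R.
Proof. by have := place_e m%:R; rewrite !rmorph_nat. Qed.

Lemma place_exp f y m : place f y -> place (f ^+ m) (y ^+ m).
Proof.
move=> h; elim: m => [|m IH]; first by rewrite !expr0; apply: place1.
by rewrite !exprS; apply: placeM.
Qed.

Lemma place_expz f y (m : int) : y != 0 -> place f y -> place (f ^ m) (y ^ m).
Proof.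
move=> y0 h; case: m => m; first exact: place_exp.
rewrite NegzE -!exprnN; apply: placeV; first by rewrite expf_neq0.
exact: place_exp.
Qed.

Lemma place_prod (I : Type) (r : seq I) (Q : pred I) (f : I -> F) (y : I -> E) :
  (forall i, Q i -> place (f i) (y i)) ->
  place (\prod_(i <- r | Q i) f i) (\prod_(i <- r | Q i) y i).
Proof.
move=> h; elim: r => [|i r IH]; first by rewrite !big_nil; apply: place1.
by rewrite !big_cons; case: ifP => // Qi; apply: placeM => //; apply: h.
Qed.

Lemma place_sum (I : Type) (r : seq I) (Q : pred I) (f : I -> F) (y : I -> E) :
  (forall i, Q i -> place (f i) (y i)) ->
  place (\sum_(i <- r | Q i) f i) (\sum_(i <- r | Q i) y i).
Proof.
move=> h; elim: r => [|i r IH]; first by rewrite !big_nil; apply: place0.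
by rewrite !big_cons; case: ifP => // Qi; apply: placeD => //; apply: h.
Qed.

End Place.

(** [D] plays the part of an ideal of a subring [L] of the field: two homomorphisms are congruent
    modulo [D] once they agree on variables and are congruent on constants. *)
Lemma mpoly_rmorph_sub (R : comNzRingType) n (F : fieldType)
    (e1 e2 : {rmorphism {mpoly R[n]} -> F}) (D L : F -> Prop) :
  D 0 -> (forall f g, D f -> D g -> D (f + g)) ->
  (forall f g, L f -> D g -> D (f * g)) -> L 1 ->
  (forall f g, L f -> L g -> L (f * g)) ->
  (forall i, e1 'X_i = e2 'X_i) -> (forall i, L (e1 'X_i)) ->
  (forall c, D (e1 c%:MP - e2 c%:MP)) -> forall p, D (e1 p - e2 p).
Proof.
move=> D0 DD DM L1 LM eX LX Dc p.
rewrite (mpolyE p) !rmorph_sum -sumrB; elim/big_ind: _ => // m _.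
rewrite -mul_mpolyC !rmorphM -[e2 'X_[m]](_ : e1 'X_[m] = _).
  rewrite -mulrBl mulrC; apply: DM => //.
  rewrite mpolyXE_id rmorph_prod; elim/big_ind: _ => // i _.
  by rewrite rmorphXn; elim: (m i) => [|k IH]; rewrite ?expr0 ?exprS //; apply: LM.
rewrite mpolyXE_id !rmorph_prod; apply: eq_bigr => i _.
by rewrite !rmorphXn eX.
Qed.

Lemma gr_rmorph_sub (K : comNzRingType) (P : semifieldType) (F : fieldType)
    (e1 e2 : {rmorphism grpring K P -> F}) (D L : F -> Prop) :
  D 0 -> (forall f g, D f -> D g -> D (f + g)) ->
  (forall f g, L f -> D g -> D (f * g)) ->
  (forall c, e1 (gr_const P c) = e2 (gr_const P c)) ->
  (forall c, L (e1 (gr_const P c))) ->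
  (forall x, D (e1 (gr_elt K x) - e2 (gr_elt K x))) -> forall g, D (e1 g - e2 g).
Proof.
move=> D0 DD DM ec Lc De; apply: gr_ind => [|c x g IH].
  by rewrite !rmorph0 subrr.
rewrite !rmorphD opprD addrACA; apply: DD => //.
by rewrite !rmorphM -ec -mulrBr; apply: DM.
Qed.

Lemma mcoeff_lincomb (R : comNzRingType) n (r : seq 'X_{1..n}) (a : 'X_{1..n} -> R) m :
  uniq r -> m \in r -> (\sum_(m' <- r) a m' *: 'X_[m'])@_m = a m.
Proof.
move=> ur mr; rewrite raddf_sum (bigD1_seq m) //= mcoeffZ mcoeffX eqxx mulr1.
rewrite big1 ?addr0 // => m' m'm.
by rewrite mcoeffZ mcoeffX (negbTE m'm) mulr0.
Qed.

(** The equal fractions a / b and p / q have equal logarithmic derivatives; the second hypothesis is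
    the derivative of the first. *)
Lemma wronskian_eq (R : comNzRingType) (a b p q da db dp dq x s : R) :
  a * q = b * p -> da * q + a * dq = db * p + b * dp ->
  p * q * (s * (x * da * b - a * (x * db))) = a * b * (s * (x * dp * q - p * (x * dq))).
Proof.
move=> e de.
have {}de : da * q - db * p = b * dp - a * dq.
  by apply/eqP; rewrite subr_eq addrAC eq_sym subr_eq [b * dp + _]addrC -de.
transitivity (s * x * ((da * q) * (b * p) - (a * q) * (db * p))); first by ring.
rewrite -e; transitivity (s * x * (a * q) * (da * q - db * p)); first by ring.
rewrite de; transitivity (s * x * b * dp * q * a - s * x * a * dq * (a * q)); first by ring.
by rewrite e; ring.
Qed.

Lemma rmorph_euler (R R' : comNzRingType) (h : {rmorphism R -> R'}) m k (a b c d : R) :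
  m%:R * (a * b) = k%:R * (c * b - a * d) ->
  m%:R * (h a * h b) = k%:R * (h c * h b - h a * h d).
Proof.
move=> /(congr1 h).
by rewrite !rmorphM rmorphB !rmorphM !rmorph_nat.
Qed.

(** Vertices are words, so recursion starts at the empty word. From an arbitrary [t0] that word is
    reached first, by walking back along the path of [t0]. *)
Lemma tree_ind n (t0 : tree n) (Q : tree n -> Prop) :
  Q t0 -> (forall t k, Q t -> Q (nbr k t)) -> forall t, Q t.
Proof.
move=> Q0 QS.
have Qnil (h : sorted (fun i j => i != j) ([::] : seq 'I_n)) : Q (exist _ [::] h).
  case: t0 Q0 => w; elim: w => [|k w IH] hw Qw.
    by rewrite (_ : exist _ _ _ = exist _ [::] hw) //; apply: val_inj.
  have hw' := path_sorted hw; apply: (IH hw').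
  rewrite (_ : exist _ _ _ = nbr k (exist _ (k :: w) hw)); first exact: QS.
  by apply: val_inj; rewrite /= eqxx.
case=> w; elim: w => [|k w IH] hw; first exact: Qnil.
have hw' := path_sorted hw.
rewrite (_ : exist _ _ _ = nbr k (exist _ w hw')); first exact/QS/IH.
apply: val_inj => /=; case: w hw {IH hw'} => //= i w /andP[/negbTE ki _].
by rewrite eq_sym ki.
Qed.

(** * Seeds and their mutations *)

Definition symmetrizes n (s : 'I_n -> int) (B : 'M[int]_n) : Prop :=
  (forall i, 0 < s i) /\ (forall i j, s i * B i j = - (s j * B j i)).

Lemma skew_symmetrizableP n (B : 'M[int]_n) :
  skew_symmetrizable B -> exists s, symmetrizes s B.
Proof.
case=> s s0; rewrite mul_diag_mx => /matrixP h.
exists (fun i => s 0 i); split=> // i j.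
by have := h j i; rewrite !mxE.
Qed.

Lemma symmetrizes_diag n s (B : 'M[int]_n) i : symmetrizes s B -> B i i = 0.
Proof.
case=> s0 /(_ i i) /eqP; rewrite -addr_eq0 -mulr2n mulrn_eq0 /= mulf_eq0.
by rewrite gt_eqF ?s0 //= => /eqP.
Qed.

Lemma symmetrizes_eq0 n s (B : 'M[int]_n) i j : symmetrizes s B ->
  (B i j == 0) = (B j i == 0).
Proof.
case=> s0 /(_ i j) h; have := s0 i; have := s0 j => sj si.
have e1 : (s i * B i j == 0) = (B i j == 0) by rewrite mulf_eq0 gt_eqF.
have e2 : (s j * B j i == 0) = (B j i == 0) by rewrite mulf_eq0 gt_eqF.
by rewrite -e1 -e2 h oppr_eq0.
Qed.

Lemma symmetrizes_gt0 n s (B : 'M[int]_n) i j : symmetrizes s B ->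
  (0 < B i j) = (B j i < 0).
Proof.
case=> s0 /(_ i j) h; have si := s0 i; have sj := s0 j.
by rewrite -(pmulr_rgt0 _ si) h oppr_gt0 pmulr_rlt0.
Qed.

(** One symmetrizer serves the whole pattern, as a bracket common to all seeds requires. The reason
    is s_j b_jk b_ki = s_i b_ik b_kj. *)
Lemma symmetrizes_mut n s (B : 'M[int]_n) k :
  symmetrizes s B -> symmetrizes s (mutB B k).
Proof.
move=> sB; have [s0 sE] := sB; split=> // i j; rewrite !mxE.
rewrite [(j == k) || _]orbC; case: ifP => _; first by rewrite !mulrN sE.
rewrite !mulrDr sE opprD; congr (_ + _).
have h : s j * (B j k * B k i) = s i * (B i k * B k j).
  have si := s0 i; have sj := s0 j; have sk := s0 k.
  have e1 := sE i k; have e2 := sE j k.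
  have sk0 : s k != 0 by rewrite gt_eqF.
  apply: (mulfI sk0).
  have -> : s k * (s j * (B j k * B k i)) = (s j * B j k) * (s k * B k i) by ring.
  have -> : s k * (s i * (B i k * B k j)) = (s i * B i k) * (s k * B k j) by ring.
  by rewrite e1 e2; ring.
have hm : s j * Num.max (B j k * B k i) 0 = s i * Num.max (B i k * B k j) 0.
  by rewrite !maxr_pMr ?ltW // h !mulr0.
rewrite mulrCA [s j * _]mulrCA hm -[RHS]mulNr.
have [le0|gt0] := leP (B i k * B k j) 0; first by rewrite mulr0 !mulr0.
congr (_ * _).
have -> : Num.sg (B j k) = - Num.sg (B k j).
  case: (ltgtP (B j k) 0) => [lt|gt|/eqP e].
  - by rewrite -(symmetrizes_gt0 k j sB) in lt; rewrite (gtr0_sg lt) ltr0_sg // -(symmetrizes_gt0 k j sB).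
  - by have := gt; rewrite (symmetrizes_gt0 j k sB) => lt; rewrite (ltr0_sg lt) gtr0_sg ?opprK.
  - by have := e; rewrite (symmetrizes_eq0 j k sB) => /eqP ->; rewrite (eqP e) sgr0 oppr0.
rewrite opprK.
have [h1|h1|h1] := ltgtP (B i k) 0.
- by rewrite nmulr_rgt0 // in gt0; rewrite !ltr0_sg.
- by rewrite pmulr_rgt0 // in gt0; rewrite !gtr0_sg.
- by rewrite h1 mul0r ltxx in gt0.
Qed.

Section Derivation.
Variables (R : comNzRingType) (F : fieldType) (iota : {rmorphism R -> F}).

Record derivation_over (D : F -> F) : Prop := DerivationOver {
  derD : forall x y, D (x + y) = D x + D y;
  derM : forall x y, D (x * y) = D x * y + x * D y;
  der_iota : forall c, D (iota c) = 0 }.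

Section Theory.
Variables (D : F -> F) (DD : derivation_over D).

Lemma der0 : D 0 = 0.
Proof. by rewrite -{1}(rmorph0 iota) (der_iota DD). Qed.
Lemma der1 : D 1 = 0.
Proof. by rewrite -{1}(rmorph1 iota) (der_iota DD). Qed.

Lemma derV x : x != 0 -> D x^-1 = - D x / x ^+ 2.
Proof.
move=> x0; have := derM DD x x^-1; rewrite divff // der1 => h.
apply: (mulfI x0); have -> : x * D x^-1 = - (D x / x).
  by apply/eqP; rewrite -addr_eq0 addrC -h.
by field.
Qed.

Definition dlg x := D x / x.

Lemma dlgE x : x != 0 -> D x = dlg x * x.
Proof. by move=> x0; rewrite /dlg divfK. Qed.
Lemma dlgM x y : x != 0 -> y != 0 -> dlg (x * y) = dlg x + dlg y.
Proof. by move=> x0 y0; rewrite /dlg (derM DD); field; rewrite x0 y0. Qed.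
Lemma dlg1 : dlg 1 = 0.
Proof. by rewrite /dlg der1 mul0r. Qed.
Lemma dlgV x : x != 0 -> dlg x^-1 = - dlg x.
Proof.
by move=> x0; apply: (addrI (dlg x)); rewrite -dlgM ?invr_eq0 // divff // dlg1 subrr.
Qed.
Lemma dlg_exp x (m : nat) : x != 0 -> dlg (x ^+ m) = m%:R * dlg x.
Proof.
move=> x0; elim: m => [|m IH]; first by rewrite expr0 dlg1 mul0r.
by rewrite exprS dlgM ?expf_neq0 // IH -natr1 mulrDl mul1r addrC.
Qed.
Lemma dlg_expz x (m : int) : x != 0 -> dlg (x ^ m) = m%:~R * dlg x.
Proof.
move=> x0; case: m => m; first by rewrite -exprnP dlg_exp.
by rewrite NegzE -exprnN dlgV ?expf_neq0 // dlg_exp // mulrNz mulNr.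
Qed.
Lemma dlg_prod (I : Type) (r : seq I) (Q : pred I) (f : I -> F) :
  (forall i, f i != 0) ->
  dlg (\prod_(i <- r | Q i) f i) = \sum_(i <- r | Q i) dlg (f i).
Proof.
move=> f0; elim: r => [|i r IH]; first by rewrite !big_nil dlg1.
rewrite !big_cons; case: ifP => // _; rewrite dlgM ?IH //.
by elim/big_ind: _ => //; [exact: oner_neq0 | move=> x y x0 y0; apply: mulf_neq0].
Qed.
Lemma dlg_iota c : dlg (iota c) = 0.
Proof. by rewrite /dlg (der_iota DD) mul0r. Qed.
Lemma dlg_iotaM c x : iota c != 0 -> x != 0 -> dlg (iota c * x) = dlg x.
Proof. by move=> c0 x0; rewrite dlgM // dlg_iota add0r. Qed.

End Theory.

Lemma derivation_sum (I : Type) (r : seq I) (c : I -> F) (D : I -> F -> F) :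
  (forall i, derivation_over (D i)) ->
  derivation_over (fun x => \sum_(i <- r) c i * D i x).
Proof.
move=> DD; split=> [x y|x y|a].
- by rewrite -big_split; apply: eq_bigr => i _; rewrite (derD (DD i)) mulrDr.
- rewrite mulr_suml mulr_sumr -big_split; apply: eq_bigr => i _.
  by rewrite (derM (DD i)) /=; ring.
- by rewrite big1 // => i _; rewrite (der_iota (DD i)) mulr0.
Qed.

(** Partial derivatives extend to [F] by the quotient rule on a chosen fraction. [DE] makes the
    choice irrelevant, so each rule can be checked on convenient fractions. *)
Lemma exists_derivation n (z v : 'I_n -> F) : free_generating iota z ->
  exists D, derivation_over D /\ forall i, D (z i) = v i.
Proof.
case=> z_inj z_gen.
have [e eE] : exists e : {rmorphism {mpoly R[n]} -> F}, forall p, mmap iota z p = e p.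
  by exists (mmap iota z).
pose d p := \sum_i v i * e (mderiv i p).
have dD p q : d (p + q) = d p + d q.
  by rewrite /d -big_split; apply: eq_bigr => i _; rewrite mderivD rmorphD mulrDr.
have dM p q : d (p * q) = d p * e q + e p * d q.
  rewrite /d mulr_suml mulr_sumr -big_split; apply: eq_bigr => i _.
  by rewrite mderivM rmorphD !rmorphM /=; ring.
have e0 p : p != 0 -> e p != 0.
  by apply: contraNneq => h; apply/eqP/z_inj; rewrite !eE h rmorph0.
have rep x : {pq : {mpoly R[n]} * {mpoly R[n]} | pq.2 != 0 /\ x * e pq.2 = e pq.1}.
  apply: boolp.cid; have [p [q [q0 ->]]] := z_gen x; exists (p, q); split=> //=.
  by rewrite !eE divfK ?e0.
pose D x := (d (sval (rep x)).1 - x * d (sval (rep x)).2) / e (sval (rep x)).2.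
have DE x p q : q != 0 -> x * e q = e p -> D x * e q = d p - x * d q.
  rewrite /D; case: (rep x) => -[p' q'] /= [q0' xq'] q0 xq.
  have h : p * q' = p' * q by apply: z_inj; rewrite !eE !rmorphM -xq -xq' mulrAC.
  have := congr1 d h; rewrite !dM -xq -xq' => h'.
  apply: (mulIf (e0 _ q0')); rewrite mulrAC divfK ?e0 //.
  apply/eqP; rewrite -subr_eq0; apply/eqP.
  have -> : (d p' - x * d q') * e q - (d p - x * d q) * e q' =
   (d p' * e q + x * e q' * d q) - (d p * e q' + x * e q * d q') by ring.
  by rewrite h' subrr.
have Drep x : exists p q, q != 0 /\ x * e q = e p.
  by case: (rep x) => -[p q] [? ?]; exists p, q.
exists D; split; first split.
- move=> x y; have [p [q [q0 xq]]] := Drep x; have [p' [q' [q0' yq']]] := Drep y.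
  have h : (x + y) * e (q * q') = e (p * q' + p' * q).
    by rewrite rmorphD !rmorphM /= -xq -yq'; ring.
  have qq0 : q * q' != 0.
    by apply: contraNneq (mulf_neq0 (e0 _ q0) (e0 _ q0')) => e'; rewrite -rmorphM e' rmorph0.
  have h1 := DE _ _ _ qq0 h; have h2 := DE _ _ _ q0 xq; have h3 := DE _ _ _ q0' yq'.
  apply: (mulIf (e0 _ qq0)); rewrite h1 dD !dM rmorphM /= -xq -yq'.
  have -> : (D x + D y) * (e q * e q') = (D x * e q) * e q' + (D y * e q') * e q by ring.
  by rewrite h2 h3; ring.
- move=> x y; have [p [q [q0 xq]]] := Drep x; have [p' [q' [q0' yq']]] := Drep y.
  have h : (x * y) * e (q * q') = e (p * p').
    by rewrite !rmorphM /= -xq -yq'; ring.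
  have qq0 : q * q' != 0.
    by apply: contraNneq (mulf_neq0 (e0 _ q0) (e0 _ q0')) => e'; rewrite -rmorphM e' rmorph0.
  have h1 := DE _ _ _ qq0 h; have h2 := DE _ _ _ q0 xq; have h3 := DE _ _ _ q0' yq'.
  apply: (mulIf (e0 _ qq0)); rewrite h1 !dM rmorphM /= -xq -yq'.
  have -> : (D x * y + x * D y) * (e q * e q')
    = (D x * e q) * y * e q' + x * (D y * e q') * e q by ring.
  by rewrite h2 h3; ring.
- move=> c; have := DE (iota c) c%:MP 1 (oner_neq0 _).
  rewrite rmorph1 !mulr1 -[e c%:MP]eE mmapC => /(_ erefl) ->.
  by rewrite /d !big1 ?mulr0 ?subrr // => i _;
    rewrite -?mpolyC1 mderivC rmorph0 mulr0.
- move=> i; have := DE (z i) 'X_i 1 (oner_neq0 _).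
  rewrite rmorph1 !mulr1 -[e 'X_i]eE mmapX mmap1U => /(_ erefl) ->.
  rewrite /d (bigD1 i) //= mderivX mnm1E eqxx scale1r.
  have -> : (U_(i) - U_(i))%MM = 0%MM by apply/mnmP => j; rewrite !mnmE subnn.
  rewrite mpolyX0 rmorph1 mulr1 !big1 ?mulr0 ?subr0 ?addr0 // => j hj.
    by rewrite -mpolyC1 mderivC rmorph0 mulr0.
  by rewrite mderivX mnm1E eq_sym (negbTE hj) scale0r rmorph0 mulr0.
Qed.

End Derivation.

Section Monomials.
Variables (F : fieldType) (n : nat).
Implicit Types (A : 'I_n -> F) (v w : 'I_n -> int).

Definition zmon A v : F := \prod_i A i ^ v i.

Lemma zmonD A v w : (forall i, A i != 0) ->
  zmon A (fun i => v i + w i) = zmon A v * zmon A w.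
Proof. by move=> A0; rewrite -big_split; apply: eq_bigr => i _; rewrite expfzDr. Qed.
Lemma zmon0 A : zmon A (fun=> 0) = 1.
Proof. by rewrite /zmon big1 // => i _; rewrite expr0z. Qed.
Lemma zmonN A v : zmon A (fun i => - v i) = (zmon A v)^-1.
Proof. by rewrite /zmon -prodfV; apply: eq_bigr => i _; rewrite invr_expz. Qed.
Lemma zmonM A v (m : int) : zmon A (fun i => v i * m) = zmon A v ^ m.
Proof.
rewrite /zmon (big_morph (fun x : F => x ^ m) (fun x y => expfzMl x y m) (exp1rz _ m)).
by apply: eq_bigr => i _; rewrite exprz_exp.
Qed.
Lemma zmon_eq A A' v v' : A =1 A' -> v =1 v' -> zmon A v = zmon A' v'.
Proof. by move=> e e'; apply: eq_bigr => i _; rewrite e e'. Qed.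
Lemma zmon_neq0 A v : (forall i, A i != 0) -> zmon A v != 0.
Proof. by move=> A0; apply/prodf_neq0 => i _; rewrite expfz_neq0. Qed.
Lemma zmon_delta A k : zmon A (fun i => (i == k)%:R) = A k.
Proof.
rewrite /zmon (bigD1 k) //= eqxx expr1z big1 ?mulr1 // => i /negbTE ->.
by rewrite expr0z.
Qed.
Lemma zmonD1 A v k : zmon A v = A k ^ v k * \prod_(i | i != k) A i ^ v i.
Proof. by rewrite /zmon (bigD1 k). Qed.

End Monomials.

Lemma expgz_exp (P : semifieldType) (F : fieldType) (f : P -> F) :
  f 1%g = 1 -> (forall x y, f (x * y)%g = f x * f y) -> (forall x, f x != 0) ->
  forall x (m : int), f (expgz x m) = f x ^ m.
Proof.
move=> f1 fM f0 x.
have fV y : f y^-1%g = (f y)^-1.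
  by apply: (mulIf (f0 y)); rewrite -fM mulVf // mulVg.
have fX (m : nat) : f (x ^+ m)%g = f x ^+ m.
  by elim: m => [|m IH]; rewrite ?expg0 ?expgS ?f1 // fM IH exprS.
by case=> m /=; rewrite ?fV fX // NegzE -exprnN.
Qed.

Lemma expgz_add (P : semifieldType) (f : P -> int) :
  f 1%g = 0 -> (forall x y, f (x * y)%g = f x + f y) ->
  forall x (m : int), f (expgz x m) = m * f x.
Proof.
move=> f1 fM x.
have fV y : f y^-1%g = - f y.
  by apply: (addrI (f y)); rewrite -fM mulgV f1 subrr.
have fX (m : nat) : f (x ^+ m)%g = m%:Z * f x.
  elim: m => [|m IH]; rewrite ?expg0 ?expgS ?f1 ?mul0r // fM IH.
  by rewrite intS mulrDl mul1r.
by case=> m /=; rewrite ?fV fX // NegzE mulNr.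
Qed.

Section Seeds.
Variables (K : comNzRingType) (P : semifieldType) (F : fieldType).
Variables (iota : {rmorphism grpring K P -> F}) (n : nat).
Implicit Types (s : seed n P F) (k : 'I_n).

(* Locked: conversion tests between field atoms would unfold the group ring. *)
Definition coef : P -> F := locked (fun x => iota (gr_elt K x)).

Lemma coefgE x : coef x = iota (gr_elt K x).
Proof. by rewrite /coef -lock. Qed.

Lemma coefgM x y : coef (x * y)%g = coef x * coef y.
Proof. by rewrite !coefgE gr_eltM rmorphM. Qed.
Lemma coefg1 : coef 1%g = 1.
Proof. by rewrite coefgE gr_elt1 rmorph1. Qed.
Lemma coef_neq0 x : coef x != 0.
Proof.
apply/eqP => h; have := coefgM x x^-1%g.
by rewrite mulgV coefg1 h mul0r => /eqP; rewrite oner_eq0.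
Qed.
Lemma coefgV x : coef x^-1%g = (coef x)^-1.
Proof. by apply: (mulIf (coef_neq0 x)); rewrite -coefgM mulVg coefg1 mulVf ?coef_neq0. Qed.
Lemma coef_expgz x m : coef (expgz x m) = coef x ^ m.
Proof. exact: (expgz_exp coefg1 coefgM coef_neq0). Qed.

Definition yhat s k : F := coef (seedX s k) * zmon (seedA s) (fun i => seedB s i k).

Lemma free_neq0 (z : 'I_n -> F) : free_generating iota z -> forall i, z i != 0.
Proof.
case=> inj _ i; apply/eqP => zi0.
have : 'X_i = 0 :> {mpoly (grpring K P)[n]}.
  by apply: inj; rewrite mmapX mmap1U rmorph0.
move=> /mpolyP /(_ U_(i)%MM); rewrite mcoeffX eqxx mcoeff0 => /eqP.
by rewrite oner_eq0.
Qed.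

Lemma free_inj (z : 'I_n -> F) : free_generating iota z -> injective z.
Proof.
case=> inj _ i j zij.
have : 'X_i = 'X_j :> {mpoly (grpring K P)[n]}.
  by apply: inj; rewrite !mmapX !mmap1U.
move=> /mpolyP /(_ U_(i)%MM); rewrite !mcoeffX eqxx => /eqP.
case: (U_(j)%MM =P U_(i)%MM) => [e _|_]; last by rewrite oner_eq0.
have := congr1 (fun m : 'X_{1..n} => m i) e.
by rewrite !mnm1E eqxx; case: (j =P i).
Qed.

Lemma yhatD1 s k i : yhat s k = coef (seedX s k)
  * (seedA s i ^ seedB s i k * \prod_(l | l != i) seedA s l ^ seedB s l k).
Proof. by rewrite /yhat (zmonD1 _ _ i). Qed.

Section OneSeed.
Variables (s : seed n P F) (k : 'I_n).
Hypothesis A0 : forall i, seedA s i != 0.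
Hypothesis Bkk : forall i, seedB s i i = 0.

Lemma exch_posE : exch_pos s k = zmon (seedA s) (fun i => Num.max (seedB s i k) 0).
Proof.
rewrite /exch_pos /zmon big_mkcond /=; apply: eq_bigr => i _.
by case: (ltP 0 (seedB s i k)) => // h; rewrite expr0z.
Qed.

Lemma exch_negE : exch_neg s k = zmon (seedA s) (fun i => Num.max (- seedB s i k) 0).
Proof.
rewrite /exch_neg /zmon big_mkcond /=; apply: eq_bigr => i _.
rewrite -oppr_gt0.
by case: (ltP 0 (- seedB s i k)) => // h; rewrite expr0z.
Qed.

Lemma exch_pos_neg : coef (seedX s k) * exch_pos s k = exch_neg s k * yhat s k.
Proof.
rewrite exch_posE exch_negE /yhat mulrCA -zmonD //; congr (_ * _).
by apply: zmon_eq => // i; lia.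
Qed.

Lemma exch_binomial_terms : exch_binomial iota s k
  = coef (seedX s k / oplus 1 (seedX s k))%g * exch_pos s k
    + coef (oplus 1 (seedX s k))^-1%g * exch_neg s k.
Proof. by rewrite !coefgE. Qed.

Lemma exch_neg_neq0 : exch_neg s k != 0.
Proof. by rewrite exch_negE zmon_neq0. Qed.

Lemma exch_binomialE : exch_binomial iota s k
  = (coef (oplus 1%g (seedX s k)))^-1 * exch_neg s k * (1 + yhat s k).
Proof.
rewrite /exch_binomial -!coefgE coefgM coefgV mulrAC exch_pos_neg.
by ring.
Qed.

Lemma mutA_k : seedA (mutation iota k s) k = (seedA s k)^-1 * exch_binomial iota s k.
Proof. by rewrite ffunE eqxx. Qed.
Lemma mutA_neq i : i != k -> seedA (mutation iota k s) i = seedA s i.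
Proof. by rewrite ffunE => /negbTE ->. Qed.
Lemma mutX_k : seedX (mutation iota k s) k = (seedX s k)^-1%g.
Proof. by rewrite ffunE eqxx. Qed.
Lemma mutX_neq i : i != k -> seedX (mutation iota k s) i
  = (seedX s i * expgz (seedX s k) (Num.max (seedB s k i) 0)
     * expgz (oplus 1 (seedX s k)) (- seedB s k i))%g.
Proof. by rewrite ffunE => /negbTE ->. Qed.

Lemma mutB_k i : seedB (mutation iota k s) i k = - seedB s i k.
Proof. by rewrite mxE eqxx orbT. Qed.

Lemma yhat_mut_k : yhat (mutation iota k s) k = (yhat s k)^-1.
Proof.
rewrite /yhat mutX_k coefgV invfM -zmonN; congr (_ * _).
rewrite !(zmonD1 _ _ k) !mutB_k Bkk oppr0 !expr0z; congr (_ * _).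
by apply: eq_bigr => i ik; rewrite mutA_neq // mutB_k.
Qed.

(** The [yhat] mutate like the coefficients, with the addition of [F] in place of [oplus]: the
    powers of [coef (oplus 1 X_k)] coming from [X'_i] and from [A'_k] cancel. *)
Lemma yhat_mut_neq i : i != k -> 1 + yhat s k != 0 ->
  yhat (mutation iota k s) i
  = yhat s i * yhat s k ^ Num.max (seedB s k i) 0 * (1 + yhat s k) ^ (- seedB s k i).
Proof.
move=> ik y0; rewrite {1}/yhat mutX_neq // !coefgM !coef_expgz.
rewrite (zmonD1 _ _ k) mutA_k mxE eqxx /=.
have -> : \prod_(l | l != k) seedA (mutation iota k s) l ^ seedB (mutation iota k s) l i
  = \prod_(l | l != k) seedA s l ^ (seedB s l i +
      Num.sg (seedB s l k) * Num.max (seedB s l k * seedB s k i) 0).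
  by apply: eq_bigr => l lk; rewrite mutA_neq // mxE (negbTE lk) (negbTE ik).
set b := seedB s k i.
have cz := coef_neq0.
rewrite exch_binomialE.
have -> : ((seedA s k)^-1 *
  ((coef (oplus 1%g (seedX s k)))^-1 * exch_neg s k * (1 + yhat s k))) ^ (- b)
  = seedA s k ^ b * coef (oplus 1%g (seedX s k)) ^ b * exch_neg s k ^ (- b)
    * (1 + yhat s k) ^ (- b).
  by rewrite !expfzMl !exprz_inv opprK !mulrA.
have -> : \prod_(l | l != k) seedA s l ^ (seedB s l i +
      Num.sg (seedB s l k) * Num.max (seedB s l k * b) 0)
   = (\prod_(l | l != k) seedA s l ^ seedB s l i) *
     zmon (seedA s) (fun l => Num.sg (seedB s l k) * Num.max (seedB s l k * b) 0).
  rewrite [zmon _ _](zmonD1 _ _ k) Bkk sgr0 mul0r expr0z mul1r -big_split /=.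
  by apply: eq_bigr => l _; rewrite expfzDr.
have -> : yhat s k ^ Num.max b 0 = coef (seedX s k) ^ Num.max b 0 *
   (exch_neg s k ^ (- b) *
     zmon (seedA s) (fun l => Num.sg (seedB s l k) * Num.max (seedB s l k * b) 0)).
  rewrite /yhat expfzMl exch_negE -!zmonM -zmonD //; congr (_ * _).
  (* What remains is b_lk max(b, 0) = - b max(- b_lk, 0) + sg(b_lk) max(b_lk b, 0). *)
  apply: zmon_eq => // l.
  case: (ltgtP (seedB s l k) 0) => h.
  - by rewrite ltr0_sg //; case: (leP b 0) => hb; nia.
  - by rewrite gtr0_sg //; case: (leP b 0) => hb; nia.
  - by rewrite h sgr0 !mul0r addr0.
rewrite (yhatD1 s i k) -/b.
rewrite -[coef (oplus _ _) ^ (- b)]invr_expz.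
have c0 : coef (oplus 1%g (seedX s k)) ^ b != 0 by rewrite expfz_neq0.
set c := coef (oplus _ _) ^ b in c0 *.
rewrite /b.
by field.
Qed.

End OneSeed.
End Seeds.

Definition trivial_character (P : semifieldType) (E : comNzRingType) : character P E :=
  @Character P E (fun=> 1) erefl (fun _ _ => esym (mulr1 1)).

Section PositiveCone.
Variables (K : idomainType) (P : semifieldType) (F : fieldType) (n : nat).
Hypothesis K_char0 : [pchar K] =i pred0.
Variables (iota : {rmorphism grpring K P -> F}) (z : 'I_n -> F).
Hypothesis z_free : free_generating iota z.

Lemma K_nat_neq0 m : m.+1%:R != 0 :> K.
Proof. by rewrite (proj1 (pcharf0P K) K_char0). Qed.

Definition augmentation : {rmorphism {mpoly (grpring K P)[n]} -> K} :=
  mmap (gr_eval (idfun : {rmorphism K -> K}) (trivial_character P K)) (fun=> 1).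

(** Positivity is tested where all group elements and variables are 1: numerator and denominator
    become positive integers, which are nonzero in characteristic 0. *)
Definition positive_elt (f : F) : Prop := exists p q a b,
  [/\ augmentation p = a.+1%:R, augmentation q = b.+1%:R
    & f = mmap iota z p / mmap iota z q].

Lemma augmentation_neq0 p a : augmentation p = a.+1%:R -> mmap iota z p != 0.
Proof.
move=> pa; apply/eqP => p0; have /eqP[] := K_nat_neq0 a.
rewrite -pa (_ : p = 0) ?rmorph0 //.
by apply: (proj1 z_free); rewrite rmorph0.
Qed.

Lemma positive_elt_cone : positive_cone positive_elt.
Proof.
split.
- by exists 1, 1, 0%N, 0%N; rewrite !rmorph1 divr1.
- move=> _ _ [p [q [a [b [pa qb ->]]]]] [p' [q' [a' [b' [pa' qb' ->]]]]].
  exists (p * q' + p' * q), (q * q'), (a.+1 * b'.+1 + a'.+1 * b.+1).-1, (b.+1 * b'.+1).-1.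
  split.
  + by rewrite prednK ?addn_gt0 // rmorphD !rmorphM pa pa' qb qb' natrD !natrM.
  + by rewrite prednK // rmorphM qb qb' natrM.
  + by rewrite rmorphD !rmorphM addf_div ?(augmentation_neq0 qb) ?(augmentation_neq0 qb').
- move=> _ _ [p [q [a [b [pa qb ->]]]]] [p' [q' [a' [b' [pa' qb' ->]]]]].
  exists (p * p'), (q * q'), (a.+1 * a'.+1).-1, (b.+1 * b'.+1).-1.
  split.
  + by rewrite prednK // rmorphM pa pa' natrM.
  + by rewrite prednK // rmorphM qb qb' natrM.
  + by rewrite !rmorphM mulf_div.
- move=> _ [p [q [a [b [pa qb ->]]]]].
  by exists q, p, b, a; rewrite invf_div.
- move=> _ [p [q [a [b [pa qb ->]]]]].
  by rewrite mulf_neq0 ?invr_eq0 ?(augmentation_neq0 pa) ?(augmentation_neq0 qb).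
Qed.

Lemma positive_elt_z i : positive_elt (z i).
Proof.
exists 'X_i, 1, 0%N, 0%N; rewrite !rmorph1 divr1; split=> //.
  by rewrite /augmentation /= mmapX mmap1U.
by rewrite mmapX mmap1U.
Qed.

Lemma positive_elt_coef x : positive_elt (coef iota x).
Proof.
rewrite coefgE; exists (gr_elt K x)%:MP, 1, 0%N, 0%N; rewrite !rmorph1 divr1; split=> //.
  by rewrite [LHS]mmapC [LHS]gr_eval_elt.
by rewrite mmapC.
Qed.

Lemma F_nat_neq0 m : m.+1%:R != 0 :> F.
Proof.
apply: (cone_neq0 positive_elt_cone).
exists m.+1%:R, 1, m, 0%N; rewrite !rmorph1 !rmorph_nat divr1; split=> //.
Qed.

End PositiveCone.

(** * The semifield homomorphism and the bracket of a seed pattern *)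

Section Pattern.
Variables (K : idomainType) (n : nat) (F : fieldType).
Notation P := (Qsf n).
Variables (iota : {rmorphism grpring K P -> F}) (S : tree n -> seed n P F).
Hypothesis K_char0 : [pchar K] =i pred0.
Hypothesis S_pattern : seed_pattern iota S.
Variable tstar : tree n.
Hypothesis S_univ : forall i : 'I_n, seedX (S tstar) i = Qsf_var i.
Variable sk : 'I_n -> int.
Hypothesis S_sym : forall t, symmetrizes sk (seedB (S t)).

Notation A t := (seedA (S t)).
Notation B t := (seedB (S t)).
Notation X t := (seedX (S t)).
Notation y t := (yhat iota (S t)).
Notation coef := (coef iota).

Lemma A_free t : free_generating iota (A t).
Proof. by have [/(_ t) []] := S_pattern. Qed.
Lemma A_neq0 t i : A t i != 0.
Proof. exact: free_neq0 (A_free t) i. Qed.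
Lemma S_mut t k : S (nbr k t) = mutation iota k (S t).
Proof. by have [_ ->] := S_pattern. Qed.
Lemma B_diag t i : B t i i = 0.
Proof. exact: symmetrizes_diag (S_sym t). Qed.

Definition pos := positive_elt iota (A tstar).

Lemma pos_cone : positive_cone pos.
Proof. exact/positive_elt_cone/A_free. Qed.
Lemma pos_coef x : pos (coef x).
Proof. exact: positive_elt_coef. Qed.
Lemma pos_neq0 f : pos f -> f != 0.
Proof. exact: cone_neq0 pos_cone _. Qed.

Lemma pos_zmon (z : 'I_n -> F) v : (forall i, pos (z i)) -> pos (zmon z v).
Proof.
move=> zp; apply: (cone_prod pos_cone) => i.
by apply: (cone_expz pos_cone).
Qed.

Lemma pos_yhat_seed (s : seed n P F) k : (forall i, pos (seedA s i)) -> pos (yhat iota s k).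
Proof. by move=> Ap; apply: (coneM pos_cone); [apply: pos_coef | apply: pos_zmon]. Qed.

Lemma pos_A t i : pos (A t i).
Proof.
move: t i; apply: (tree_ind (t0 := tstar)) => [i|t k IH i].
  exact: positive_elt_z.
rewrite S_mut; have [->|ik] := eqVneq i k; last by rewrite mutA_neq.
rewrite mutA_k exch_binomialE ?exch_negE; last exact: A_neq0.
have cone := pos_cone.
do !apply: (coneM cone); try apply: (coneV cone) => //.
- exact: pos_coef.
- exact: pos_zmon.
- by apply: (coneD cone); [apply: cone1 | apply: pos_yhat_seed].
Qed.

Lemma pos_yhat t k : pos (y t k).
Proof. by apply: pos_yhat_seed => i; apply: pos_A. Qed.
Lemma yhat_neq0 t k : y t k != 0.
Proof. exact/pos_neq0/pos_yhat. Qed.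
Lemma pos_yhat1 t k : pos (1 + y t k).
Proof. by apply: (coneD pos_cone); [apply: cone1 pos_cone | apply: pos_yhat]. Qed.
Lemma yhat1_neq0 t k : 1 + y t k != 0.
Proof. exact/pos_neq0/pos_yhat1. Qed.

(* Locked: unfolding [psi] makes conversion tests on field atoms diverge. *)
Definition psi : P -> F := locked (sf_hom (y tstar)).
Lemma psiE a : psi a = sf_hom (y tstar) a.
Proof. by rewrite /psi -lock. Qed.

Lemma psiM a b : psi (a * b)%g = psi a * psi b.
Proof. by rewrite !psiE (sf_homM pos_cone (pos_yhat tstar)). Qed.
Lemma psiD a b : psi (oplus a b) = psi a + psi b.
Proof. by rewrite !psiE (sf_homD pos_cone (pos_yhat tstar)). Qed.
Lemma psi1 : psi 1%g = 1.
Proof. by rewrite psiE (sf_hom1 pos_cone (pos_yhat tstar)). Qed.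
Lemma psiV a : psi a^-1%g = (psi a)^-1.
Proof. by rewrite !psiE (sf_homV pos_cone (pos_yhat tstar)). Qed.
Lemma pos_psi a : pos (psi a).
Proof. by rewrite psiE; apply: sf_hom_cone pos_cone (pos_yhat tstar) _. Qed.
Lemma psi_neq0 a : psi a != 0.
Proof. exact/pos_neq0/pos_psi. Qed.
Lemma psi_expgz a m : psi (expgz a m) = psi a ^ m.
Proof. exact: (expgz_exp psi1 psiM psi_neq0). Qed.

Lemma psi_X t i : psi (X t i) = y t i.
Proof.
move: t i; apply: (tree_ind (t0 := tstar)) => [i|t k IH i].
  by rewrite S_univ psiE (sf_hom_var pos_cone (pos_yhat tstar)).
rewrite S_mut; have [->|ik] := eqVneq i k.
  by rewrite mutX_k psiV IH yhat_mut_k // => j; apply: B_diag.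
rewrite mutX_neq // !psiM !psi_expgz psiD psi1 !IH yhat_mut_neq ?yhat1_neq0 //.
  by move=> j; apply: A_neq0.
by move=> j; apply: B_diag.
Qed.

Lemma A_nbr_k t k : A (nbr k t) k
  = (A t k)^-1 * ((coef (oplus 1%g (X t k)))^-1 * exch_neg (S t) k * (1 + y t k)).
Proof. by rewrite S_mut mutA_k exch_binomialE // => i; apply: A_neq0. Qed.
Lemma A_nbr_neq t k i : i != k -> A (nbr k t) i = A t i.
Proof. by move=> ik; rewrite S_mut mutA_neq. Qed.
Lemma X_nbr_k t k : X (nbr k t) k = (X t k)^-1%g.
Proof. by rewrite S_mut mutX_k. Qed.
Lemma X_nbr_neq t k i : i != k -> X (nbr k t) i
  = (X t i * expgz (X t k) (Num.max (B t k i) 0)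
     * expgz (oplus 1 (X t k)) (- B t k i))%g.
Proof. by move=> ik; rewrite S_mut mutX_neq. Qed.

(* [lam x] is the derivation [{x, -}], for the bracket on the pair (P, F) with
   [{X_i, A_j} = delta_ij s_i X_i A_j], divided by [psi x]. *)
Section Bracket.
Variable d : 'I_n -> F -> F.
Hypothesis d_der : forall l, derivation_over iota (d l).
Hypothesis d_A : forall l i, d l (A tstar i) = (i == l)%:R * A tstar i.

Definition lam (x : P) (f : F) : F :=
  \sum_l ((sk l)%:~R * sf_dlog (y tstar) l x) * d l f.

Lemma lam_der x : derivation_over iota (lam x).
Proof. exact: (derivation_sum _ (fun l => (sk l)%:~R * sf_dlog (y tstar) l x)). Qed.
Lemma lamM a b f : lam (a * b)%g f = lam a f + lam b f.
Proof.
rewrite /lam -big_split; apply: eq_bigr => l _.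
by rewrite (sf_dlogM pos_cone (pos_yhat tstar)) /=; ring.
Qed.
Lemma lamV a f : lam a^-1%g f = - lam a f.
Proof.
rewrite /lam -sumrN; apply: eq_bigr => l _.
by rewrite (sf_dlogV pos_cone (pos_yhat tstar)) /=; ring.
Qed.
Lemma lam1 f : lam 1%g f = 0.
Proof. by apply: (addrI (lam 1%g f)); rewrite -lamM mul1g addr0. Qed.
Lemma lamD a b f : psi (oplus a b) * lam (oplus a b) f
  = psi a * lam a f + psi b * lam b f.
Proof.
rewrite /lam !mulr_sumr -big_split; apply: eq_bigr => l _.
rewrite !psiE; transitivity ((sk l)%:~R * (sf_hom (y tstar) (oplus a b)
  * sf_dlog (y tstar) l (oplus a b)) * d l f).
  by ring.
by rewrite (sf_dlogD pos_cone (pos_yhat tstar)) /=; ring.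
Qed.
Lemma lam_expgz a m f : lam (expgz a m) f = m%:~R * lam a f.
Proof.
have lamX k : lam (a ^+ k)%g f = k%:R * lam a f.
  elim: k => [|k IH]; first by rewrite expg0 lam1 mul0r.
  by rewrite expgS lamM IH -natr1 mulrDl mul1r addrC.
case: m => m /=; first by rewrite lamX.
by rewrite lamV lamX NegzE mulrNz mulNr.
Qed.

(** Logarithmic derivatives of the exchange relation and of the coefficient mutation are compared.
    The terms with y_k / (1 + y_k) cancel because s_i b_ik = - s_k b_ki, so the bracket keeps its
    form under mutation. *)
Lemma lam_X t i l : lam (X t i) (A t l) = (i == l)%:R * (sk i)%:~R * A t l.
Proof.
move: t i l; apply: (tree_ind (t0 := tstar)) => [i l|t k IH i l].
  rewrite S_univ /lam (bigD1 i) //= big1 => [|m mi].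
    rewrite (sf_dlog_var pos_cone (pos_yhat tstar)) eqxx mulr1 addr0 d_A eq_sym.
    by ring.
  by rewrite (sf_dlog_var pos_cone (pos_yhat tstar)) (negbTE mi) mulr0 mul0r.
have A0 := A_neq0 t.
have [_ sE] := S_sym t.
have lX m i' : dlg (lam (X t m)) (A t i') = (m == i')%:R * (sk m)%:~R.
  by rewrite /dlg IH mulfK.
(* The contribution of [X_k] to the logarithmic derivative of [X'_i]; the factor y / (1 + y) is its
   share in that of [oplus 1 X_k]. *)
pose c : F := (Num.max (B t k i) 0)%:~R + (- B t k i)%:~R * (y t k / (1 + y t k)).
have hX f : i != k -> lam (X (nbr k t) i) f = lam (X t i) f + c * lam (X t k) f.
  move=> ik; rewrite X_nbr_neq // !lamM !lam_expgz.
  have := lamD 1%g (X t k) f; rewrite psiD psi1 lam1 mulr0 add0r psi_X => h.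
  have {h} -> : lam (oplus 1%g (X t k)) f = y t k / (1 + y t k) * lam (X t k) f.
    by apply: (mulfI (yhat1_neq0 t k)); rewrite h; field; apply: yhat1_neq0.
  by rewrite /c; ring.
have [lk|lk] := eqVneq l k; last first.
  rewrite A_nbr_neq //; have [->|ik] := eqVneq i k.
    by rewrite X_nbr_k lamV IH eq_sym (negbTE lk) !mul0r oppr0.
  by rewrite hX // !IH [k == l]eq_sym (negbTE lk) !mul0r mulr0 addr0.
subst l.
have A0' := A_neq0 (nbr k t) k.
have en0 : exch_neg (S t) k != 0 by apply: exch_neg_neq0.
have y10 := yhat1_neq0 t k.
have y0 := yhat_neq0 t k.
have cc0 := coef_neq0 iota.
have dlg_A' x : dlg (lam x) (A (nbr k t) k) = - dlg (lam x) (A t k)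
   + (\sum_i (Num.max (- B t i k) 0)%:~R * dlg (lam x) (A t i)
   + y t k / (1 + y t k) * \sum_i (B t i k)%:~R * dlg (lam x) (A t i)).
  have D := lam_der x.
  rewrite A_nbr_k (dlgM D) ?invr_eq0 ?mulf_neq0 ?invr_eq0 ?cc0 // (dlgV D) //.
  congr (_ + _); rewrite (dlgM D) ?mulf_neq0 ?invr_eq0 ?cc0 //.
  rewrite -coefgV (coefgE iota) (dlg_iotaM D) -?coefgE ?cc0 // exch_negE.
  have dz v : dlg (lam x) (zmon (A t) v) = \sum_i (v i)%:~R * dlg (lam x) (A t i).
    rewrite (dlg_prod D) => [|i']; last by rewrite expfz_neq0.
    by apply: eq_bigr => i' _; rewrite (dlg_expz D).
  rewrite dz; congr (_ + _).
  rewrite /dlg (derD D) (der1 D) add0r (dlgE _ y0) mulrAC.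
  rewrite {1}/yhat (coefgE iota) (dlg_iotaM D) -?coefgE ?cc0 ?zmon_neq0 // dz.
  by rewrite /dlg; ring.
have hs m v : \sum_i' v i' * dlg (lam (X t m)) (A t i') = v m * (sk m)%:~R.
  rewrite (bigD1 m) //= lX eqxx mul1r big1 ?addr0 // => i' im.
  by rewrite lX eq_sym (negbTE im) mul0r mulr0.
apply: (mulIf (invr_neq0 A0')).
rewrite mulfK //.
rewrite -[LHS]/(dlg (lam (X (nbr k t) i)) (A (nbr k t) k)).
have [->|ik] := eqVneq i k.
  rewrite {1}/dlg X_nbr_k lamV -/(dlg _ _) mulNr -/(dlg (lam (X t k)) (A (nbr k t) k)) dlg_A'.
  by rewrite lX eqxx !hs B_diag oppr0 maxxx !mul0r mulr0 !addr0 opprK.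
rewrite {1}/dlg hX // mulrDl -mulrA -!/(dlg _ (A (nbr k t) k)).
rewrite -/(dlg (lam (X t i)) (A (nbr k t) k)) -/(dlg (lam (X t k)) (A (nbr k t) k)).
rewrite !dlg_A' !lX eqxx (negbTE ik) !hs B_diag oppr0 maxxx.
have e : (B t i k)%:~R * (sk i)%:~R = - (B t k i)%:~R * (sk k)%:~R :> F.
  by rewrite -[- _%:~R]mulrNz -!intrM [B t i k * _]mulrC sE mulNr [sk k * _]mulrC.
have e2 : (Num.max (- B t i k) 0)%:~R * (sk i)%:~R
   = (Num.max (B t k i) 0)%:~R * (sk k)%:~R :> F.
  rewrite -!intrM; congr (_%:~R).
  have [s0 _] := S_sym t; have si := s0 i; have sk0 := s0 k; have h := sE i k.
  by nia.
rewrite e e2 /c mulrNz !mul0r mulr0 !addr0 mul1r oppr0 add0r.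
set w := y t k / _; set m := (Num.max _ _)%:~R; set b := (B t k i)%:~R.
by ring.
Qed.

End Bracket.

(** * Degrees of coefficients and separation of cluster variables *)

Lemma lcoef_neq0 (x : P) : lcoef x != 0.
Proof.
have [a b] := sfx_frac_neq0 (sfx_rep x).
by rewrite mulf_neq0 ?invr_eq0 ?mleadc_rat_neq0.
Qed.

Lemma lcoef1 : lcoef (1%g : P) = 1.
Proof. by apply: (mulfI (lcoef_neq0 1%g)); rewrite -lcoefM mul1g mulr1. Qed.

(* At [tstar] the degree is the leading exponent [lexp]; a mutation acts on it
   by a tropical, unimodular change of basis, because of [grad_add1]. *)
Record grading t (xdeg : P -> 'I_n -> int) : Prop := Grading {
  gradM : forall a b l, xdeg (a * b)%g l = xdeg a l + xdeg b l;
  grad_X : forall i l, xdeg (X t i) l = (l == i)%:R;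
  grad_add1 : forall x, (exists l, xdeg x l != 0) ->
    (xdeg (oplus 1%g x) =1 xdeg x /\ lcoef (oplus 1%g x) = lcoef x)
    \/ ((forall l, xdeg (oplus 1%g x) l = 0) /\ lcoef (oplus 1%g x) = 1) }.

Lemma grad1 t xdeg : grading t xdeg -> forall l, xdeg 1%g l = 0.
Proof. by move=> G l; apply: (addrI (xdeg 1%g l)); rewrite -(gradM G) mul1g addr0. Qed.

Lemma grad_expgz t xdeg : grading t xdeg -> forall x m l, xdeg (expgz x m) l = m * xdeg x l.
Proof.
by move=> G x m l; apply: (expgz_add (f := xdeg^~ l)); [exact: (grad1 G) | move=> a b; exact: (gradM G)].
Qed.

Lemma exists_grading t : (exists xdeg, grading t xdeg) /\ (forall i, lcoef (X t i) = 1).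
Proof.
move: t; apply: (tree_ind (t0 := tstar)) => [|t k [[xdeg G] lX]].
  split=> [|i]; last by rewrite S_univ lcoef_var.
  exists (@lexp n); split=> [a b l|i l|x]; first exact: lexpM.
    by rewrite S_univ lexp_var.
  exact: lexp_add1.
have hk : exists l, xdeg (X t k) l != 0 by exists k; rewrite (grad_X G) eqxx.
have l1 : lcoef (oplus 1%g (X t k)) = 1.
  by case: (grad_add1 G hk) => -[_ ->].
have xdeg1 l : l != k -> xdeg (oplus 1%g (X t k)) l = 0.
  by move=> lk; case: (grad_add1 G hk) => -[-> //]; rewrite (grad_X G) (negbTE lk).
have lexpg x m : lcoef (expgz x m : P) = lcoef x ^ m.
  by apply: (expgz_exp lcoef1 (@lcoefM n) lcoef_neq0).
split; last first.
  move=> i; have [->|ik] := eqVneq i k.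
    rewrite X_nbr_k; apply: (mulfI (lcoef_neq0 (X t k))).
    by rewrite -lcoefM mulgV lcoef1 lX mulr1.
  by rewrite X_nbr_neq // !lcoefM !lexpg !lX l1 !exp1rz.
have X'k l : xdeg (X (nbr k t) k) l = - (l == k)%:R.
  rewrite X_nbr_k; apply: (addrI (xdeg (X t k) l)).
  by rewrite -(gradM G) mulgV (grad1 G) (grad_X G) subrr.
have X'i i l : i != k -> l != k -> xdeg (X (nbr k t) i) l = (l == i)%:R.
  move=> ik lk; rewrite X_nbr_neq // !(gradM G) !(grad_expgz G) !(grad_X G).
  by rewrite xdeg1 // (negbTE lk) !mulr0 !addr0.
(* For [i != k] the degrees of [X'_i] and [X_i] differ only in the coordinate [k], and [X'_k] has
   minus the degree of [X_k]. So only that coordinate has to be corrected. *)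
pose xdeg' x l := if l == k then
  - xdeg x k + \sum_(i | i != k) xdeg (X (nbr k t) i) k * xdeg x i else xdeg x l.
have xdeg'0 x : (forall l, xdeg x l = 0) -> forall l, xdeg' x l = 0.
  move=> x0 l; rewrite /xdeg' !x0 big1 ?if_same ?oppr0 ?addr0 // => i _.
  by rewrite x0 mulr0.
have xdeg'E x x' : xdeg x =1 xdeg x' -> xdeg' x =1 xdeg' x'.
  move=> e l; rewrite /xdeg' !e; case: ifP => // _; congr (_ + _).
  by apply: eq_bigr => i _; rewrite e.
exists xdeg'; split=> [a b l|i l|x [l xl]].
- rewrite /xdeg'; case: ifP => _; rewrite (gradM G) //.
  rewrite opprD addrACA -big_split /=; congr (_ + _).
  by apply: eq_bigr => i _; rewrite (gradM G) mulrDr.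
- rewrite /xdeg'; have [->|lk] := eqVneq l k; last first.
    have [->|ik] := eqVneq i k; last exact: X'i.
    by rewrite X'k (negbTE lk) oppr0.
  have [->|ik] := eqVneq i k.
    by rewrite X'k eqxx opprK big1 ?addr0 // => i' ik'; rewrite X'k (negbTE ik') oppr0 mulr0.
  rewrite (bigD1 i) //= (X'i i i) // eqxx mulr1 big1 => [|i' /andP[i'k i'i]].
    by rewrite addr0 addNr.
  by rewrite (X'i i i') // (negbTE i'i) mulr0.
- have hx : exists l, xdeg x l != 0.
    apply: boolp.contrapT => /boolp.forallNP h; move/eqP: xl; apply; apply: xdeg'0 => l'.
    by apply/eqP; rewrite -[_ == _]negbK; apply/negP/h.
  case: (grad_add1 G hx) => -[e1 e2]; [left|right]; split=> //.
    exact: xdeg'E.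
  exact: xdeg'0.
Qed.

Definition xdeg t : P -> 'I_n -> int := sval (boolp.cid (proj1 (exists_grading t))).
Lemma xdeg_grading t : grading t (xdeg t).
Proof. by rewrite /xdeg; case: boolp.cid. Qed.
Lemma xdegM t a b l : xdeg t (a * b)%g l = xdeg t a l + xdeg t b l.
Proof. exact: gradM (xdeg_grading t) _ _ _. Qed.
Lemma xdeg1 t l : xdeg t 1%g l = 0.
Proof. exact: grad1 (xdeg_grading t) _. Qed.
Lemma xdeg_X t i l : xdeg t (X t i) l = (l == i)%:R.
Proof. exact: grad_X (xdeg_grading t) _ _. Qed.
Lemma xdeg_expgz t x m l : xdeg t (expgz x m) l = m * xdeg t x l.
Proof. exact: grad_expgz (xdeg_grading t) _ _ _. Qed.
Lemma lcoef_X t i : lcoef (X t i) = 1.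
Proof. exact: (proj2 (exists_grading t)). Qed.
Lemma lcoef_addX t i : lcoef (oplus 1%g (X t i)) = 1.
Proof.
have h : exists l, xdeg t (X t i) l != 0 by exists i; rewrite xdeg_X eqxx.
by case: (grad_add1 (xdeg_grading t) h) => -[_ ->]; rewrite ?lcoef_X.
Qed.

(** Mutation is involutive, so the coefficients of a seed are subtraction-free in those of its
    neighbour. *)
Lemma sfx_gen t (x : P) : exists e, sfx_semifield (X t) e = x.
Proof.
move: t x; apply: (tree_ind (t0 := tstar)) => [x|t k IH x].
  have [e <-] := sfx_val_surj x; exists e.
  by elim: e => //= a -> b ->.
set t' := nbr k t.
pose Q x := exists e, sfx_semifield (X t') e = x.
have Q1 : Q 1%g by exists SfOne.
have QX i : Q (X t' i) by exists (SfVar i).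
have QD a b : Q a -> Q b -> Q (oplus a b) by move=> [e <-] [e' <-]; exists (SfAdd e e').
have QM a b : Q a -> Q b -> Q (a * b)%g by move=> [e <-] [e' <-]; exists (SfMul e e').
have QV a b : Q a -> Q b -> Q (a / b)%g by move=> [e <-] [e' <-]; exists (SfDiv e e').
have QE a m : Q a -> Q (expgz a m).
  move=> Qa; have Qn (l : nat) : Q (a ^+ l)%g.
    by elim: l => [|l IHl]; rewrite ?expg0 ?expgS //; apply: QM.
  by case: m => m //=; rewrite -[(_ ^- _)%g]mul1g; apply: QV.
have QXt i : Q (X t i).
  rewrite -[t](nbrK k) -/t'; have [->|ik] := eqVneq i k.
    by rewrite X_nbr_k -[(_^-1)%g]mul1g; apply: QV.
  by rewrite X_nbr_neq //; apply: (QM); [apply: (QM) => //|]; apply: QE => //; apply: QD.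
have [e <-] := IH x; elim: e => [|i|a Qa b Qb|a Qa b Qb|a Qa b Qb] /=.
- exact: Q1.
- exact: QXt.
- exact: QD.
- exact: QM.
- exact: QV.
Qed.

Lemma psi_sfx t e : psi (sfx_semifield (X t) e) = sfx_field (y t) e.
Proof.
elim: e => [|i|a IHa b IHb|a IHa b IHb|a IHa b IHb] /=.
- exact: psi1.
- exact: psi_X.
- by rewrite psiD IHa IHb.
- by rewrite psiM IHa IHb.
- by rewrite psiM psiV IHa IHb.
Qed.

Lemma sfx_eq (Z : 'I_n -> P) e e' :
  sfx_num e * sfx_den e' = sfx_num e' * sfx_den e ->
  sfx_semifield Z e = sfx_semifield Z e'.
Proof.
move=> h; apply: val_inj; rewrite /= !sfx_semifield_val.
set z := fun i => _.
have Cz i : subtraction_free (z i) by apply: Qsf_sf.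
case: (sfx_cone (cone_subtraction_free n) Cz e) => Ca Cb ->.
case: (sfx_cone (cone_subtraction_free n) Cz e') => Cc Cd ->.
by apply/eqP; rewrite eqr_div ?subtraction_free_neq0 // -!rmorphM h.
Qed.

(* [lcoef h = 1] rules out [h] a positive integer [m]: [psi m / coef m], the
   quotient of [m] by the group element [m], is a unit but not a monomial. *)
Definition separated t0 (f : F) : Prop := exists g h,
  lcoef h = 1 /\ f = zmon (A t0) g * psi h / coef h.

Lemma separatedM t0 f f' : separated t0 f -> separated t0 f' -> separated t0 (f * f').
Proof.
move=> [g [h [l ->]]] [g' [h' [l' ->]]].
exists (fun i => g i + g' i), (h * h')%g; split; first by rewrite lcoefM l l' mulr1.
rewrite zmonD; last exact: A_neq0.
rewrite psiM coefgM invfM; ring.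
Qed.

Lemma separated_zmon t0 (z : 'I_n -> F) v : (forall i, separated t0 (z i)) ->
  separated t0 (zmon z v).
Proof.
move=> sz.
have s1 : separated t0 1.
  exists (fun=> 0), 1%g; split; first exact: lcoef1.
  by rewrite zmon0 psi1 coefg1 divr1 mulr1.
have sV f : separated t0 f -> separated t0 f^-1.
  move=> [g [h [l ->]]]; exists (fun i => - g i), (h^-1)%g; split.
    by apply: (mulfI (lcoef_neq0 h)); rewrite -lcoefM mulgV lcoef1 l mulr1.
  by rewrite zmonN psiV coefgV invrK !invfM invrK.
have sX f (m : nat) : separated t0 f -> separated t0 (f ^+ m).
  by move=> sf; elim: m => [|m IH]; rewrite ?expr0 ?exprS //; apply: separatedM.
have sZ f (m : int) : separated t0 f -> separated t0 (f ^ m).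
  move=> sf; case: m => m; first exact: sX.
  by rewrite NegzE -exprnN; apply/sV/sX.
by rewrite /zmon; elim/big_ind: _ => //; [exact: separatedM | move=> i _; apply: sZ].
Qed.

(** The factor that a mutation adds, [1 + y_k] over the coefficient [oplus 1 X_k], is
    [psi h / coef h] for [h = oplus 1 X_k]. The other factors form a Laurent monomial in variables
    already separated. *)
Lemma separated_A t0 t i : separated t0 (A t i).
Proof.
move: t i; apply: (tree_ind (t0 := t0)) => [i|t k IH i].
  exists (fun l => (l == i)%:R), 1%g; split; first exact: lcoef1.
  by rewrite zmon_delta psi1 coefg1 divr1 mulr1.
have [->|ik] := eqVneq i k; last by rewrite A_nbr_neq.
rewrite A_nbr_k exch_negE.
have -> : (A t k)^-1 * ((coef (oplus 1%g (X t k)))^-1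
   * zmon (A t) (fun i => Num.max (- B t i k) 0) * (1 + y t k))
  = zmon (A t) (fun i => Num.max (- B t i k) 0 - (i == k)%:R)
    * ((1 + y t k) / coef (oplus 1%g (X t k))).
  rewrite zmonD; last exact: A_neq0.
  by rewrite zmonN zmon_delta; ring.
apply: separatedM; first by apply: separated_zmon => l; apply: IH.
exists (fun=> 0), (oplus 1%g (X t k)); split; first exact: lcoef_addX.
by rewrite zmon0 mul1r psiD psi1 psi_X.
Qed.

(** * Laurent rings and the upper cluster algebra *)

Inductive laurent t : F -> Prop :=
| laurent0 : laurent t 0
| laurent_add (c : grpring K P) (v : 'I_n -> int) f : laurent t f ->
    laurent t (iota c * zmon (A t) v + f).

Lemma laurent_mon t c v : laurent t (iota c * zmon (A t) v).
Proof. by rewrite -[_ * _]addr0; apply: laurent_add; apply: laurent0. Qed.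

Lemma laurentD t f g : laurent t f -> laurent t g -> laurent t (f + g).
Proof.
move=> Lf Lg; elim: Lf => [|c v f' _ IH]; first by rewrite add0r.
by rewrite -addrA; apply: laurent_add.
Qed.

Lemma laurentM t f g : laurent t f -> laurent t g -> laurent t (f * g).
Proof.
move=> Lf Lg; elim: Lf => [|c v f' _ IH]; first by rewrite mul0r; apply: laurent0.
rewrite mulrDl; apply: laurentD => {IH} //.
elim: Lg => [|c' v' g' _ IH]; first by rewrite mulr0; apply: laurent0.
rewrite mulrDr mulrACA -rmorphM -zmonD; last exact: A_neq0.
exact: laurent_add.
Qed.

Lemma laurent_zmon t v : laurent t (zmon (A t) v).
Proof. by have := laurent_mon t 1 v; rewrite rmorph1 mul1r. Qed.
Lemma laurent_iota t c : laurent t (iota c).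
Proof. by have := laurent_mon t c (fun=> 0); rewrite zmon0 mulr1. Qed.
Lemma laurent_coef t x : laurent t (coef x).
Proof. by rewrite coefgE; apply: laurent_iota. Qed.
Lemma laurent1 t : laurent t 1.
Proof. by rewrite -(rmorph1 iota); apply: laurent_iota. Qed.
Lemma laurentN t f : laurent t f -> laurent t (- f).
Proof.
move=> Lf; rewrite -mulN1r; apply: laurentM => //.
by rewrite -(rmorphN1 iota); apply: laurent_iota.
Qed.
Lemma laurent_exp t f m : laurent t f -> laurent t (f ^+ m).
Proof.
move=> Lf; elim: m => [|m IH]; first by rewrite expr0; apply: laurent1.
by rewrite exprS; apply: laurentM.
Qed.
Lemma laurent_expz t f (m : int) : laurent t f -> laurent t f^-1 -> laurent t (f ^ m).
Proof.
move=> Lf LfV; case: m => m; first exact: laurent_exp.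
by rewrite NegzE -exprz_inv; apply: laurent_exp.
Qed.
Lemma laurent_A t i : laurent t (A t i).
Proof. by rewrite -zmon_delta; apply: laurent_zmon. Qed.
Lemma laurent_AV t i : laurent t (A t i)^-1.
Proof. by rewrite -[A t i]zmon_delta -zmonN; apply: laurent_zmon. Qed.
Lemma laurent_prod t (Q : pred 'I_n) (f : 'I_n -> F) :
  (forall i, Q i -> laurent t (f i)) -> laurent t (\prod_(i | Q i) f i).
Proof.
by move=> Lf; elim/big_ind: _ => //; [exact: laurent1 | exact: laurentM].
Qed.
Lemma laurent_zmon_gen t (z : 'I_n -> F) v :
  (forall i, v i = 0 \/ laurent t (z i) /\ (laurent t (z i)^-1 \/ 0 <= v i)) ->
  laurent t (zmon z v).
Proof.
move=> h; apply: laurent_prod => i _; case: (h i) => [->|[Lz]].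
  by rewrite expr0z; apply: laurent1.
by case=> [LV|]; [apply: laurent_expz | case: (v i) => // m _; apply: laurent_exp].
Qed.
Lemma laurent_yhat t k : laurent t (y t k).
Proof. by apply: laurentM; [apply: laurent_coef | apply: laurent_zmon]. Qed.
Lemma laurent_yhatV t k : laurent t (y t k)^-1.
Proof.
by rewrite invfM -coefgV -zmonN; apply: laurentM; [apply: laurent_coef | apply: laurent_zmon].
Qed.

Lemma mmap_iotaM t p q : mmap iota (A t) (p * q) = mmap iota (A t) p * mmap iota (A t) q.
Proof. exact: rmorphM. Qed.

Lemma laurentP t f : laurent t f ->
  exists p v, f = mmap iota (A t) p * zmon (A t) v.
Proof.
elim=> [|c v f' _ [p [w ->]]].
  by exists 0, (fun=> 0); rewrite rmorph0 mul0r.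
pose u i := Num.min (v i) (w i).
pose M (z : 'I_n -> int) : 'X_{1..n} := [multinom `|z i|%N | i < n].
have hM z : (forall i, 0 <= z i) -> mmap iota (A t) 'X_[M z] = zmon (A t) z.
  move=> z0; rewrite mmapX; apply: eq_bigr => i _; rewrite mnmE.
  by rewrite -[z i in RHS]gez0_abs.
have uv i : 0 <= v i - u i by rewrite subr_ge0 /u ge_min lexx.
have uw i : 0 <= w i - u i by rewrite subr_ge0 /u ge_min lexx orbT.
suff [q eq] : exists q, mmap iota (A t) q =
    iota c * zmon (A t) (fun i => v i - u i) + mmap iota (A t) p * zmon (A t) (fun i => w i - u i).
  by exists q, u; rewrite eq mulrDl -!mulrA -!zmonD; try exact: A_neq0;
    congr (_ * _ + _ * _); apply: zmon_eq => // i; rewrite subrK.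
rewrite -(hM _ uv) -(hM _ uw) -(mmapC (A t) iota).
move: (c%:MP) ('X_[_]) ('X_[_]) => q1 q2 q3; exists (q1 * q3 + p * q2).
by rewrite mmapD; congr (_ + _); apply: mmap_iotaM.
Qed.

(* The place of the prime [1 + y t i] of the Laurent ring of [t]: it sends
   [y t i] to -1, using the splitting of the group of Laurent monomials by the
   exponent of [X t i]. *)
Section PrimePlace.
Variables (t : tree n) (i : 'I_n).

Definition place_val (x : P) : F := coef x * (- y t i) ^ (- xdeg t x i).

Fact place_val1 : place_val 1%g = 1.
Proof. by rewrite /place_val coefg1 xdeg1 expr0z mulr1. Qed.
Lemma oppy_neq0 : - y t i != 0.
Proof. by rewrite oppr_eq0 yhat_neq0. Qed.
Fact place_valM a b : place_val (a * b)%g = place_val a * place_val b.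
Proof.
by rewrite /place_val coefgM xdegM opprD expfzDr ?oppy_neq0 // mulrACA.
Qed.
Definition place_char := Character place_val1 place_valM.

Definition place_coef : {rmorphism grpring K P -> F} :=
  gr_eval (iota \o @gr_const K P : {rmorphism K -> F}) place_char.
Definition res_e1 : {rmorphism {mpoly (grpring K P)[n]} -> F} := mmap iota (A t).
Definition res_e2 : {rmorphism {mpoly (grpring K P)[n]} -> F} := mmap place_coef (A t).
Definition res : F -> F -> Prop := place res_e1 res_e2.

Lemma res_e1_inj : injective res_e1.
Proof. exact: (proj1 (A_free t)). Qed.

Lemma res_coef x : res (coef x) (place_val x).
Proof.
have -> : place_val x = res_e2 (gr_elt K x)%:MP by rewrite [RHS]mmapC [RHS]gr_eval_elt.
have -> : coef x = res_e1 (gr_elt K x)%:MP by rewrite [RHS]mmapC coefgE.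
exact: place_e.
Qed.
Lemma res_iota c : exists w, res (iota c) w.
Proof.
exists (res_e2 c%:MP).
have -> : iota c = res_e1 c%:MP by rewrite [RHS]mmapC.
exact: place_e.
Qed.
Lemma res_A l : res (A t l) (A t l).
Proof.
have h1 : A t l = res_e1 'X_l by rewrite [RHS]mmapX mmap1U.
have h2 : A t l = res_e2 'X_l by rewrite [RHS]mmapX mmap1U.
by rewrite {1}h1 h2; apply: place_e.
Qed.
Lemma res_AV l m : res (A t l ^ m) (A t l ^ m).
Proof. by apply: place_expz; [exact: res_e1_inj | exact: A_neq0 | exact: res_A]. Qed.
Lemma res_zmon v : res (zmon (A t) v) (zmon (A t) v).
Proof. by apply: place_prod => l _; apply: res_AV. Qed.
Lemma res_yhat : res (y t i) (-1).
Proof.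
have -> : (-1 : F) = place_val (X t i) * zmon (A t) (fun l => B t l i).
  rewrite /place_val xdeg_X eqxx mulrAC -/(y t i) exprN1 invrN mulrN divff //.
  exact: yhat_neq0.
by apply: placeM; [exact: res_coef | exact: res_zmon].
Qed.
Lemma res_yhat1 : res (1 + y t i) 0.
Proof.
have -> : 0 = 1 + (-1) :> F by rewrite subrr.
by apply: placeD; [exact: place1 | exact: res_yhat].
Qed.
Lemma res_fun f w w' : res f w -> res f w' -> w = w'.
Proof. exact: place_fun res_e1_inj _ _ _. Qed.

Let divisible f := exists2 g, laurent t g & f = (1 + y t i) * g.

Lemma divisible_expz (m : int) : divisible (1 - (- y t i) ^ m).
Proof.
have Ly := laurent_yhat t i; have LyV := laurent_yhatV t i.
have hn (l : nat) : divisible (1 - (- y t i) ^+ l).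
  elim: l => [|l [g Lg e]]; first by exists 0; [exact: laurent0 | rewrite expr0 subrr mulr0].
  exists (1 - y t i * g).
    by apply: laurentD; [exact: laurent1 | apply/laurentN/laurentM].
  have -> : 1 - (- y t i) ^+ l.+1 = (1 + y t i) - y t i * (1 - (- y t i) ^+ l).
    by rewrite exprS; ring.
  by rewrite e; ring.
case: m => m; first exact: hn.
have [g Lg e] := hn m.+1.
exists (- (- y t i)^-1 ^+ m.+1 * g).
  apply: laurentM => //; apply/laurentN/laurent_exp.
  by rewrite invrN; apply: laurentN.
rewrite NegzE -exprnN mulrCA -e exprVn; field.
by rewrite expf_neq0 ?oppy_neq0.
Qed.

(** Specialization fixes the cluster and the constants and multiplies [coef x] by a power of
    [- y_i]. Such a power is congruent to 1 modulo [1 + y_i], hence so are a polynomial and its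
    value. *)
Lemma res_divisible p : divisible (res_e1 p - res_e2 p).
Proof.
have dD f g : divisible f -> divisible g -> divisible (f + g).
  move=> [f' Lf ->] [g' Lg ->]; exists (f' + g'); last by rewrite mulrDr.
  exact: laurentD.
have dM f g : laurent t f -> divisible g -> divisible (f * g).
  by move=> Lf [g' Lg ->]; exists (f * g'); [exact: laurentM | rewrite mulrCA].
have d0 : divisible 0 by exists 0; [exact: laurent0 | rewrite mulr0].
apply: (mpoly_rmorph_sub d0 dD dM (laurent1 t) (@laurentM t)) => [l|l|c].
- by rewrite [LHS]mmapX [RHS]mmapX.
- by rewrite [res_e1 _]mmapX mmap1U; apply: laurent_A.
rewrite [res_e1 _]mmapC [res_e2 _]mmapC.
apply: (gr_rmorph_sub d0 dD dM) => [a|a|x].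
- by rewrite [RHS]gr_eval_const.
- exact: laurent_iota.
rewrite [place_coef _]gr_eval_elt /place_char /= /place_val -coefgE.
rewrite -{1}[coef x]mulr1 -mulrBr.
by apply: dM; [exact: laurent_coef | exact: divisible_expz].
Qed.

Lemma res_laurent0 f : laurent t f -> res f 0 ->
  exists2 g, laurent t g & f = (1 + y t i) * g.
Proof.
move=> /laurentP [p [v fE]] rf.
have r1 : res f (res_e2 p * zmon (A t) v).
  by rewrite fE; apply: placeM; [exact: (place_e res_e1 res_e2) | exact: res_zmon].
have := res_fun rf r1 => /esym/eqP.
rewrite mulf_eq0 (negbTE (zmon_neq0 _ (A_neq0 t))) orbF => /eqP e0.
have [g Lg] := res_divisible p; rewrite e0 subr0 => e1.
exists (g * zmon (A t) v); first by apply: laurentM => //; apply: laurent_zmon.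
by rewrite fE -[mmap _ _ _]/(res_e1 p) e1 mulrA.
Qed.

(** The new variable is [1 + y_i] times a unit of the Laurent ring of [t], so the only new
    denominators are powers of [1 + y_i]. *)
Lemma laurent_nbr_exp f : laurent (nbr i t) f ->
  exists N, laurent t ((1 + y t i) ^+ N * f).
Proof.
have Ly1 : laurent t (1 + y t i).
  by apply: laurentD; [exact: laurent1 | exact: laurent_yhat].
elim=> [|c v f' _ [N LN]]; first by exists 0%N; rewrite mulr0; apply: laurent0.
exists (`|v i| + N)%N; rewrite mulrDr; apply: laurentD; last first.
  by rewrite exprD -mulrA; apply: laurentM => //; apply: laurent_exp.
rewrite exprD mulrCA -mulrA; apply: laurentM; first exact: laurent_iota.
rewrite mulrCA; apply: laurentM; first exact: laurent_exp.
rewrite (zmonD1 _ _ i) mulrA; apply: laurentM; last first.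
  apply: laurent_prod => l li; rewrite A_nbr_neq //.
  by apply: laurent_expz; [exact: laurent_A | exact: laurent_AV].
set a := A (nbr i t) i.
have aE : a = ((A t i)^-1 * ((coef (oplus 1%g (X t i)))^-1 * exch_neg (S t) i))
   * (1 + y t i) by rewrite /a A_nbr_k !mulrA.
set u := (A t i)^-1 * _ in aE.
have Lu : laurent t u.
  rewrite /u -coefgV exch_negE; apply: laurentM; first exact: laurent_AV.
  by apply: laurentM; [exact: laurent_coef | exact: laurent_zmon].
have LuV : laurent t u^-1.
  rewrite /u -coefgV exch_negE !invfM !invrK -coefgV -zmonN.
  apply: laurentM; first exact: laurent_A.
  by apply: laurentM; [exact: laurent_coef | exact: laurent_zmon].
rewrite aE expfzMl mulrCA; apply: laurentM; first exact: laurent_expz.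
rewrite exprnP -expfzDr ?yhat1_neq0 //.
by case: (v i) => m; rewrite ?NegzE ?abszN ?absz_nat ?subrr; apply: laurent_exp.
Qed.

(** Since [f] has a value, its product with a positive power of [1 + y_i] has value 0 and is
    divisible by [1 + y_i]; the factors are cancelled one at a time. *)
Lemma laurent_of_place f w : laurent (nbr i t) f -> res f w -> laurent t f.
Proof.
move=> /laurent_nbr_exp [N] + rf; elim: N => [|N IH]; first by rewrite mul1r.
move=> LN; apply: IH.
have r0 : res ((1 + y t i) ^+ N.+1 * f) 0.
  have -> : 0 = 0 ^+ N.+1 * w by rewrite exprS !mul0r.
  by apply: placeM => //; apply/place_exp/res_yhat1.
have [g Lg e] := res_laurent0 LN r0.
rewrite (_ : _ * f = g) //; apply: (mulfI (yhat1_neq0 t i)).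
by rewrite -e exprS mulrA.
Qed.

End PrimePlace.

(** * The cluster of [nbr i (nbr k t)] at a prime of [nbr i t] *)

Section PlaceOfMutation.
Variables (t : tree n) (i k : 'I_n).
Hypothesis ki : k != i.
Let s := nbr i t.
Variable D : F -> F.
Hypothesis D_der : derivation_over iota D.
Hypothesis D_A : forall l, D (A s l) = (l == i)%:R * A s l.

Let D_M x z : D x = 0 -> D z = 0 -> D (x * z) = 0.
Proof. by move=> Dx Dz; rewrite (derM D_der) Dx Dz mul0r mulr0 addr0. Qed.
Let D_V x : x != 0 -> D x = 0 -> D x^-1 = 0.
Proof. by move=> x0 Dx; rewrite (derV D_der) // Dx oppr0 mul0r. Qed.
Let D_expz x m : x != 0 -> D x = 0 -> D (x ^ m) = 0.
Proof.
move=> x0 Dx; have := dlg_expz D_der m x0; rewrite /dlg Dx mul0r mulr0 => /eqP.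
by rewrite mulf_eq0 invr_eq0 expfz_eq0 (negbTE x0) andbF orbF => /eqP.
Qed.
Let D_prod (f : 'I_n -> F) (Q : pred 'I_n) :
  (forall l, Q l -> D (f l) = 0) -> D (\prod_(l | Q l) f l) = 0.
Proof.
by move=> h; elim/big_ind: _ => //; exact: (der1 D_der).
Qed.

Lemma der_A_neq l : l != i -> D (A s l) = 0.
Proof. by move=> li; rewrite D_A (negbTE li) mul0r. Qed.
Lemma der_coef x : D (coef x) = 0.
Proof. by rewrite coefgE (der_iota D_der). Qed.
Lemma der_yhat : D (y s i) = 0.
Proof.
rewrite (yhatD1 _ _ _ i) B_diag expr0z mul1r; apply: D_M; first exact: der_coef.
by apply: D_prod => l li; apply: D_expz; [exact: A_neq0 | exact: der_A_neq].
Qed.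

(** The condition [D w = 0] says that the value does not involve [A s i]. A sum of [A s i] and an
    element killed by [D] cannot vanish, and this is the source of nonzero values in
    [res_affine]. *)
Definition res_unit (f : F) := exists w, [/\ w != 0, D w = 0 & res s i f w].

Let res_inj := @res_e1_inj s.

Lemma res_unitM f g : res_unit f -> res_unit g -> res_unit (f * g).
Proof.
move=> [w [w0 Dw rw]] [z [z0 Dz rz]]; exists (w * z); split.
- exact: mulf_neq0.
- exact: D_M.
- exact: placeM.
Qed.
Lemma res_unitV f : res_unit f -> res_unit f^-1.
Proof.
move=> [w [w0 Dw rw]]; exists w^-1; split; first by rewrite invr_eq0.
  exact: D_V.
by apply: placeV.
Qed.
Lemma res_unit1 : res_unit 1.
Proof.
by exists 1; split; [exact: oner_neq0 | exact: (der1 D_der) | exact: place1].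
Qed.
Lemma res_unit_expz f m : res_unit f -> res_unit (f ^ m).
Proof.
move=> [w [w0 Dw rw]]; exists (w ^ m); split; first by rewrite expfz_neq0.
  exact: D_expz.
by apply: place_expz.
Qed.
Lemma res_unit_zmon (z : 'I_n -> F) v : (forall l, v l = 0 \/ res_unit (z l)) ->
  res_unit (zmon z v).
Proof.
move=> h; rewrite /zmon; elim/big_ind: _ => [||l _].
- exact: res_unit1.
- exact: res_unitM.
- case: (h l) => [->|]; first by rewrite expr0z; apply: res_unit1.
  exact: res_unit_expz.
Qed.
Lemma res_unitD f g : res_unit f -> res s i g 0 -> res_unit (f + g).
Proof.
move=> [w [w0 Dw rw]] rg; exists w; split=> //.
by rewrite -[w]addr0; apply: placeD.
Qed.

Lemma res_unit_coef x : res_unit (coef x).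
Proof.
exists (place_val s i x); split; last exact: res_coef.
  by rewrite mulf_neq0 ?coef_neq0 ?expfz_neq0 ?oppy_neq0.
apply: D_M; first exact: der_coef.
apply: D_expz; first exact: oppy_neq0.
by rewrite -mulN1r -(rmorphN1 iota) (derM D_der) (der_iota D_der) der_yhat mul0r mulr0 addr0.
Qed.

Let At_neq l : l != i -> A t l = A s l.
Proof. by move=> li; rewrite /s A_nbr_neq. Qed.

Lemma res_unit_A l : l != i -> res_unit (A t l).
Proof.
move=> li; rewrite At_neq //; exists (A s l); split; first exact: A_neq0.
  exact: der_A_neq.
exact: res_A.
Qed.

Lemma res_yt : res s i (y t i) (-1).
Proof.
have -> : y t i = (y s i)^-1 by rewrite -!psi_X /s X_nbr_k psiV invrK.
rewrite (_ : -1 = (-1)^-1); last by rewrite invrN1.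
by apply: placeV => //; [rewrite oppr_eq0 oner_eq0 | exact: res_yhat].
Qed.

(** [A t i] is the variable exchanged for [A s i], so it carries the factor [1 + y s i]. *)
Lemma res_Ai : res s i (A t i) 0.
Proof.
have {1}-> : A t i = A (nbr i s) i by rewrite /s nbrK.
rewrite A_nbr_k exch_negE -coefgV.
rewrite (_ : 0 = (A s i)^-1 * (place_val s i (oplus 1 (X s i))^-1%g
  * zmon (A s) (fun l => Num.max (- B s l i) 0) * 0)); last by rewrite !mulr0.
apply: placeM; first by apply: placeV => //; [exact: A_neq0 | exact: res_A].
apply: placeM; last exact: res_yhat1.
by apply: placeM; [exact: res_coef | exact: res_zmon].
Qed.

Lemma res_zmon0 v : 0 < v i -> (forall l, l != i -> v l = 0 \/ res_unit (A t l)) ->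
  res s i (zmon (A t) v) 0.
Proof.
move=> vi h; rewrite (zmonD1 _ _ i).
have [w [_ _ rw]] : res_unit (\prod_(l | l != i) A t l ^ v l).
  elim/big_ind: _ => [||l li]; [exact: res_unit1 | exact: res_unitM |].
  case: (h l li) => [->|]; first by rewrite expr0z; apply: res_unit1.
  exact: res_unit_expz.
rewrite -(mul0r w); apply: placeM => //.
case: (v i) vi => // m m0; rewrite -exprnP.
rewrite (_ : 0 = 0 ^+ m); last by rewrite expr0n; case: m m0.
exact/place_exp/res_Ai.
Qed.

Lemma res_unit_zmonA v : v i = 0 -> res_unit (zmon (A t) v).
Proof.
move=> vi; apply: res_unit_zmon => l; have [->|li] := eqVneq l i; first by left.
by right; apply: res_unit_A.
Qed.

(** If b_ik is nonzero, exactly one of the two exchange monomials contains [A t i] and dies at the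
    place, while the other survives. If b_ik = 0, the specialization fixes [1 + y t k], which is
    free of [A s i]. *)
Lemma res_unit_Ak : res_unit (A (nbr k t) k).
Proof.
have [b0|b0] := eqVneq (B t i k) 0.
  rewrite A_nbr_k exch_negE -coefgV.
  apply: res_unitM; first exact/res_unitV/res_unit_A.
  apply: res_unitM.
    by apply: res_unitM; [exact: res_unit_coef | apply: res_unit_zmonA; rewrite b0].
  have Xk : xdeg s (X t k) i = 0.
    have -> : X t k = X s k.
      by rewrite /s X_nbr_neq // b0 oppr0 maxxx /= !expg0 !mulg1.
    by rewrite xdeg_X eq_sym (negbTE ki).
  exists (1 + y t k); split; first exact: yhat1_neq0.
    rewrite (derD D_der) (der1 D_der) add0r (yhatD1 _ _ _ i) b0 expr0z mul1r.
    apply: D_M; first exact: der_coef.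
    apply: D_prod => l li; apply: D_expz; first exact: A_neq0.
    by rewrite At_neq //; apply: der_A_neq.
  apply: placeD; first exact: place1.
  apply: placeM.
    have := res_coef s i (X t k); rewrite /place_val Xk oppr0 expr0z mulr1.
    exact.
  rewrite (zmonD1 _ _ i) b0 expr0z mul1r; apply: place_prod => l li.
  by apply: place_expz => //; [exact: A_neq0 | rewrite At_neq //; exact: res_A].
rewrite S_mut.
rewrite mutA_k.
rewrite exch_binomial_terms.
rewrite exch_posE.
rewrite exch_negE.
apply: res_unitM; first exact/res_unitV/res_unit_A.
have rc x : exists w, res s i (coef x) w by exists (place_val s i x); apply: res_coef.
have r0 x f : res s i f 0 -> res s i (coef x * f) 0.
  by move=> rf; have [w rw] := rc x; rewrite -(mulr0 w); apply: placeM.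
have hu l : l != i -> forall z : int, z = 0 \/ res_unit (A t l).
  by move=> li z; right; apply: res_unit_A.
have [bp|bn] := ltP 0 (B t i k).
  rewrite addrC; apply: res_unitD.
    apply: res_unitM; first exact: res_unit_coef.
    by apply: res_unit_zmonA; rewrite max_r // oppr_le0 ltW.
  by apply/r0/res_zmon0 => [|l li]; [rewrite lt_max bp | apply: hu].
apply: res_unitD.
  apply: res_unitM; first exact: res_unit_coef.
  by apply: res_unit_zmonA; rewrite max_r.
by apply/r0/res_zmon0 => [|l li]; [rewrite lt_max oppr_gt0 lt_neqAle b0 bn | apply: hu].
Qed.

(* With [a] = [A t i] of value 0 at the place, the correction term only
   survives for [b = 1], and then it is free of [A s i]. *)
Lemma res_affine (e m : F) (b c : nat) : (0 < b)%N ->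
  (exists2 w, D w = 0 & res s i e w) -> (exists2 w, D w = 0 & res s i m w) ->
  exists2 w, w != 0 & res s i (A s i + e * A t i ^+ b.-1 * m
     * (\sum_(q < c) (1 + A t i ^+ b * m) ^+ q)) w.
Proof.
move=> b0 [we De re] [wm Dm rm].
pose z : F := (0 : F) ^+ b.-1.
have Dz : D z = 0.
  by rewrite /z expr0n; case: (_ == _); [exact: (der1 D_der) | exact: (der0 D_der)].
have Dc : D c%:R = 0.
  by rewrite -(rmorph_nat iota); exact: (der_iota D_der).
exists (A s i + we * z * wm * c%:R); last first.
  apply: placeD; first exact: res_A.
  apply: placeM; first by apply: placeM => //; apply: placeM => //; apply/place_exp/res_Ai.
  have -> : c%:R = \sum_(q < c) (1 + (0 : F) ^+ b * wm) ^+ q.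
    rewrite -{1}[c]card_ord -sumr_const; apply: eq_bigr => q _.
    by rewrite expr0n eqn0Ngt b0 mul0r addr0 expr1n.
  apply: place_sum => q _; apply: place_exp; apply: placeD; first exact: place1.
  by apply: placeM => //; apply/place_exp/res_Ai.
apply/eqP => h.
have Dn : D (we * z * wm * c%:R) = 0 by do !apply: D_M.
have := congr1 D h; rewrite (derD D_der) Dn D_A eqxx mul1r addr0 (der0 D_der).
by apply/eqP; apply: A_neq0.
Qed.

(** Up to units at the place the variable is [A s i (1 + y'_i) / (1 + y_i)], where both binomials
    have value 0. If b_ki is nonzero, then [y'_i] is [y_i] times a power of some [u] with [u - 1]
    divisible by [A t i]. Up to a power of [u], the numerator is [1 + y_i] plus a multiple of
    [u^c - 1]; there one factor [A t i] cancels [1 + y_i], as both occur in the exchange relation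
    for [A s i], and [res_affine] applies. *)
Lemma res_nonzero_Ai : exists2 w, w != 0 & res s i (A (nbr i (nbr k t)) i) w.
Proof.
set t' := nbr k t.
pose kap := (coef (oplus 1%g (X t i)))^-1 * exch_neg (S t) i.
pose kap' := (coef (oplus 1%g (X t' i)))^-1 * exch_neg (S t') i.
have ik : i != k by rewrite eq_sym.
have uk : res_unit kap.
  rewrite /kap -coefgV exch_negE; apply: res_unitM; first exact: res_unit_coef.
  by apply: res_unit_zmonA; rewrite B_diag.
have uk' : res_unit kap'.
  rewrite /kap' -coefgV exch_negE; apply: res_unitM; first exact: res_unit_coef.
  apply: res_unit_zmon => l; have [->|li] := eqVneq l i; first by left; rewrite B_diag.
  right; have [->|lk] := eqVneq l k; first exact: res_unit_Ak.
  by rewrite /t' A_nbr_neq //; apply: res_unit_A.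
have a0 := A_neq0 t i; have k0 : kap != 0.
  by rewrite mulf_neq0 ?invr_eq0 ?coef_neq0 ?exch_neg_neq0 // => l; apply: A_neq0.
have y10 := yhat1_neq0 t i.
have As : A s i = (A t i)^-1 * (kap * (1 + y t i)) by rewrite /s A_nbr_k.
have -> : A (nbr i t') i = kap' / kap * (A s i * (1 + y t' i) / (1 + y t i)).
  rewrite A_nbr_k -/kap' As {1}/t' A_nbr_neq //; field.
  by rewrite a0 k0 y10.
suff [w w0 rw] : exists2 w, w != 0 & res s i (A s i * (1 + y t' i) / (1 + y t i)) w.
  have [w' [w'0 _ rw']] := res_unitM uk' (res_unitV uk).
  by exists (w' * w); [exact: mulf_neq0 | exact: placeM].
have yE : y t' i = y t i * y t k ^ Num.max (B t k i) 0 * (1 + y t k) ^ (- B t k i).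
  rewrite /t' S_mut yhat_mut_neq //; try exact: yhat1_neq0.
    by move=> l; apply: A_neq0.
  by move=> l; apply: B_diag.
pose b := `|B t i k|%N; pose c := `|B t k i|%N.
have m_unit (v : 'I_n -> int) x : v i = 0 -> exists2 w, D w = 0 & res s i (coef x * zmon (A t) v) w.
  move=> vi; have [w [_ Dw rw]] : res_unit (coef x * zmon (A t) v).
    by apply: res_unitM; [exact: res_unit_coef | exact: res_unit_zmonA].
  by exists w.
have kapD : exists2 w, D w = 0 & res s i kap w by have [w [_ Dw rw]] := uk; exists w.
have y0 := yhat_neq0 t k; have y1 := yhat1_neq0 t k.
have geo (u : F) : u ^+ c - 1 = (u - 1) * \sum_(q < c) u ^+ q by rewrite subrX1.
have [B0|B0|B0] := ltgtP (B t k i) 0.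
- (* u = 1 + y_k *)
  have Bik : 0 < B t i k by rewrite (symmetrizes_gt0 _ _ (S_sym t)).
  have b0 : (0 < b)%N by rewrite /b absz_gt0 gt_eqF.
  pose m := coef (X t k) * zmon (A t) (fun l => if l == i then 0 else B t l k).
  have ym : y t k = A t i ^+ b * m.
    rewrite (yhatD1 _ _ _ i) /m (zmonD1 _ _ i) eqxx expr0z mul1r mulrCA.
    congr (_ * (_ * _)); first by rewrite exprnP /b gez0_abs ?ltW.
    by apply: eq_bigr => l /negbTE ->.
  have eD : exists2 w, D w = 0 & res s i (y t i * kap) w.
    have [w Dw rw] := kapD; exists (-1 * w); last by apply: placeM => //; apply: res_yt.
    by rewrite -(rmorphN1 iota) (derM D_der) (der_iota D_der) Dw mul0r mulr0 addr0.
  have mD : exists2 w, D w = 0 & res s i m w by apply: m_unit; rewrite eqxx.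
  have [w w0 rw] := res_affine c b0 eD mD.
  exists w => //.
  rewrite (_ : A s i * (1 + y t' i) / (1 + y t i) = A s i + y t i * kap * A t i ^+ b.-1 * m *
     (\sum_(q < c) (1 + A t i ^+ b * m) ^+ q)) //.
  rewrite -ym.
  have yE' : y t' i = y t i * (1 + y t k) ^+ c.
    rewrite yE (_ : Num.max _ _ = 0); last by lia.
    by rewrite expr0z mulr1 exprnP /c -abszN gez0_abs //; lia.
  have -> : 1 + y t' i = (1 + y t i) + y t i * ((1 + y t k) ^+ c - 1) by rewrite yE'; ring.
  rewrite geo [1 + y t k - 1]addrAC subrr add0r.
  set Sg := \sum_(_ < _) _; rewrite ym -(prednK b0) exprS As /=.
  by field; rewrite a0 y10.
- (* u = 1 + 1/y_k *)
  have Bik : B t i k < 0 by rewrite -(symmetrizes_gt0 _ _ (S_sym t)).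
  have b0 : (0 < b)%N by rewrite /b absz_gt0 lt_eqF.
  pose m := coef (X t k)^-1%g * zmon (A t) (fun l => if l == i then 0 else - B t l k).
  have ym : (y t k)^-1 = A t i ^+ b * m.
    rewrite /yhat invfM -coefgV -zmonN mulrCA; congr (_ * _).
    rewrite !(zmonD1 _ _ i) eqxx expr0z mul1r.
    congr (_ * _); first by rewrite exprnP /b -abszN gez0_abs //; lia.
    by apply: eq_bigr => l /negbTE ->.
  have mD : exists2 w, D w = 0 & res s i m w by apply: m_unit; rewrite eqxx.
  have [w w0 rw] := res_affine c b0 kapD mD.
  pose u := 1 + (y t k)^-1.
  have u0 : u != 0.
    have -> : u = (1 + y t k) / y t k by rewrite /u; field.
    by rewrite mulf_neq0 ?invr_eq0.
  have ru : res s i u 1.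
    have [wm _ rm] := mD; rewrite /u ym.
    suff : res s i (1 + A t i ^+ b * m) (1 + 0 ^+ b * wm).
      by rewrite expr0n eqn0Ngt b0 mul0r addr0.
    apply: placeD; first exact: place1.
    by apply: placeM => //; apply/place_exp/res_Ai.
  exists (w * 1 ^- c); first by rewrite expr1n invr1 mulr1.
  rewrite (_ : A s i * (1 + y t' i) / (1 + y t i) = (A s i + kap * A t i ^+ b.-1 * m *
     (\sum_(q < c) (1 + A t i ^+ b * m) ^+ q)) * u ^- c); last first.
    rewrite -ym -/u.
    have yE' : y t' i = y t i * u ^- c.
      rewrite yE (_ : Num.max _ _ = c%:Z); last by rewrite max_l ?ltW // /c gez0_abs ?ltW.
      have -> : u = (1 + y t k) / y t k by rewrite /u; field.
      rewrite -mulrA; congr (_ * _); rewrite expr_div_n invf_div.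
      by rewrite -exprnP exprnN /c gez0_abs ?ltW.
    have uc0 : u ^+ c != 0 by rewrite expf_neq0.
    have -> : 1 + y t' i = ((1 + y t i) + (u ^+ c - 1)) / u ^+ c by rewrite yE'; field.
    rewrite geo {1}/u [1 + (y t k)^-1 - 1]addrAC subrr add0r.
    set Sg := \sum_(_ < _) _; rewrite {1}ym -{1}(prednK b0) exprS As /=.
    by field; rewrite a0 y10 uc0.
  apply: placeM => //; apply: placeV => //; last exact: place_exp.
  by rewrite expr1n oner_neq0.
- exists (A s i); first exact: A_neq0.
  have -> : y t' i = y t i by rewrite yE B0 oppr0 maxxx !expr0z !mulr1.
  by rewrite mulfK //; apply: res_A.
Qed.

Lemma laurent_place f : laurent (nbr i (nbr k t)) f -> exists w, res s i f w.
Proof.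
elim=> [|c v f' _ [w rw]]; first by exists 0; apply: place0.
suff [w' rw'] : exists w, res s i (iota c * zmon (A (nbr i (nbr k t))) v) w.
  by exists (w' + w); apply: placeD.
have [wc rc] := res_iota s i c.
suff [w' w0 rw'] : exists2 w, w != 0 & res s i (zmon (A (nbr i (nbr k t))) v) w.
  by exists (wc * w'); apply: placeM.
rewrite /zmon; elim/big_ind: _ => [|f1 f2 [w1 w10 r1] [w2 w20 r2]|l _].
- by exists 1; [exact: oner_neq0 | exact: place1].
- by exists (w1 * w2); [exact: mulf_neq0 | exact: placeM].
suff [w' w0 rw'] : exists2 w, w != 0 & res s i (A (nbr i (nbr k t)) l) w.
  by exists (w' ^ v l); [rewrite expfz_neq0 | apply: place_expz].
have [->|li] := eqVneq l i; first exact: res_nonzero_Ai.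
rewrite A_nbr_neq //; have [->|lk] := eqVneq l k.
  by have [w' [w0 _ rw']] := res_unit_Ak; exists w'.
by rewrite A_nbr_neq //; have [w' [w0 _ rw']] := res_unit_A li; exists w'.
Qed.

End PlaceOfMutation.

(** Being Laurent at [t] leaves only powers of the prime [1 + y] of [nbr i t] as denominators, and
    the second Laurent condition provides a value at that prime. *)
Lemma laurent_mutation t i k f : k != i ->
  laurent t f -> laurent (nbr i (nbr k t)) f -> laurent (nbr i t) f.
Proof.
move=> ki Lf Lf'.
have [D [D_der D_A]] := exists_derivation
  (fun l => (l == i)%:R * A (nbr i t) l) (A_free (nbr i t)).
have [w rw] := laurent_place ki D_der D_A Lf'.
by apply: (laurent_of_place _ rw); rewrite nbrK.
Qed.

Definition upper_bound t f := laurent t f /\ forall i, laurent (nbr i t) f.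
Definition upper f := forall t, laurent t f.

Lemma upper_bound_upper t f : upper_bound t f -> upper f.
Proof.
move=> Uf; suff h : forall t', upper_bound t' f by move=> t'; case: (h t').
apply: (tree_ind Uf) => {t Uf} t k [Lf Lnf]; split=> // i.
have [->|ik] := eqVneq i k; first by rewrite nbrK.
by apply: (@laurent_mutation (nbr k t) i k); rewrite ?nbrK // eq_sym.
Qed.

Lemma upper_A t i : upper (A t i).
Proof.
apply: (@upper_bound_upper t); split; first exact: laurent_A.
move=> k; have [->|ik] := eqVneq i k; last by rewrite -(A_nbr_neq t ik); apply: laurent_A.
have {1}-> : A t k = A (nbr k (nbr k t)) k by rewrite nbrK.
rewrite A_nbr_k exch_negE -coefgV; apply: laurentM; first exact: laurent_AV.
apply: laurentM; first by apply: laurentM; [exact: laurent_coef | exact: laurent_zmon].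
by apply: laurentD; [exact: laurent1 | exact: laurent_yhat].
Qed.

Lemma laurent_res t i f : laurent t f -> exists w, res t i f w.
Proof.
elim=> [|c v f' _ [w rw]]; first by exists 0; apply: place0.
have [wc rc] := res_iota t i c.
exists (wc * zmon (A t) v + w); apply: placeD => //; apply: placeM => //.
exact: res_zmon.
Qed.

Lemma upper_zmon_ge0 t v : upper (zmon (A t) v) -> forall i, 0 <= v i.
Proof.
move=> Uv i; set s := nbr i t.
have [w rw] := laurent_res i (Uv s).
rewrite leNgt; apply/negP => vi.
have r0 : res s i (A t i ^ (- v i)) 0.
  case: (v i) vi => // m _; rewrite NegzE opprK -exprnP.
  rewrite (_ : 0 = 0 ^+ m.+1); last by rewrite expr0n.
  by apply: place_exp; apply: res_Ai.
have r1 := placeM rw r0; rewrite mulr0 in r1.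
have e : zmon (A t) v * A t i ^ (- v i) = \prod_(l | l != i) A s l ^ v l.
  rewrite (zmonD1 _ _ i) mulrAC -expfzDr ?A_neq0 // subrr expr0z mul1r.
  by apply: eq_bigr => l li; rewrite A_nbr_neq.
have r2 : res s i (\prod_(l | l != i) A s l ^ v l) (\prod_(l | l != i) A s l ^ v l).
  by apply: place_prod => l _; apply: res_AV.
rewrite e in r1; have := res_fun r1 r2 => /esym/eqP.
apply/negP/prodf_neq0 => l _.
by rewrite expfz_neq0 ?A_neq0.
Qed.

Fixpoint sfx_nat (m : nat) : sfx n :=
  if m is m'.+1 then SfAdd SfOne (sfx_nat m') else SfOne.

Lemma sfx_nat_frac m : sfx_frac (sfx_nat m) = (m.+1%:R, 1).
Proof. by elim: m => //= m ->; rewrite !mulr1 -[m.+2%:R]natr1 addrC. Qed.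

Lemma sfx_natE m (Z : 'I_n -> P) : sfx_semifield Z (sfx_nat m) = sfx_val (sfx_nat m).
Proof. by elim: m => //= m ->. Qed.

Lemma lcoef_nat m : lcoef (sfx_val (sfx_nat m)) = m.+1%:R.
Proof.
rewrite lcoefE sfx_nat_frac /= mleadc1 divr1 -mpolyC_nat mleadcC.
by rewrite rmorph_nat.
Qed.

Definition sfx_mon (m : 'X_{1..n}) : sfx n :=
  foldr (fun i e => SfMul (iter (m i) (SfMul (SfVar i)) SfOne) e) SfOne (enum 'I_n).

Lemma sfx_mon_frac m : sfx_frac (sfx_mon m) = ('X_[m], 1).
Proof.
have h (r : seq 'I_n) : sfx_frac (foldr (fun i e =>
    SfMul (iter (m i) (SfMul (SfVar i)) SfOne) e) SfOne r) = (\prod_(i <- r) 'X_i ^+ m i, 1).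
  elim: r => [|i r IH] /=; first by rewrite big_nil.
  rewrite IH big_cons (_ : sfx_frac (iter _ _ _) = ('X_i ^+ m i, 1)) ?mulr1 //.
  by elim: (m i) => //= k ->; rewrite mulr1 exprS.
by rewrite /sfx_mon h mpolyXE_id big_enum.
Qed.

Definition Xmon t m : P := sfx_semifield (X t) (sfx_mon m).

Lemma lcoef_Xmon t m : lcoef (Xmon t m) = 1.
Proof.
rewrite /Xmon /sfx_mon; elim: (enum _) => [|i r IH] /=; first exact: lcoef1.
rewrite lcoefM IH mulr1; elim: (m i) => [|k IHk] /=; first exact: lcoef1.
by rewrite lcoefM IHk lcoef_X mulr1.
Qed.

Lemma psi_Xmon t m : psi (Xmon t m) = zmon (y t) (fun i => m i).
Proof.
rewrite /Xmon /sfx_mon /zmon -big_enum /=.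
elim: (enum _) => [|i r IH] /=; first by rewrite big_nil psi1.
rewrite psiM IH big_cons; congr (_ * _).
elim: (m i) => [|k IHk] /=; first by rewrite psi1.
by rewrite psiM IHk psi_X -!exprnP exprS.
Qed.

Lemma psi_coef_Xmon t m : exists v, psi (Xmon t m) / coef (Xmon t m) = zmon (A t) v.
Proof.
pose Q x := exists v, psi x / coef x = zmon (A t) v.
have Q1 : Q 1%g by exists (fun=> 0); rewrite psi1 coefg1 divr1 zmon0.
have QM a b : Q a -> Q b -> Q (a * b)%g.
  move=> [v ev] [w ew]; exists (fun i => v i + w i).
  by rewrite zmonD ?psiM ?coefgM ?mulf_div ?invfM -?ev -?ew; [rewrite mulrACA | exact: A_neq0].
have QX i : Q (X t i).
  exists (fun l => B t l i); rewrite psi_X /yhat mulrC mulrA mulVf ?mul1r //.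
  exact: coef_neq0.
rewrite -/(Q _) /Xmon /sfx_mon; elim: (enum _) => //= i r IH; apply: (QM) => //.
by elim: (m i) => //= k IHk; apply: (QM).
Qed.

Lemma F_char0 m : m.+1%:R != 0 :> F.
Proof. exact: (F_nat_neq0 K_char0 (A_free tstar)). Qed.

Lemma K_int_eq0 (m : int) : (m%:~R == 0 :> K) = (m == 0).
Proof.
case: m => m; first by rewrite -pmulrn (proj1 (pcharf0P K) K_char0).
by rewrite NegzE mulrNz !oppr_eq0 -pmulrn (proj1 (pcharf0P K) K_char0).
Qed.

(** * Specializing a cluster to 1 *)

Section Phi.
Variable t0 : tree n.

Definition ratK : fieldType := {fraction {mpoly K[n]}}.
Definition Yvar (l : 'I_n) : ratK := tofrac ('X_l : {mpoly K[n]}).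

Lemma Yvar_neq0 l : Yvar l != 0.
Proof.
rewrite tofrac_eq0; apply/eqP => /mpolyP /(_ U_(l)%MM) /eqP.
by rewrite mcoeffX eqxx mcoeff0 oner_eq0.
Qed.

Fact phi_char1 : zmon Yvar (xdeg t0 1%g) = 1.
Proof. by rewrite -(zmon0 Yvar); apply: zmon_eq => // l; apply: xdeg1. Qed.
Fact phi_charM a b : zmon Yvar (xdeg t0 (a * b)%g)
  = zmon Yvar (xdeg t0 a) * zmon Yvar (xdeg t0 b).
Proof.
by rewrite -(zmonD _ _ Yvar_neq0); apply: zmon_eq => // l; apply: xdegM.
Qed.
Definition phi_char : character P ratK :=
  @Character P ratK (fun x => zmon Yvar (xdeg t0 x)) phi_char1 phi_charM.

Definition phi_const : {rmorphism K -> ratK} :=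
  (@tofrac {mpoly K[n]} \o @mpolyC n K : {rmorphism K -> ratK}).
Definition phi_e2 : {rmorphism {mpoly (grpring K P)[n]} -> ratK} :=
  mmap (gr_eval phi_const phi_char) (fun=> 1).

(* The specialization [A t0 _ = 1], which reads off [y t0]-exponents. *)
Definition phi : F -> ratK -> Prop := place (res_e1 t0) phi_e2.

Let e1_inj := @res_e1_inj t0.

Lemma phi_fun f r r' : phi f r -> phi f r' -> r = r'.
Proof. exact: place_fun e1_inj _ _ _. Qed.

Lemma phi_coef x : phi (coef x) (zmon Yvar (xdeg t0 x)).
Proof.
have h2 : zmon Yvar (xdeg t0 x) = phi_e2 (gr_elt K x)%:MP.
  by rewrite [RHS]mmapC [RHS]gr_eval_elt.
have h1 : coef x = res_e1 t0 (gr_elt K x)%:MP by rewrite [RHS]mmapC coefgE.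
by rewrite h1 h2; apply: place_e.
Qed.

Lemma phi_A l : phi (A t0 l) 1.
Proof.
have h1 : A t0 l = res_e1 t0 'X_l by rewrite [RHS]mmapX mmap1U.
have h2 : 1 = phi_e2 'X_l by rewrite [RHS]mmapX mmap1U.
by rewrite h1 h2; apply: place_e.
Qed.

Lemma phi_zmon v : phi (zmon (A t0) v) 1.
Proof.
rewrite -(_ : zmon (fun=> 1) v = 1 :> ratK); last first.
  by rewrite /zmon big1 // => l _; rewrite exp1rz.
apply: place_prod => l _; apply: place_expz => //; first exact: oner_neq0.
exact: phi_A.
Qed.

Lemma phi_yhat l : phi (y t0 l) (Yvar l).
Proof.
rewrite -[Yvar l]mulr1; apply: placeM; last exact: phi_zmon.
rewrite -(zmon_delta Yvar l) -(zmon_eq (v := xdeg t0 (X t0 l)) (A := Yvar)) //.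
  exact: phi_coef.
by move=> i; apply: xdeg_X.
Qed.

Notation toK p := (map_mpoly (intmul 1 : int -> K) p).

Lemma toK_inj : injective (fun p : {mpoly int[n]} => toK p).
Proof. exact/map_mpoly_int_inj/K_int_eq0. Qed.

Lemma phi_eval p : phi (int_eval (y t0) p) (tofrac (toK p)).
Proof.
rewrite -int_eval_tofrac; apply: place_sum => m _; apply: placeM.
  have hn k : phi k%:R k%:R by apply: place_nat.
  by case: (p@_m) => k; rewrite ?NegzE ?mulrNz; [|apply: placeN]; apply: hn.
by apply: place_prod => l _; apply: place_exp; apply: phi_yhat.
Qed.

Definition laurent_poly (r : ratK) : Prop := exists (q : {mpoly K[n]}) a,
  r * tofrac ('X_[a] : {mpoly K[n]}) = tofrac q.

Lemma mpolyX_neq0 (a : 'X_{1..n}) : 'X_[a] != 0 :> {mpoly K[n]}.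
Proof.
apply/eqP => /mpolyP /(_ a) /eqP.
by rewrite mcoeffX eqxx mcoeff0 oner_eq0.
Qed.

Lemma laurent_polyD r r' : laurent_poly r -> laurent_poly r' -> laurent_poly (r + r').
Proof.
move=> [q [a e]] [q' [a' e']]; exists (q * 'X_[a'] + q' * 'X_[a]), (a + a')%MM.
by rewrite mpolyXD tofracD !tofracM -e -e'; ring.
Qed.
Lemma laurent_polyM r r' : laurent_poly r -> laurent_poly r' -> laurent_poly (r * r').
Proof.
move=> [q [a e]] [q' [a' e']]; exists (q * q'), (a + a')%MM.
by rewrite mpolyXD !tofracM -e -e'; ring.
Qed.

Lemma laurent_poly_zmon v : laurent_poly (zmon Yvar v).
Proof.
rewrite /zmon; elim/big_ind: _ => [||l _].
- by exists 1, 0%MM; rewrite mpolyX0 tofrac1 mulr1.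
- exact: laurent_polyM.
case: (v l) => m.
  by exists ('X_l ^+ m), 0%MM; rewrite mpolyX0 tofrac1 mulr1 tofracXn.
exists 1, (U_(l) *+ m.+1)%MM; rewrite -mpolyXn tofracXn tofrac1 NegzE -exprnN.
by rewrite mulVf // expf_neq0 // Yvar_neq0.
Qed.

Lemma phi_coef_laurent c : laurent_poly (gr_eval phi_const phi_char c).
Proof.
elim/gr_ind: c => [|c x g IH].
  by exists 0, 0%MM; rewrite rmorph0 mul0r tofrac0.
rewrite rmorphD; apply: laurent_polyD => //.
rewrite -[GRing.RMorphism.sort _ _]/(gr_eval phi_const phi_char (gr_const P c * gr_elt K x)).
rewrite -gr_mono_factor gr_eval_mono.
apply: laurent_polyM; last exact: laurent_poly_zmon.
by exists c%:MP, 0%MM; rewrite mpolyX0 tofrac1 mulr1.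
Qed.

Lemma phi_laurent f : laurent t0 f -> exists2 r, laurent_poly r & phi f r.
Proof.
elim=> [|c v f' _ [r Lr pr]].
  by exists 0; [exists 0, 0%MM; rewrite mul0r tofrac0 | exact: place0].
exists (gr_eval phi_const phi_char c * 1 + r).
  by rewrite mulr1; apply: laurent_polyD => //; apply: phi_coef_laurent.
apply: placeD => //; apply: placeM; last exact: phi_zmon.
have h1 : iota c = res_e1 t0 c%:MP by rewrite [RHS]mmapC.
have h2 : gr_eval phi_const phi_char c = phi_e2 c%:MP by rewrite [RHS]mmapC.
by rewrite h1 h2; apply: place_e.
Qed.

Lemma psi_frac (e : sfx n) : [/\ psi (sfx_semifield (X t0) e)
    = int_eval (y t0) (sfx_num e) / int_eval (y t0) (sfx_den e),
  int_eval (y t0) (sfx_num e) != 0 & int_eval (y t0) (sfx_den e) != 0].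
Proof.
have [pn pd e'] := sfx_cone pos_cone (pos_yhat t0) e.
by rewrite psi_sfx e'; split=> //; apply: pos_neq0.
Qed.

Lemma toK_neq0 (e : sfx n) : (toK (sfx_num e) != 0) /\ (toK (sfx_den e) != 0).
Proof.
have [a b] := sfx_frac_neq0 e.
have h (p : {mpoly int[n]}) : p != 0 -> toK p != 0.
  by apply: contraNneq => p0; apply/eqP; apply: (@toK_inj p 0); rewrite /= p0 rmorph0.
by split; apply: h.
Qed.

Lemma phi_psi (e : sfx n) : phi (psi (sfx_semifield (X t0) e))
  (tofrac (toK (sfx_num e)) / tofrac (toK (sfx_den e))).
Proof.
have [-> _ _] := psi_frac e; have [_ d0] := toK_neq0 e.
apply: placeM; first exact: phi_eval.
by apply: placeV => //; [rewrite tofrac_eq0 | exact: phi_eval].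
Qed.

End Phi.

Lemma upper_zmon t v : (forall i, 0 <= v i) -> upper (zmon (A t) v).
Proof.
move=> v0 t'; apply: laurent_zmon_gen => i; right; split; first exact: upper_A.
by right.
Qed.

Lemma A_neq1 t i : A t i != 1.
Proof.
apply/eqP => h; have : 'X_i = 1 :> {mpoly (grpring K P)[n]}.
  by apply: (@res_e1_inj t); rewrite [LHS]mmapX mmap1U h rmorph1.
move=> /mpolyP /(_ 0%MM); rewrite mcoeffX mcoeff1 eqxx => /eqP.
case: (U_(i)%MM =P 0%MM) => [e|_]; last by rewrite eq_sym oner_eq0.
by have := congr1 (fun m : 'X_{1..n} => m i) e; rewrite mnm1E eqxx mnm0E.
Qed.

Definition at1 (R : comNzRingType) : 'I_n -> R := fun=> 1.

Lemma int_eval_at1 (R : comNzRingType) (p : {mpoly int[n]}) :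
  int_eval (at1 R) p = (int_eval (at1 int) p)%:~R.
Proof.
rewrite -[RHS]/((intmul 1 \o int_eval (at1 int)) p).
apply: mpoly_rmorph_eq => [c|i] /=; last by rewrite !int_evalX.
by rewrite /int_eval !mmapC /= intz.
Qed.

Lemma meval_at1 (p : {mpoly int[n]}) :
  meval (at1 K) (map_mpoly (intmul 1) p) = (int_eval (at1 int) p)%:~R.
Proof.
rewrite -int_eval_at1 -[LHS]/((meval (at1 K) \o map_mpoly (intmul 1)) p).
apply: mpoly_rmorph_eq => [c|i] /=; last by rewrite map_mpolyX mevalXU int_evalX.
by rewrite map_mpolyC ?rmorph0 // mevalC /int_eval mmapC.
Qed.

Lemma sfx_at1 (e : sfx n) : exists a b, int_eval (at1 int) (sfx_num e) = a.+1%:Z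
  /\ int_eval (at1 int) (sfx_den e) = b.+1%:Z.
Proof.
have cQ : positive_cone (fun x : rat => 0 < x).
  split=> [|x z|x z|x|x]; [exact: ltr01 | exact: addr_gt0 | exact: mulr_gt0 | |].
    by rewrite invr_gt0.
  by move/gt_eqF/negbT.
have [] := @sfx_cone n _ _ cQ (at1 rat) (fun=> ltr01) e.
rewrite !(int_eval_at1 rat) !ltr0z => h1 h2 _.
have pos_int (m : int) : 0 < m -> exists a, m = a.+1%:Z.
  by case: m => [[|a]|] // _; exists a.
by have [a ha] := pos_int _ h1; have [b hb] := pos_int _ h2; exists a, b.
Qed.

(** Evaluation at (1, ..., 1) shows that the scalar [c] of [K] is a ratio of positive integers.
    Cleared of it, the identity is one of integer polynomials and hence holds in [P], where leading
    coefficients force the two integers to agree. *)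
Lemma int_mpoly_cancel t0 (e : sfx n) c a b :
  map_mpoly (intmul 1 : int -> K) (sfx_num e) * 'X_[a]
    = c *: 'X_[b] * map_mpoly (intmul 1) (sfx_den e) ->
  lcoef (sfx_semifield (X t0) e) = 1 ->
  (sfx_semifield (X t0) e * Xmon t0 a)%g = Xmon t0 b.
Proof.
move=> h lh; have [N [D [eN eD]]] := sfx_at1 e.
have hc : N.+1%:R = c * D.+1%:R :> K.
  have := congr1 (meval (at1 K)) h.
  rewrite !mevalM mevalZ !meval_at1 eN eD -!pmulrn.
  have m1 m : meval (at1 K) 'X_[m] = 1 by rewrite mevalX big1 // => i _; rewrite expr1n.
  by rewrite !m1 !mulr1.
have hZ : D.+1%:R * sfx_num e * 'X_[a] = N.+1%:R * 'X_[b] * sfx_den e.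
  pose toK (p : {mpoly int[n]}) : {mpoly K[n]} := map_mpoly (intmul 1) p.
  have tM p q : toK (p * q) = toK p * toK q by exact: rmorphM.
  have tN k : toK k%:R = k%:R by exact: rmorph_nat.
  have tX m : toK 'X_[m] = 'X_[m] by exact: map_mpolyX.
  apply: toK_inj; rewrite /= -!/(toK _) !tM !tN !tX -mulrA h -/(toK _).
  rewrite -[N.+1%:R]mpolyC_nat hc.
  by rewrite -mul_mpolyC mpolyCM mpolyC_nat; ring.
have := @sfx_eq (X t0) (SfMul (SfMul (sfx_nat D) e) (sfx_mon a)) (SfMul (sfx_nat N) (sfx_mon b)).
rewrite /= !sfx_natE -/(Xmon t0 a) -/(Xmon t0 b) !sfx_nat_frac !sfx_mon_frac.
move: hZ; case: (sfx_frac e) => p q /= hZ; rewrite !mul1r !mulr1 hZ => /(_ erefl) eP.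
have := congr1 (@lcoef n) eP.
rewrite !lcoefM !lcoef_nat lh !lcoef_Xmon !mulr1 => /eqP; rewrite eqr_nat => /eqP[DN].
by move: eP; rewrite DN -mulgA => /mulgI.
Qed.

(** * Consequences of an equality of coefficients *)

(** Up to Laurent units [f] is [psi h], so [psi h] and its inverse are Laurent. Their images under
    [phi] are mutually inverse Laurent polynomials, hence monomials up to a scalar; this makes [h] a
    Laurent monomial in the [X_{i;t0}], on which [psi] and [coef] differ by a cluster monomial. *)
Lemma unit_zmon t0 f : laurent t0 f -> laurent t0 f^-1 -> separated t0 f ->
  exists v, f = zmon (A t0) v.
Proof.
move=> Lf LfV [g [h [lh fE]]]; have [e he] := sfx_gen t0 h.
have A0 := A_neq0 t0; have cn := coef_neq0 iota h; have zn := zmon_neq0 g A0.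
have f0 : f != 0 by rewrite fE !mulf_neq0 ?invr_eq0 ?psi_neq0.
have pE : psi h = f * coef h * zmon (A t0) (fun i => - g i).
  by rewrite fE zmonN; field; rewrite cn zn.
have Lp : laurent t0 (psi h).
  rewrite pE; apply: laurentM; last exact: laurent_zmon.
  by apply: laurentM => //; apply: laurent_coef.
have LpV : laurent t0 (psi h)^-1.
  rewrite pE !invfM zmonN invrK -coefgV; apply: laurentM; last exact: laurent_zmon.
  by apply: laurentM => //; apply: laurent_coef.
have [r [q [a ra]] pr] := phi_laurent Lp; have [r' [q' [a' ra']] pr'] := phi_laurent LpV.
have pe := phi_psi t0 e; rewrite he in pe.
have [n0 d0] := toK_neq0 e.
move: pe; set NUM := map_mpoly _ (sfx_num e) in n0 *; set DEN := map_mpoly _ _ in d0 *.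
move=> pe; have rE := phi_fun pr pe.
have tn0 : tofrac NUM / tofrac DEN != 0 :> ratK.
  by rewrite mulf_neq0 ?invr_eq0 ?tofrac_eq0.
have r'E := phi_fun pr' (placeV (@res_e1_inj t0) tn0 pe).
have qq : q * q' = 'X_[a + a'].
  apply/eqP; rewrite -tofrac_eq tofracM -ra -ra' mulrACA rE r'E mulfV // mul1r.
  by rewrite mpolyXD tofracM.
have [c [b qE]] := mpoly_mul_monomial qq.
have hE : NUM * 'X_[a] = c *: 'X_[b] * DEN.
  apply/eqP; rewrite -tofrac_eq !tofracM -qE -ra rE mulrAC divfK ?tofrac_eq0 //.
rewrite -he in lh; have := int_mpoly_cancel hE lh; rewrite he => hX.
have [va ea] := psi_coef_Xmon t0 a; have [vb eb] := psi_coef_Xmon t0 b.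
exists (fun i => g i + (vb i - va i)).
rewrite !zmonD // zmonN -ea -eb fE -mulrA; congr (_ * _).
rewrite -hX psiM coefgM; field.
by rewrite !psi_neq0 !coef_neq0.
Qed.

(** As a unit, [A t i] is a monomial in [A t0] with nonnegative exponents. A variable [A t0 l]
    occurring in it is invertible at [t], hence a monomial in [A t] that divides [A t i]: it is 1 or
    [A t i], and 1 is no cluster variable. *)
Lemma A_unit t t0 i : laurent t0 (A t i)^-1 -> exists l, A t i = A t0 l.
Proof.
move=> LV.
have [v vE] := unit_zmon (upper_A t i t0) LV (separated_A t0 t i).
have v0 : forall l, 0 <= v l by apply: (@upper_zmon_ge0 t0); rewrite -vE; apply: upper_A.
have [l vl] : exists l, v l != 0.
  apply: boolp.contrapT => /boolp.forallNP h; move: (A_neq1 t i).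
  rewrite vE -(zmon0 (A t0)) (zmon_eq (A' := A t0) (v' := fun=> 0)) ?eqxx // => l.
  by apply/eqP; rewrite -[_ == _]negbK; apply/negP/h.
pose u := zmon (A t0) (fun m => v m - (m == l)%:R).
have uE : A t i = u * A t0 l.
  rewrite vE /u zmonD; last exact: A_neq0.
  by rewrite zmonN zmon_delta divfK // A_neq0.
have Uu : upper u.
  apply: upper_zmon => m; have [->|ml] := eqVneq m l; last by rewrite subr0.
  by rewrite subr_ge0 -gtz0_ge1 lt_neqAle eq_sym vl v0.
have LlV : laurent t (A t0 l)^-1.
  have -> : (A t0 l)^-1 = u * (A t i)^-1.
    rewrite uE invfM mulrA mulfV ?mul1r //.
    by apply: contraNneq (A_neq0 t i) => u0; rewrite uE u0 mul0r.
  by apply: laurentM => //; apply: laurent_AV.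
have [w wE] := unit_zmon (upper_A t0 l t) LlV (separated_A t t0 l).
have w0 : forall m, 0 <= w m by apply: (@upper_zmon_ge0 t); rewrite -wE; apply: upper_A.
have d0 : forall m, 0 <= (m == i)%:R - w m.
  apply: (@upper_zmon_ge0 t); rewrite zmonD; last exact: A_neq0.
  by rewrite zmonN zmon_delta -wE uE mulfK ?A_neq0.
have w1 m : m != i -> w m = 0.
  move=> mi; apply/eqP; rewrite eq_le w0 andbT.
  by have := d0 m; rewrite (negbTE mi) sub0r oppr_ge0.
have wi : w i = 0 \/ w i = 1.
  by have := d0 i; have := w0 i; rewrite eqxx; lia.
have wE' : A t0 l = A t i ^ w i.
  rewrite wE (zmonD1 _ _ i) big1 ?mulr1 // => m mi.
  by rewrite w1 // expr0z.
exists l; rewrite wE'; case: wi => [w00|->]; last by rewrite expr1z.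
by have := A_neq1 t0 l; rewrite wE' w00 expr0z eqxx.
Qed.

(** The properties of [lam] that do not depend on the seed [tstar] or on the derivations chosen
    there. *)
Record bracket (L : P -> F -> F) : Prop := Bracket {
  bracket_der : forall x, derivation_over iota (L x);
  bracketM : forall a b f, L (a * b)%g f = L a f + L b f;
  bracketV : forall a f, L a^-1%g f = - L a f;
  bracketD : forall a b f, psi (oplus a b) * L (oplus a b) f
    = psi a * L a f + psi b * L b f;
  bracket_X : forall t i l, L (X t i) (A t l) = (i == l)%:R * (sk i)%:~R * A t l }.

Lemma exists_bracket : exists L, bracket L.
Proof.
have [d hd] := boolp.choice (fun l =>
  exists_derivation (fun i => (i == l)%:R * A tstar i) (A_free tstar)).
have d1 l := proj1 (hd l); have d2 l := proj2 (hd l).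
exists (lam d); split.
- exact: lam_der.
- exact: lamM.
- exact: lamV.
- exact: lamD.
- exact: lam_X.
Qed.

Section UseBracket.
Variables (L : P -> F -> F) (LB : bracket L).

(** The chain rule: if among the coefficients of [t0] only [X_j] acts on [a], an expression acts by
    its logarithmic derivative in [X_j]. *)
Lemma bracket_dlog t0 j a (e : sfx n) :
  (forall l, L (X t0 l) a = (l == j)%:R * (sk j)%:~R * a) ->
  L (sfx_semifield (X t0) e) a = (sk j)%:~R * sf_dlog (y t0) j (sfx_val e) * a.
Proof.
move=> hX; have cz := pos_cone; have py := pos_yhat t0.
have L1 : L 1%g a = 0.
  by apply: (addrI (L 1%g a)); rewrite -(bracketM LB) mul1g addr0.
elim: e => [|i|e1 IH1 e2 IH2|e1 IH1 e2 IH2|e1 IH1 e2 IH2].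
- by rewrite /= L1 (sf_dlog1 cz py) mulr0 mul0r.
- rewrite /= hX -[sfx_val (SfVar i)]/(Qsf_var i) (sf_dlog_var cz py) eq_sym.
  by rewrite [(sk j)%:~R * _]mulrC.
- rewrite /= -[sfx_val (SfAdd _ _)]/(oplus (sfx_val e1) (sfx_val e2)).
  set x1 := sfx_semifield _ e1 in IH1 *; set x2 := sfx_semifield _ e2 in IH2 *.
  apply: (mulfI (psi_neq0 (oplus x1 x2))); rewrite (bracketD LB) IH1 IH2.
  have h (e : sfx n) : sf_hom (y t0) (sfx_val e) = psi (sfx_semifield (X t0) e).
    by rewrite (sf_homE cz py) psi_sfx.
  have := sf_dlogD cz py j (sfx_val e1) (sfx_val e2).
  rewrite (sf_homD cz py) !h -/x1 -/x2 psiD => hd.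
  transitivity ((sk j)%:~R * (psi x1 * sf_dlog (y t0) j (sfx_val e1)
    + psi x2 * sf_dlog (y t0) j (sfx_val e2)) * a); first by ring.
  by rewrite -hd; ring.
- rewrite /= -[sfx_val (SfMul _ _)]/((sfx_val e1) * (sfx_val e2))%g.
  by rewrite (bracketM LB) IH1 IH2 (sf_dlogM cz py); ring.
- rewrite /= -[sfx_val (SfDiv _ _)]/((sfx_val e1) / (sfx_val e2))%g.
  by rewrite (bracketM LB) (bracketV LB) IH1 IH2 (sf_dlogM cz py) (sf_dlogV cz py); ring.
Qed.

End UseBracket.

Lemma F_int_eq0 (m : int) : (m%:~R == 0 :> F) = (m == 0).
Proof.
case: m => [[|m]|m]; first by rewrite eqxx.
  by rewrite -pmulrn (negbTE (F_char0 m)).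
by rewrite NegzE mulrNz !oppr_eq0 -pmulrn (negbTE (F_char0 m)).
Qed.

(** [D] is diagonal on Laurent monomials, with eigenvalue determined by the exponent of [A t0 j]. An
    eigenvector is thus homogeneous in this variable, and dividing by its power leaves only
    variables shared with [nbr j t0]. *)
Lemma laurent_eigen t0 j (D : F -> F) (s0 s1 : int) f :
  derivation_over iota D -> s0 != 0 ->
  (forall l, D (A t0 l) = (l == j)%:R * s0%:~R * A t0 l) ->
  laurent t0 f -> f != 0 -> D f = s1%:~R * f ->
  exists2 d, s1 = s0 * d & laurent (nbr j t0) (f * A t0 j ^ (- d)).
Proof.
move=> DD s00 DA /laurentP [p [v fE]] f0 Df.
have A0 := A_neq0 t0.
have dz w : D (zmon (A t0) w) = (s0 * w j)%:~R * zmon (A t0) w.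
  rewrite (dlgE _ (zmon_neq0 w A0)) (dlg_prod DD) => [|l]; last by rewrite expfz_neq0.
  congr (_ * _); rewrite (bigD1 j) //= big1 => [|l lj].
    rewrite addr0 (dlg_expz DD) // /dlg DA eqxx mul1r mulfK // -intrM mulrC //.
  by rewrite (dlg_expz DD) // /dlg DA (negbTE lj) !mul0r mulr0.
have fS : f = \sum_(m <- msupp p) iota p@_m * zmon (A t0) (fun i => (m i)%:Z + v i).
  rewrite fE mulr_suml; apply: eq_bigr => m' _.
  by rewrite zmonD // mulrA.
have pm m : m \in msupp p -> s1 = s0 * ((m j)%:Z + v j).
  move=> mp; pose c (m' : 'X_{1..n}) : int := s0 * ((m' j)%:Z + v j) - s1.
  have key : \sum_(m <- msupp p) (c m)%:~R *
     (iota p@_m * zmon (A t0) (fun i => (m i)%:Z + v i)) = 0.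
    transitivity (D f - s1%:~R * f); last by rewrite Df subrr.
    rewrite fS mulr_sumr (big_morph D (derD DD) (der0 DD)) -sumrB.
    apply: eq_bigr => m' _; rewrite (derM DD) (der_iota DD) mul0r add0r dz.
    by rewrite intrB; ring.
  (* The eigenvalue equation as a polynomial identity: freeness of the cluster kills every
     coefficient, and characteristic 0 then kills the factor [c m]. *)
  pose q : {mpoly (grpring K P)[n]} := \sum_(m <- msupp p) ((c m)%:~R * p@_m) *: 'X_[m].
  have q0 : q = 0.
    apply: (@res_e1_inj t0); rewrite rmorph0; apply: (mulIf (zmon_neq0 v A0)).
    rewrite mul0r -key /q rmorph_sum mulr_suml; apply: eq_bigr => m' _.
    have -> : res_e1 t0 (((c m')%:~R * p@_m') *: 'X_[m'])
      = iota ((c m')%:~R * p@_m') * zmon (A t0) (fun i => m' i).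
      by rewrite -mul_mpolyC rmorphM; congr (_ * _); [exact: mmapC | exact: mmapX].
    by rewrite rmorphM rmorph_int zmonD // !mulrA.
  have := mcoeff_lincomb (fun m => (c m)%:~R * p@_m) (msupp_uniq p) mp.
  rewrite -/q q0 mcoeff0 => /esym.
  move=> /(congr1 iota); rewrite rmorphM rmorph_int rmorph0 => /eqP.
  rewrite mulf_eq0 F_int_eq0 subr_eq0 => /orP[/eqP //|/eqP pm0].
  have : (p@_m)%:MP = 0 :> {mpoly (grpring K P)[n]}.
    by apply: (@res_e1_inj t0); rewrite [LHS]mmapC rmorph0.
  by move=> /eqP; rewrite mpolyC_eq0 mcoeff_eq0 mp.
have [m0 m0p] : exists m, m \in msupp p.
  exists (mlead p); apply: mlead_supp; apply: contraNneq f0 => p0.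
  by rewrite fE p0 rmorph0 mul0r.
pose d := (m0 j)%:Z + v j.
exists d; first exact: pm.
rewrite fS mulr_suml big_seq; elim/big_ind: _ => [|g h|m mp].
- exact: laurent0.
- exact: laurentD.
have md : (m j)%:Z + v j = d by apply: (mulfI s00); rewrite -(pm _ mp) -(pm _ m0p).
rewrite -mulrA; apply: laurentM; first exact: laurent_iota.
rewrite (zmonD1 _ _ j) md mulrAC -expfzDr // subrr expr0z mul1r.
apply: laurent_prod => l lj; rewrite -(A_nbr_neq t0 lj).
by apply: laurent_expz; [exact: laurent_A | exact: laurent_AV].
Qed.

Lemma sk_gt0 i : 0 < sk i.
Proof. by have [s0 _] := S_sym tstar. Qed.

Lemma quotient_upper t t0 k j : X t k = X t0 j -> upper (A t k / A t0 j).
Proof.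
have [L LB] := exists_bracket; move=> Xkj.
have sn i : sk i != 0 by rewrite gt_eqF ?sk_gt0.
have half t1 t2 i1 i2 : X t1 i1 = X t2 i2 -> exists2 d, sk i1 = sk i2 * d &
    laurent (nbr i2 t2) (A t1 i1 * A t2 i2 ^ (- d)).
  move=> Xi; apply: (laurent_eigen (bracket_der LB (X t2 i2))) => //.
  - by move=> l; rewrite (bracket_X LB) eq_sym.
  - exact: upper_A.
  - exact: A_neq0.
  - by rewrite -Xi (bracket_X LB) eqxx mul1r.
have [d sd Ld] := half _ _ _ _ Xkj.
have [d' sd' _] := half _ _ _ _ (esym Xkj).
have d1 : d = 1.
  (* Exchanging the two seeds gives the inverse ratio of the symmetrizers as an integer too. *)
  have dd : d * d' = 1 by apply: (mulfI (sn j)); rewrite mulrA -sd -sd' mulr1.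
  have dp : 0 < d by rewrite -(pmulr_rgt0 _ (sk_gt0 j)) -sd sk_gt0.
  have dp' : 0 < d' by rewrite -(pmulr_rgt0 _ (sk_gt0 k)) -sd' sk_gt0.
  clear - dd dp dp'; nia.
apply: (@upper_bound_upper t0); split.
  by apply: laurentM; [exact: upper_A | exact: laurent_AV].
(* Only the neighbour across [j] loses the variable [A t0 j]; there homogeneity of degree 1 is
   needed. *)
move=> i; have [->|ij] := eqVneq i j.
  by move: Ld; rewrite d1 exprN1.
apply: laurentM; first exact: upper_A.
by rewrite -(@A_nbr_neq t0 i j) 1?eq_sym //; apply: laurent_AV.
Qed.

Lemma X_A t t0 k j : X t k = X t0 j -> A t k = A t0 j.
Proof.
move=> Xkj; have U1 := quotient_upper Xkj; have U2 := quotient_upper (esym Xkj).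
have inv : (A t k / A t0 j)^-1 = A t0 j / A t k by rewrite invf_div.
have sep : separated t0 (A t k / A t0 j).
  apply: separatedM; first exact: separated_A.
  rewrite -[A t0 j]zmon_delta -zmonN.
  by apply: separated_zmon => l; apply: separated_A.
have LV : laurent t0 (A t k / A t0 j)^-1 by rewrite inv.
have [v vE] := unit_zmon (U1 t0) LV sep.
have v0 : forall i, 0 <= v i by apply: (@upper_zmon_ge0 t0); rewrite -vE.
have v1 : forall i, 0 <= - v i.
  by apply: (@upper_zmon_ge0 t0); rewrite zmonN -vE inv.
have : A t k / A t0 j = 1.
  rewrite vE -(zmon0 (A t0)); apply: zmon_eq => // i; apply/eqP.
  by rewrite eq_le v0 andbT -oppr_ge0.
by move=> /(congr1 (fun f => f * A t0 j)); rewrite divfK ?A_neq0 // mul1r.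
Qed.

Lemma nbr_eq t t0 k j : X t k = X t0 j ->
  A t k = A t0 j /\ A (nbr k t) k = A (nbr j t0) j.
Proof.
by move=> e; split; apply: X_A; rewrite // !X_nbr_k e.
Qed.

Lemma exch_eq t t0 k j : X t k = X t0 j ->
  exch_pos (S t) k = exch_pos (S t0) j /\ exch_neg (S t) k = exch_neg (S t0) j.
Proof.
move=> e; have [eA] := nbr_eq e.
have ye : y t k = y t0 j by rewrite -!psi_X e.
rewrite !A_nbr_k eA e ye => /(mulfI (invr_neq0 (A_neq0 t0 j))).
move=> /(mulIf (yhat1_neq0 t0 j)) /(mulfI (invr_neq0 (coef_neq0 iota _))) en.
split=> //; apply: (mulfI (coef_neq0 iota (X t0 j))).
have A0 := A_neq0 t0; have A1 := A_neq0 t.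
by rewrite exch_pos_neg // -e exch_pos_neg // en ye.
Qed.

Lemma exch_binomial_A t k : exch_binomial iota (S t) k = A t k * A (nbr k t) k.
Proof. by rewrite S_mut mutA_k mulVKf // A_neq0. Qed.

(** This is |b_ik|, in the shape in which the product of the two exchange monomials yields it. *)
Let absB t k i : int := Num.max (B t i k) 0 + Num.max (- B t i k) 0.

Lemma exch_prod t k : exch_pos (S t) k * exch_neg (S t) k = zmon (A t) (absB t k).
Proof. by rewrite exch_posE exch_negE -zmonD //; apply: A_neq0. Qed.

Lemma absB_ge0 t k i : 0 <= absB t k i.
Proof. by rewrite /absB addr_ge0 // le_max lexx orbT. Qed.

Lemma absB_ge1 t k i : (1 <= absB t k i) = (B t i k != 0).
Proof.
rewrite /absB; case: (ltgtP (B t i k) 0) => h.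
- have -> : Num.max (- B t i k) 0 = - B t i k by rewrite max_l // oppr_ge0 ltW.
  by rewrite add0r -gtz0_ge1 oppr_gt0 h.
- have -> : Num.max (- B t i k) 0 = 0 by rewrite max_r // oppr_le0 ltW.
  by rewrite addr0 -gtz0_ge1 h.
- by rewrite h oppr0 maxxx.
Qed.

(** [A t i] divides the product of the two exchange monomials, which is also a monomial in [A t0].
    So it is invertible at [t0] and lies in that cluster by [A_unit]; since the quotient is in the
    upper cluster algebra, its exponent there is at least 1. *)
Lemma support_eq t t0 k j i : exch_pos (S t) k = exch_pos (S t0) j ->
  exch_neg (S t) k = exch_neg (S t0) j -> B t i k != 0 ->
  exists2 l, B t0 l j != 0 & A t i = A t0 l.
Proof.
move=> ep en b0.
have M : zmon (A t) (absB t k) = zmon (A t0) (absB t0 j) by rewrite -!exch_prod ep en.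
pose u m := absB t k m - (m == i)%:R.
have uE : zmon (A t) u = zmon (A t) (absB t k) / A t i.
  by rewrite zmonD ?zmonN ?zmon_delta //; apply: A_neq0.
have Uu : upper (zmon (A t) u).
  apply: upper_zmon => m; rewrite /u; have [->|_] := eqVneq m i.
    by rewrite subr_ge0 absB_ge1.
  by rewrite subr0 absB_ge0.
have LV : laurent t0 (A t i)^-1.
  have -> : (A t i)^-1 = zmon (A t) u * (zmon (A t) (absB t k))^-1.
    by rewrite uE mulrAC divff ?mul1r // zmon_neq0 //; apply: A_neq0.
  by apply: laurentM; rewrite // M -zmonN; apply: laurent_zmon.
have [l lE] := A_unit LV; exists l => //.
rewrite -absB_ge1 -subr_ge0.
have : forall m, 0 <= absB t0 j m - (m == l)%:R.
  apply: (@upper_zmon_ge0 t0); rewrite zmonD; last exact: A_neq0.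
  by rewrite zmonN zmon_delta -M -lE -uE.
by move=> /(_ l); rewrite eqxx.
Qed.

(** * Consequences of an equality of binomials or of clusters *)

Lemma psi_inj : injective psi.
Proof.
move=> a b; have [e <-] := sfx_gen tstar a; have [e' <-] := sfx_gen tstar b => h.
apply: sfx_eq; apply: toK_inj; rewrite /=.
have pe := phi_psi tstar e; have pe' := phi_psi tstar e'; rewrite h in pe.
have [n0 d0] := toK_neq0 e; have [n0' d0'] := toK_neq0 e'.
have /eqP := phi_fun pe pe'; rewrite eqr_div ?tofrac_eq0 // -!tofracM tofrac_eq => /eqP hh.
by rewrite [LHS]rmorphM [RHS]rmorphM.
Qed.

Let mpos (v : 'I_n -> int) : 'X_{1..n} := [multinom `|Num.max (v i) 0|%N | i < n].
Let mneg (v : 'I_n -> int) : 'X_{1..n} := [multinom `|Num.max (- v i) 0|%N | i < n].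

Lemma zmonY v : zmon Yvar v = tofrac 'X_[mpos v] / tofrac 'X_[mneg v].
Proof.
have h (w : 'I_n -> int) (m : 'X_{1..n}) : (forall i, (m i)%:Z = w i) ->
    tofrac ('X_[m] : {mpoly K[n]}) = zmon Yvar w.
  move=> mw; rewrite mpolyXE_id rmorph_prod; apply: eq_bigr => i _.
  by rewrite rmorphXn /= exprnP mw.
rewrite (h (fun i => Num.max (v i) 0)) => [|i]; last first.
  by rewrite mnmE gez0_abs // le_max lexx orbT.
rewrite (h (fun i => Num.max (- v i) 0)) => [|i]; last first.
  by rewrite mnmE gez0_abs // le_max lexx orbT.
rewrite -zmonN -zmonD; last exact: Yvar_neq0.
by apply: zmon_eq => // i; case: (ltgtP (v i) 0) => h'; lia.
Qed.

Lemma zmonY_eq1 v : zmon Yvar v = 1 -> forall i, v i = 0.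
Proof.
rewrite zmonY => /(congr1 (fun z => z * tofrac 'X_[mneg v])).
rewrite divfK ?tofrac_eq0 ?mpolyX_neq0 // mul1r => /eqP.
rewrite tofrac_eq => /eqP /mpolyP /(_ (mpos v)).
rewrite !mcoeffX eqxx; case: (mneg v =P mpos v) => [e _ i|_ /eqP]; last by rewrite oner_eq0.
have := congr1 (fun m : 'X_{1..n} => m i) e; rewrite !mnmE.
by case: (ltgtP (v i) 0) => h; lia.
Qed.

(** [A t0 j] cannot occur: it equals [A t k], which is not among the neighbours because b_kk = 0. *)
Lemma zmon_cluster t t0 k j u : A t k = A t0 j ->
  (forall i, B t i k != 0 -> exists l, A t i = A t0 l) ->
  (forall i, u i != 0 -> B t i k != 0) ->
  exists2 w, w j = 0 & zmon (A t) u = zmon (A t0) w.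
Proof.
move=> eA hB hu; rewrite {1}/zmon; elim/big_ind: _ => [|f g [w wj ->] [w' wj' ->]|i _].
- by exists (fun=> 0); rewrite ?zmon0.
- exists (fun i => w i + w' i); first by rewrite wj wj'.
  by rewrite zmonD //; apply: A_neq0.
have [->|ui] := eqVneq (u i) 0; first by exists (fun=> 0); rewrite ?zmon0 ?expr0z.
have [l el] := hB i (hu i ui).
exists (fun m => (m == l)%:R * u i); last by rewrite el zmonM zmon_delta.
case: (j =P l) => [jl|_]; last by rewrite mul0r.
have ik : i = k by apply: (free_inj (A_free t)); rewrite el -jl -eA.
by have := hu i ui; rewrite ik B_diag eqxx.
Qed.

(** Under [phi] the left side of the hypothesis becomes [x] itself and the right side the monomial
    of its degree. *)
Lemma X_monomial t0 (x : P) v : lcoef x = 1 -> psi x = coef x * zmon (A t0) v ->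
  psi x = zmon (y t0) (xdeg t0 x).
Proof.
move=> lx px; have [e he] := sfx_gen t0 x.
have pe := phi_psi t0 e; rewrite he px in pe.
have := phi_fun pe (placeM (phi_coef t0 x) (phi_zmon t0 v)); rewrite mulr1 zmonY.
have [n0 d0] := toK_neq0 e.
set a := mneg _; set b := mpos _ => /eqP.
rewrite eqr_div ?tofrac_eq0 ?mpolyX_neq0 // -!tofracM tofrac_eq => /eqP h.
rewrite -he in lx; rewrite -[_ * map_mpoly _ _]scale1r scalerAl in h.
have := int_mpoly_cancel h lx; rewrite he => hX.
have A0 i : y t0 i != 0 by apply: yhat_neq0.
apply: (mulIf (psi_neq0 (Xmon t0 a))); rewrite -psiM hX !psi_Xmon -zmonD //.
apply: zmon_eq => // i; rewrite !mnmE !gez0_abs ?le_max ?lexx ?orbT //.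
by case: (ltgtP (xdeg t0 x i) 0) => hi; lia.
Qed.

Lemma X_eq_of_cluster t t0 k j : A t k = A t0 j ->
  (forall i, B t i k != 0 -> exists l, A t i = A t0 l) -> X t k = X t0 j.
Proof.
move=> eA hB; pose x := X t k.
have y0 i : y t0 i != 0 by apply: yhat_neq0.
have [v vj vE] := zmon_cluster (u := fun i => B t i k) eA hB (fun i h => h).
have [w wj wE] : exists2 w, w j = 0 & exch_neg (S t) k = zmon (A t0) w.
  rewrite exch_negE; apply: (zmon_cluster eA hB) => i.
  by apply: contraNneq => ->; rewrite oppr0 maxxx.
have px : psi x = coef x * zmon (A t0) v by rewrite psi_X /yhat vE.
have yE := X_monomial (lcoef_X t k) px.
pose s := nbr j t0; pose th := xdeg t0 x; pose r := xdeg s x j.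
have [D [D_der D_A]] := exists_derivation (fun l => (l == j)%:R * A s l) (A_free s).
(* The binomial is [A t0 j], which vanishes at the place of [s], times an element of the upper
   cluster algebra. *)
have rP : res s j (exch_binomial iota (S t) k) 0.
  rewrite exch_binomial_A eA; have [z rz] := laurent_res j (upper_A (nbr k t) k s).
  by rewrite -(mul0r z); apply: placeM => //; apply: res_Ai.
have ry : res s j (1 + y t k) 0.
  have A0 := A_neq0 t; move: rP; rewrite exch_binomialE // wE -coefgV => rP.
  have [z [z0 _ rz]] : res_unit t0 j D (coef (oplus 1 (X t k))^-1%g * zmon (A t0) w).
    apply: res_unitM => //; first exact: res_unit_coef.
    exact: res_unit_zmonA.
  have := placeM (placeV (@res_e1_inj s) z0 rz) rP; rewrite mulr0 mulKf //.
  by rewrite mulf_neq0 ?coef_neq0 ?zmon_neq0 //; apply: A_neq0.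
have ry1 : res s j (y t k) (-1).
  have := placeD ry (placeN (place1 (res_e1 s) (res_e2 s j))).
  by rewrite add0r [1 + _]addrC addrK.
(* The cluster monomial in [y t k] avoids [A t0 j], so only the coefficient changes under
   specialization. *)
have ry2 : res s j (y t k) (y t k * (- y s j) ^ (- r)).
  rewrite -psi_X -/x px mulrAC; apply: placeM; first exact: res_coef.
  rewrite (zmonD1 _ _ j) vj expr0z mul1r; apply: place_prod => l lj.
  by rewrite -(A_nbr_neq t0 lj); apply: res_AV.
have e1 := res_fun ry1 ry2.
have ys : y s j = (y t0 j)^-1 by rewrite -!psi_X X_nbr_k psiV.
(* The two values make [y t k] a power of [y t0 j] up to sign; squaring removes the sign and leaves
   a Laurent monomial in [y t0] equal to 1. *)
have e2 : zmon (y t0) (fun i => (th i + (i == j)%:R * r) * 2) = 1.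
  rewrite (zmonM _ (fun i => th i + (i == j)%:R * r)) zmonD //.
  rewrite (zmonM _ (fun i => (i == j)%:R)) zmon_delta -yE psi_X -/th.
  move: e1; rewrite ys -invrN exprz_inv opprK => e1.
  have -> : y t0 j ^ r = (-1) ^ r * (- y t0 j) ^ r by rewrite -expfzMl mulN1r opprK.
  rewrite mulrCA -e1 mulrN1 -exprnP sqrrN.
  by rewrite exprnP exprz_exp mulrC -exprz_exp -exprnP sqrrN expr1n exp1rz.
have e3 i : i != j -> th i = 0.
  move=> ij; have pz : phi t0 (zmon (y t0) (fun i => (th i + (i == j)%:R * r) * 2))
     (zmon Yvar (fun i => (th i + (i == j)%:R * r) * 2)).
    apply: place_prod => l _; apply: place_expz => //; first exact: res_e1_inj.
      exact: Yvar_neq0.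
    exact: phi_yhat.
  rewrite e2 in pz; have := phi_fun pz (place1 _ _) => /zmonY_eq1 /(_ i) /eqP.
  by rewrite (negbTE ij) mul0r addr0 mulf_eq0 orbF => /eqP.
have yk : y t k = y t0 j ^ th j.
  rewrite -psi_X yE (zmonD1 _ _ j) big1 ?mulr1 // => l lj.
  by rewrite -/th e3 // expr0z.
have xE : x = expgz (X t0 j) (th j).
  by apply: psi_inj; rewrite psi_X psi_expgz psi_X.
(* [X_{k;t}] has degree 1 at [t], so the exponent divides 1. *)
have thu : th j * xdeg t (X t0 j) k = 1.
  by rewrite -(xdeg_expgz t) -xE xdeg_X eqxx.
have [th1|th1] : th j = 1 \/ th j = -1.
  clear - thu; move: (th j) (xdeg _ _ _) thu => a b ab.
  have : (a \is a GRing.unit) by apply/unitrP; exists b; rewrite mulrC ab.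
  by rewrite qualifE /= => /orP[] /eqP ->; [left | right].
- by apply: psi_inj; rewrite !psi_X yk th1 expr1z.
have [L LB] := exists_bracket.
(* The exponent -1 would give the common variable eigenvalues s_k and - s_j, against positivity. *)
have xV : x = (X t0 j)^-1%g by apply: psi_inj; rewrite psiV !psi_X yk th1 exprN1.
have := bracket_X LB t k k; rewrite -/x xV (bracketV LB) eA (bracket_X LB) !eqxx !mul1r.
move=> /eqP; rewrite -mulNr => /eqP /(mulIf (A_neq0 t0 j)) => /eqP.
rewrite eq_sym -addr_eq0 -intrD F_int_eq0 => /eqP h.
by have := addr_gt0 (sk_gt0 k) (sk_gt0 j); rewrite h ltxx.
Qed.

Lemma mderiv_map (R R' : comNzRingType) (g : {rmorphism R -> R'}) m (j : 'I_m) p :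
  mderiv j (map_mpoly g p) = map_mpoly g (mderiv j p).
Proof.
apply/mpolyP => l; rewrite mcoeff_deriv !mcoeff_map_mpoly mcoeff_deriv.
by rewrite raddfMn.
Qed.

(** The [y t0] are algebraically independent, so the equation in [F] holds already between integer
    polynomials. *)
Lemma int_euler t0 j (e : sfx n) (s1 : int) :
  s1%:~R = (sk j)%:~R * sfx_dlog (y t0) j e ->
  s1%:~R * (sfx_num e * sfx_den e) = (sk j)%:~R *
    ('X_j * mderiv j (sfx_num e) * sfx_den e - sfx_num e * ('X_j * mderiv j (sfx_den e))).
Proof.
have [_ n0 d0] := psi_frac t0 e.
move: n0 d0; rewrite /sfx_dlog /dlog; move: (sfx_num e) (sfx_den e) => p q p0 q0 h.
have inj : injective (int_eval (y t0)).
  move=> a b hab; apply: toK_inj; rewrite /=.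
  have := phi_eval t0 a; rewrite hab => ha.
  by have /eqP := phi_fun ha (phi_eval t0 b); rewrite tofrac_eq => /eqP.
have {}h : s1%:~R * (int_eval (y t0) p * int_eval (y t0) q) = (sk j)%:~R
    * (y t0 j * int_eval (y t0) (mderiv j p) * int_eval (y t0) q
       - int_eval (y t0) p * (y t0 j * int_eval (y t0) (mderiv j q))).
  by rewrite h; field; rewrite p0 q0.
apply: inj; rewrite !rmorphM rmorphB !rmorphM !rmorph_int.
by rewrite -(int_evalX (y t0) j) in h; exact: h.
Qed.

Lemma X_eq_of_binomial t t0 k j : A t k = A t0 j ->
  exch_binomial iota (S t) k = exch_binomial iota (S t0) j -> X t k = X t0 j.
Proof.
move=> eA eP; pose x := X t k; have [e he] := sfx_gen t0 x.
have A0 := A_neq0 t0; have A1 := A_neq0 t; have cn := coef_neq0 iota.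
have [L LB] := exists_bracket.
have hs : (sk k)%:~R = (sk j)%:~R * sfx_dlog (y t0) j e.
  have hX l : L (X t0 l) (A t0 j) = (l == j)%:R * (sk j)%:~R * A t0 j.
    by rewrite (bracket_X LB); case: eqP => [->|]; rewrite ?mul0r.
  have := bracket_dlog LB e hX; rewrite he -{1}eA (bracket_X LB) eqxx mul1r eA.
  move=> /(mulIf (A0 j)) ->.
  by rewrite (sf_dlogE pos_cone (pos_yhat t0)).
have {hs} eu := int_euler hs.
(* Dividing by the unit [N] of the binomial of [t0] turns the two terms of the binomial of [t] into
   Laurent elements with sum [1 + y t0 j] and ratio [psi x]. *)
pose N := (coef (oplus 1%g (X t0 j)))^-1 * exch_neg (S t0) j.
pose f := coef (X t k / oplus 1 (X t k))%g * exch_pos (S t) k / N.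
pose g := coef (oplus 1 (X t k))^-1%g * exch_neg (S t) k / N.
have N0 : N != 0 by rewrite mulf_neq0 ?invr_eq0 ?exch_neg_neq0.
have fg : f + g = 1 + y t0 j.
  rewrite /f /g -mulrDl -exch_binomial_terms eP exch_binomialE // -/N.
  by rewrite mulrAC divff // mul1r.
have fgx : f = g * psi x.
  rewrite /f /g /x psi_X coefgM.
  transitivity (coef (oplus 1 (X t k))^-1%g * (coef (X t k) * exch_pos (S t) k) / N).
    by rewrite mulrA [coef _ * coef (X t k)]mulrC.
  by rewrite exch_pos_neg // mulrA [RHS]mulrAC.
have LN u z : (forall i, 0 <= u i) -> laurent t0 (coef z * zmon (A t) u / N).
  move=> u0; apply: laurentM.
    by apply: laurentM; [exact: laurent_coef | exact: upper_zmon].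
  rewrite /N invfM invrK exch_negE -zmonN; apply: laurentM; first exact: laurent_coef.
  exact: laurent_zmon.
have Lf : laurent t0 f by rewrite /f exch_posE; apply: LN => i; rewrite le_max lexx orbT.
have Lg : laurent t0 g by rewrite /g exch_negE; apply: LN => i; rewrite le_max lexx orbT.
have [rf [q [a ra]] pf] := phi_laurent Lf; have [rg [q' [a' ra']] pg] := phi_laurent Lg.
have [n0 d0] := toK_neq0 e.
pose NUM : {mpoly K[n]} := map_mpoly (intmul 1) (sfx_num e).
pose DEN : {mpoly K[n]} := map_mpoly (intmul 1) (sfx_den e).
have rE : rf * tofrac DEN = rg * tofrac NUM.
  have := phi_psi t0 e; rewrite he => pe; rewrite fgx in pf.
  by rewrite (phi_fun pf (placeM pg pe)) mulrA divfK // tofrac_eq0.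
have rS : rf + rg = 1 + Yvar j.
  have h := placeD pf pg; rewrite fg in h.
  exact: (phi_fun h (placeD (place1 _ _) (phi_yhat t0 j))).
pose al := q * 'X_[a']; pose be := q' * 'X_[a]; pose m := (a + a')%MM.
have sE : al + be = 'X_[m] * (1 + 'X_j).
  apply/eqP; rewrite -tofrac_eq tofracD !tofracM -ra -ra' mpolyXD tofracM tofracD tofrac1.
  rewrite -/(Yvar j) -rS; apply/eqP; ring.
have cE : al * DEN = be * NUM.
  apply/eqP; rewrite -tofrac_eq !tofracM -ra -ra'; apply/eqP.
  transitivity ((rf * tofrac DEN) * tofrac 'X_[a] * tofrac 'X_[a']); first by ring.
  by rewrite rE; ring.
have one_X : 1 + 'X_j != 0 :> {mpoly K[n]}.
  apply/eqP => /mpolyP /(_ 0%MM) /eqP; rewrite mcoeffD mcoeff1 eqxx mcoeffX mcoeff0.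
  case: (U_(j)%MM =P 0%MM) => [h|_]; last by rewrite addr0 oner_eq0.
  by have := congr1 (fun m : 'X_{1..n} => m j) h; rewrite mnm1E eqxx mnm0E.
have s_n0 : al + be != 0 by rewrite sE mulf_neq0 ?mpolyX_neq0.
have be0 : be != 0.
  apply: contraNneq s_n0 => b0; move: cE; rewrite b0 mul0r => /eqP.
  by rewrite mulf_eq0 (negbTE d0) orbF addr0.
have al0 : al != 0.
  apply: contraNneq be0 => a0'; move: cE; rewrite a0' mul0r => /esym/eqP.
  by rewrite mulf_eq0 (negbTE n0) orbF.
have [s1 hs1 s1p] : exists2 m, sk k = m%:Z & (0 < m)%N.
  by have := sk_gt0 k; case: (sk k) => // i i0; exists i.
have [s0 hs0 s0p] : exists2 m, sk j = m%:Z & (0 < m)%N.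
  by have := sk_gt0 j; case: (sk j) => // i i0; exists i.
pose toKm : {rmorphism {mpoly int[n]} -> {mpoly K[n]}} := map_mpoly (intmul 1 : int -> K).
have tX p : toKm ('X_j * p) = 'X_j * toKm p.
  by transitivity (toKm 'X_j * toKm p); [exact: rmorphM | congr (_ * _); exact: map_mpolyX].
have tD p : toKm (mderiv j p) = mderiv j (toKm p) by rewrite [RHS]mderiv_map.
have eK : s1%:R * (NUM * DEN)
    = s0%:R * ('X_j * mderiv j NUM * DEN - NUM * ('X_j * mderiv j DEN)).
  move: eu; rewrite hs1 hs0 -!pmulrn => /(rmorph_euler toKm).
  by rewrite !tX !tD.
clearbody al be.
(* [al / be] and [NUM / DEN] are the same fraction, so the Euler identity passes from the expression
   [e] to [al] and [be]. *)
have euq : s1%:R * (al * be) = s0%:R * (('X_j * mderiv j al) * be - al * ('X_j * mderiv j be)).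
  have dE := congr1 (mderiv j) cE; rewrite !mderivM in dE.
  apply: (mulfI (mulf_neq0 n0 d0)); rewrite -/NUM -/DEN (wronskian_eq _ _ cE dE) -eK.
  by rewrite mulrCA [in RHS]mulrCA; congr (_ * _); rewrite mulrC.
have [aE bE] := euler_mpoly K_char0 s1p s0p al0 be0 sE euq.
rewrite -/x -he; apply: (@sfx_eq (X t0) e (SfVar j)); rewrite /= mulr1.
apply: toK_inj; rewrite -[RHS]/(toKm ('X_j * sfx_den e)) tX.
by apply: (mulfI (mpolyX_neq0 m)); rewrite -{1}bE -cE aE mulrA.
Qed.

End Pattern.

Theorem theorem7p5
    (K : idomainType) (K_ufd : factorial_domain K) (K_char0 : [pchar K] =i pred0)
    (n : nat)
    (F : fieldType) (iota : {rmorphism grpring K (Qsf n) -> F})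
    (F_ratfun : is_ratfun_field iota n)
    (S : tree n -> seed n (Qsf n) F) (S_pattern : seed_pattern iota S)
    (S_noninv : forall (t : tree n) (k : 'I_n),
       ~ invertible_in iota (exch_binomial iota (S t) k))
    (tstar : tree n) (S_univ : forall i : 'I_n, seedX (S tstar) i = Qsf_var i)
    (t t0 : tree n) (k j : 'I_n) :
  let X u i := seedX (S u) i in
  let A u i := seedA (S u) i in
  [<-> X t k = X t0 j;
       (A t k, exch_pos (S t) k, exch_neg (S t) k)
         = (A t0 j, exch_pos (S t0) j, exch_neg (S t0) j);
       (A t k, exch_support (S t) k) = (A t0 j, exch_support (S t0) j);
       A t k = A t0 j /\ (exch_support (S t) k `<=` cluster (S t0))%fset;
       (A t k, A (nbr k t) k) = (A t0 j, A (nbr j t0) j);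
       A t k = A t0 j
         /\ exch_binomial iota (S t) k = exch_binomial iota (S t0) j].
Proof.
move=> X A.
have [sk sk_star] : exists sk, symmetrizes sk (seedB (S tstar)).
  by apply: skew_symmetrizableP; have [/(_ tstar) []] := S_pattern.
have S_sym u : symmetrizes sk (seedB (S u)).
  move: u; apply: (tree_ind sk_star) => u i; have [_ ->] := S_pattern.
  exact: symmetrizes_mut.
have suppP u i f : reflect (exists2 l, seedB (S u) l i != 0 & f = A u l)
    (f \in exch_support (S u) i).
  by apply: (iffP (imfsetP _ _ _ _)) => -[l hl ->]; exists l.
have [ipos ineg] : (X t k = X t0 j -> exch_pos (S t) k = exch_pos (S t0) j) /\
    (X t k = X t0 j -> exch_neg (S t) k = exch_neg (S t0) j).
  by split=> /(exch_eq K_char0 S_pattern S_univ S_sym) [].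
have inbr := nbr_eq K_char0 S_pattern S_univ S_sym.
have isupp := support_eq K_char0 S_pattern S_univ S_sym.
tfae.
- by move=> e; have [eA _] := inbr _ _ _ _ e; rewrite /A eA ipos // ineg.
- move=> [eA ep en]; rewrite eA; congr (_, _); apply/fsetP => f.
  by apply/suppP/suppP => -[l hl ->]; apply: isupp hl.
- move=> [-> ->]; split=> //; apply/fsubsetP => f /suppP [l _ ->].
  by apply/(imfsetP _ _ _ _); exists l.
- move=> [eA sub].
  (* The inclusion of clusters does not mention the mutated variable; equality of coefficients is
     recovered first and then applied to the mutated seeds. *)
  have e : X t k = X t0 j.
    apply: (X_eq_of_cluster K_char0 S_pattern S_univ S_sym eA) => i hi.
    have /(imfsetP _ _ _ _) [l _ el] : A t i \in cluster (S t0).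
      by apply: (fsubsetP sub); apply/suppP; exists i.
    by exists l.
  by have [_ eA'] := inbr _ _ _ _ e; rewrite eA /A eA'.
- by move=> [eA eA']; split=> //; rewrite !(exch_binomial_A S_pattern) -!/(A _ _) eA eA'.
- by move=> [eA eP]; apply: (X_eq_of_binomial K_char0 S_pattern S_univ S_sym eA).
Qed.
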